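(* There is an algorithm that solves All-Pairs Shortest Path on $n$-vertex graphs of symmetric difference $O(n^{1/3})$ (that is, for any fixed constant $\beta$, graphs $G$ with $\mathrm{sd}(G)\le \beta n^{1/3}$) in time $O(n^{7/3}\log^2 n)$ with high probability, i.e., with probability at least $1-n^{-c}$ for any fixed but arbitrarily large constant $c>0$.
   Context: For vertices $u,v$ of a graph $G$, $\mathrm{sd}_G(u,v)=|(N_G(u)\setminus\{v\})\triangle(N_G(v)\setminus\{u\})|$. The symmetric difference $\mathrm{sd}(G)$ of $G$ is the least nonnegative integer $d$ such that every induced subgraph $H$ of $G$ with at least two vertices contains $u\neq v$ with $\mathrm{sd}_H(u,v)\le d$. All-Pairs Shortest Path asks for all pairwise distances in an unweighted graph. *)

(* Defs.v *)
From HB Require Import structures.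
From mathcomp Require Import all_boot all_order all_algebra.
From mathcomp Require Import all_classical all_reals all_analysis.

Set Implicit Arguments.
Unset Strict Implicit.
Unset Printing Implicit Defensive.

Import Order.TTheory GRing.Theory Num.Theory.

(* A simple graph is a symmetric irreflexive relation [e] on a finite type;
   its induced subgraphs are given by their vertex sets [A]. *)

Section Graphs.
Variables (T : finType) (e : rel T).

Definition nbhd (A : {set T}) (u : T) : {set T} := [set x in A | e u x].

Definition sd_pair (A : {set T}) (u v : T) : nat :=
  let Nu := nbhd A u :\ v in
  let Nv := nbhd A v :\ u in
  #|(Nu :\: Nv) :|: (Nv :\: Nu)|.

Definition sd_at_most (d : nat) : bool :=
  [forall A : {set T}, (1 < #|A|) ==>
    [exists u in A, exists v in A, (u != v) && (sd_pair A u v <= d)]].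

Lemma sd_at_most_exists : exists d, sd_at_most d.
Proof.
exists #|T|; apply/forallP => A; apply/implyP => /card_gt1P[u [v [uA vA uv]]].
apply/existsP; exists u; rewrite uA /=; apply/existsP; exists v.
by rewrite vA uv max_card.
Qed.

Definition sd : nat := ex_minn sd_at_most_exists.

Definition has_walk (u v : T) (k : nat) : bool :=
  [exists p : k.-tuple T, path e u p && (v == last u p)].

Lemma connect_has_walk u v : connect e u v -> exists k, has_walk u v k.
Proof.
case/connectP => p ep vp; exists (size p); apply/existsP; exists (in_tuple p).
by rewrite ep vp eqxx.
Qed.

(* [None] is the infinite distance between different components. *)
Definition distance (u v : T) : option nat :=
  match @idP (connect e u v) with
  | ReflectT uv => Some (ex_minn (connect_has_walk uv))
  | ReflectF _ => None
  end.

End Graphs.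

(* Randomized word RAM with [w]-bit words, programmed by structured commands
   instead of jumps. A program mentions finitely many registers; memory is
   random-access and indexed by words. Arithmetic is modulo [2 ^ w]; division
   by zero gives [0] and [a %% 0 = a]; comparisons give [1] or [0]. *)

Inductive binop := OpAdd | OpSub | OpMul | OpDiv | OpMod | OpEq | OpLt.

Inductive expr :=
| EConst of nat
| EReg of nat
| ELoad of expr
| EBin of binop & expr & expr.

Inductive cmd :=
| CSkip
| CAssign of nat & expr
| CStore of expr & expr           (* address, value *)
| CRand of nat                    (* register := uniformly random word *)
| CSeq of cmd & cmd
| CIf of expr & cmd & cmd         (* nonzero means true *)
| CWhile of expr & cmd.

Record config := Config {
  todo : seq cmd;
  reg : nat -> nat;
  memory : nat -> nat;
  tape : seq nat                  (* random words not drawn yet *)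
}.

Definition update (f : nat -> nat) (a x : nat) : nat -> nat :=
  fun b => if b == a then x else f b.

Definition eval_binop (w : nat) (o : binop) (a b : nat) : nat :=
  match o with
  | OpAdd => (a + b) %% 2 ^ w
  | OpSub => (a + 2 ^ w - b) %% 2 ^ w
  | OpMul => (a * b) %% 2 ^ w
  | OpDiv => a %/ b
  | OpMod => a %% b
  | OpEq => (a == b) %% 2 ^ w
  | OpLt => (a < b) %% 2 ^ w
  end.

Fixpoint eval (w : nat) (r m : nat -> nat) (x : expr) : nat :=
  match x with
  | EConst k => k %% 2 ^ w
  | EReg i => r i
  | ELoad y => m (eval w r m y)
  | EBin o y z => eval_binop w o (eval w r m y) (eval w r m z)
  end.

(* One unit of time. The expressions of a program have bounded size, so that
   evaluating one takes constant time. *)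
Definition step (w : nat) (s : config) : config :=
  let: Config cs r m t := s in
  match cs with
  | [::] => s
  | CSkip :: k => Config k r m t
  | CAssign i x :: k => Config k (update r i (eval w r m x)) m t
  | CStore x y :: k => Config k r (update m (eval w r m x) (eval w r m y)) t
  | CRand i :: k => Config k (update r i (head 0 t)) m (behead t)
  | CSeq c d :: k => Config (c :: d :: k) r m t
  | CIf x c d :: k => Config ((if eval w r m x != 0 then c else d) :: k) r m t
  | CWhile x c :: k =>
      Config (if eval w r m x != 0 then c :: CWhile x c :: k else k) r m t
  end.

Definition halted (s : config) : bool := nilp (todo s).

(* Register [0] holds [n], and cell [i * n + j] with [i, j < n] holds the
   entry [(i, j)] of the adjacency matrix; all the rest is zero. *)

Definition input_reg (n : nat) : nat -> nat :=
  fun i => if i == 0 then n else 0.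

Definition input_mem (n : nat) (e : rel 'I_n) : nat -> nat :=
  fun a => [exists i : 'I_n, exists j : 'I_n, (a == i * n + j) && e i j].

Definition init (P : cmd) (n : nat) (e : rel 'I_n) (t : seq nat) : config :=
  Config [:: P] (input_reg n) (input_mem e) t.

(* The distance matrix is written in the [n * n] cells following the input,
   with [n], which is never a finite distance, for infinity. *)
Definition apsp_output (n : nat) (e : rel 'I_n) (m : nat -> nat) : bool :=
  [forall i : 'I_n, forall j : 'I_n,
    m (n * n + (i * n + j)) == odflt n (distance e i j)].

Definition apsp_solved (P : cmd) (w n : nat) (e : rel 'I_n) (time : nat)
    (t : seq nat) : bool :=
  let s := iter time (step w) (init P e t) in
  halted s && apsp_output e (memory s).

(* Probability that [P] halts within [time] steps with the correct output. At
   most [time] random words are drawn by then, so it is enough to let the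
   tape range uniformly over the sequences of [time] words. *)
Definition apsp_success (R : realType) (P : cmd) (w n : nat) (e : rel 'I_n)
    (time : nat) : R :=
  (#|[set t : time.-tuple 'I_(2 ^ w) |
       apsp_solved P w e time (map (@nat_of_ord _) t)]|%:R
   / #|{: time.-tuple 'I_(2 ^ w)}|%:R)%R.

(* Words of [Theta(log n)] bits. *)
Definition word_size (kappa n : nat) : nat := kappa * (trunc_log 2 n).+1.

(* Main.v *)
(* The output of the algorithm is always correct; only its running time depends on the
   random words. Let N be a power of two close to n, q about n^(1/3) and s = N / q.
   In each of O(s log n) rounds, draw s random columns and merge the alive vertices
   whose rows agree on the alive ones among them, keeping one vertex of each class alive.
   Small symmetric difference provides many alive pairs whose rows differ on O(q) alive
   columns, and each is merged with probability at least 1/2, so the expected number of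
   alive vertices, minus 1, decreases by a factor 1 - Omega(1/s) per round. On the other
   hand, with high probability vertices are only merged when their rows differ on
   O(q log n) alive columns.
   List the vertices so that the clusters of every round are intervals, and restrict the
   rows of the adjacency matrix to the dyadic blocks of this list. Going back from one
   cluster to the rounds before, a new restriction to a block appears only when the block
   is cut by a cluster or meets a column on which merged rows differ; hence there are only
   O(n q log^2 n) distinct nonzero restrictions. Naming them bottom-up by hashing into a
   table turns the graph into a digraph with that many nodes, of outdegree at most 2,
   in which each edge of the graph is a path from a leaf to the root block of its row and
   down to another leaf. Breadth-first search from every vertex takes
   O(n^2 q log^2 n) = O(n^(7/3) log^2 n) steps. *)
Require Import Defs.
From HB Require Import structures.
From mathcomp Require Import all_boot zify.

Set Implicit Arguments.
Unset Strict Implicit.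
Unset Printing Implicit Defensive.

(** * A program logic with time bounds *)

(** The definition of symmetric difference yields a single pair of near twins per induced subgraph,
    whereas a round must merge many vertices. Applying it again after deleting one vertex of the
    pair yields k = q/4 pairs, but each is controlled only outside the deleted columns, whence the
    bound d + 2 + k on its differing columns. As d + 2 <= q/4, a sample of s = N/q columns separates
    such a pair with probability at most 1/2. Patterns are counted only when neither empty nor full
    on their block, since none of this kind is left once there is a single cluster. A vertex lost in
    a round pays for its at most [Delta] row differences and, by symmetry, for as many column
    differences. All leaves of the tree of blocks have the same depth, so each edge becomes a path
    of exactly L + 1 arcs and distances are merely scaled. Memory of polynomial size, initially
    zero, allows tables addressed directly by the key. A last merge without samples makes the vertex
    order a permutation on every tape, so that randomness affects only the number of nodes
    visited. *)

(* Memory is used through arrays: cell [i] of array [k] is at the address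
   [k * B + i], where [B] is kept in register 1. *)
Inductive aexpr :=
| AConst of nat
| AReg of nat
| ALoad of nat & aexpr
| ABin of binop & aexpr & aexpr.

Definition address (k : nat) (i : expr) : expr :=
  EBin OpAdd (EBin OpMul (EConst k) (EReg 1)) i.

Fixpoint compile (x : aexpr) : expr :=
  match x with
  | AConst k => EConst k
  | AReg i => EReg i
  | ALoad k y => ELoad (address k (compile y))
  | ABin o y z => EBin o (compile y) (compile z)
  end.

Definition exact_binop (o : binop) (a b : nat) : nat :=
  match o with
  | OpAdd => a + b
  | OpSub => a - b
  | OpMul => a * b
  | OpDiv => a %/ b
  | OpMod => a %% b
  | OpEq => a == b
  | OpLt => a < b
  end.

Fixpoint aeval (r : nat -> nat) (F : nat -> nat -> nat) (x : aexpr) : nat :=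
  match x with
  | AConst k => k
  | AReg i => r i
  | ALoad k y => F k (aeval r F y)
  | ABin o y z => exact_binop o (aeval r F y) (aeval r F z)
  end.

Definition set_array (F : nat -> nat -> nat) (k i v : nat) : nat -> nat -> nat :=
  fun k' i' => if (k' == k) && (i' == i) then v else F k' i'.

Lemma set_array_neq F k i v k' : k' != k -> set_array F k i v k' = F k'.
Proof. by rewrite /set_array => /negbTE ->. Qed.

Declare Scope aexpr_scope.
Delimit Scope aexpr_scope with A.
Bind Scope aexpr_scope with aexpr.
Notation "# k" := (AConst k) (at level 5, format "# k") : aexpr_scope.
Notation "% i" := (AReg i) (at level 5, format "% i") : aexpr_scope.
Notation "k $[ x ]" := (ALoad k x) (at level 6, x at level 99, format "k $[ x ]") : aexpr_scope.
Infix "+" := (ABin OpAdd) : aexpr_scope.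
Infix "-" := (ABin OpSub) : aexpr_scope.
Infix "*" := (ABin OpMul) : aexpr_scope.
Infix "%/" := (ABin OpDiv) : aexpr_scope.
Infix "%%" := (ABin OpMod) : aexpr_scope.
Infix "==" := (ABin OpEq) : aexpr_scope.
Infix "<" := (ABin OpLt) : aexpr_scope.

Definition assign (i : nat) (x : aexpr) : cmd := CAssign i (compile x).
Definition store (k : nat) (x y : aexpr) : cmd :=
  CStore (address k (compile x)) (compile y).
Definition cond (x : aexpr) (c d : cmd) : cmd := CIf (compile x) c d.
Definition while (x : aexpr) (c : cmd) : cmd := CWhile (compile x) c.
Arguments assign i x%_A.
Arguments store k x%_A y%_A.
Arguments cond x%_A c d.
Arguments while x%_A c.
Definition for_loop (i j : nat) (c : cmd) : cmd :=
  CSeq (assign i #0) (while (%i < %j)%A (CSeq c (assign i (%i + #1)))).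

Declare Scope cmd_scope.
Delimit Scope cmd_scope with C.
Bind Scope cmd_scope with cmd.
Notation "i ::= x" := (assign i x) (at level 70) : cmd_scope.
Notation "'put' k [ x ] <~ y" := (store k x y)
  (at level 70, k at level 0, x at level 99, y at level 69) : cmd_scope.
Notation "c ;; d" := (CSeq c d) (at level 81, right associativity) : cmd_scope.

Section Logic.
Variables (w B : nat) (G : (nat -> nat) -> Prop).
Local Notation W := (2 ^ w).
Hypothesis (W_gt1 : 1 < W) (B_gt0 : 0 < B) (BW : 16 * B <= W).

(** The side conditions under which arithmetic modulo [2 ^ w] agrees with [aeval], which computes on
    unbounded naturals. Division, remainder and comparisons cannot overflow; a load must hit one of
    the 16 arrays at an index below [B]. *)
Fixpoint safe (r : nat -> nat) (F : nat -> nat -> nat) (x : aexpr) : Prop :=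
  match x with
  | AConst k => k < W
  | AReg _ => True
  | ALoad k y => [/\ safe r F y, r 1 = B, k < 16 & aeval r F y < B]
  | ABin o y z =>
    let a := aeval r F y in let b := aeval r F z in
    [/\ safe r F y, safe r F z &
      match o with
      | OpAdd => a + b < W
      | OpSub => b <= a < W
      | OpMul => a * b < W
      | _ => True
      end]
  end.

Definition represents (m : nat -> nat) (F : nat -> nat -> nat) : Prop :=
  forall k i, k < 16 -> i < B -> m (k * B + i) = F k i.

Lemma eval_address r m k x i : r 1 = B -> k < 16 -> eval w r m x = i -> i < B ->
  eval w r m (address k x) = k * B + i.
Proof.
move=> rB k16 E iB; rewrite /= E rB.
have kB : k.+1 * B <= W by apply: leq_trans BW; rewrite leq_mul2r k16 orbT.
have kW : k < W.
  exact: leq_trans (leq_pmulr _ B_gt0) kB.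
have kBW : k * B + i < W by apply: leq_trans kB; rewrite mulSnr ltn_add2l.
by rewrite !modn_small //; lia.
Qed.

Lemma eval_compile r m F x : represents m F -> safe r F x ->
  eval w r m (compile x) = aeval r F x.
Proof.
move=> mF; elim: x => [k|i|k y IH|o y IHy z IHz] //=.
- by move=> kW; rewrite modn_small.
- move=> [sy rB k16 yB]; have := eval_address rB k16 (IH sy) yB.
  by rewrite /= => ->; exact: mF.
- move=> [sy sz]; rewrite (IHy sy) (IHz sz); case: o => //=; try by move=> ?; rewrite modn_small.
  + move=> /andP[ba aW]; have -> : aeval r F y + W - aeval r F z = (aeval r F y - aeval r F z) + W by lia.
    rewrite modnDr modn_small //; move: (aeval r F y) (aeval r F z) ba aW => a b; lia.
  + by move=> _; rewrite modn_small //; exact: leq_ltn_trans (leq_b1 _) W_gt1.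
  + by move=> _; rewrite modn_small //; exact: leq_ltn_trans (leq_b1 _) W_gt1.
Qed.

(* [wp c k r F t Q]: from registers [r], arrays [F] and tape [t], the command
   [c] stops within [k] steps in a state satisfying [Q], keeping [G]. *)
Definition wp (c : cmd) (k : nat) r F (t : seq nat)
    (Q : (nat -> nat) -> (nat -> nat -> nat) -> seq nat -> Prop) : Prop :=
  G r -> forall m, represents m F ->
  exists j r' m' F' t',
    [/\ j <= k, forall K, iter j (step w) (Config (c :: K) r m t) = Config K r' m' t',
      represents m' F', G r' & Q r' F' t'].

Lemma wp_G c k r F t Q : (G r -> wp c k r F t Q) -> wp c k r F t Q.
Proof. by move=> H g; exact: H. Qed.

Lemma wp_weaken c k k' r F t (Q Q' : _ -> _ -> _ -> Prop) :
  wp c k r F t Q -> k <= k' -> (forall r' F' t', G r' -> Q r' F' t' -> Q' r' F' t') ->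
  wp c k' r F t Q'.
Proof.
move=> H kk' QQ' g m mF; have [j [r' [m' [F' [t' [jk ? ? gr' q]]]]]] := H g m mF.
by exists j, r', m', F', t'; split=> //; [exact: leq_trans kk'|exact: QQ'].
Qed.

Lemma wp_le c k k' r F t Q : wp c k r F t Q -> k <= k' -> wp c k' r F t Q.
Proof. by move=> H kk'; apply: wp_weaken H kk' _. Qed.

Lemma wp_skip r F t (Q : _ -> _ -> _ -> Prop) : Q r F t -> wp CSkip 1 r F t Q.
Proof. by move=> q g m mF; exists 1, r, m, F, t. Qed.

Lemma wp_assign i x r F t (Q : _ -> _ -> _ -> Prop) :
  (forall v, G r -> G (update r i v)) -> safe r F x ->
  Q (update r i (aeval r F x)) F t -> wp (assign i x) 1 r F t Q.
Proof.
move=> Gi sx q g m mF; exists 1, (update r i (aeval r F x)), m, F, t.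
by split=> // [K|]; [rewrite /= (eval_compile mF)|exact: Gi].
Qed.

Lemma wp_store k x y r F t (Q : _ -> _ -> _ -> Prop) :
  safe r F (ALoad k x) -> safe r F y ->
  Q r (set_array F k (aeval r F x) (aeval r F y)) t -> wp (store k x y) 1 r F t Q.
Proof.
move=> [sx rB k16 xB] sy q g m mF.
exists 1, r, (update m (k * B + aeval r F x) (aeval r F y)),
  (set_array F k (aeval r F x) (aeval r F y)), t.
split=> // [K|k' i' k'16 i'B].
  have /= -> := eval_address rB k16 (eval_compile mF sx) xB.
  by rewrite (eval_compile mF sy).
rewrite /update /set_array -mF //.
suff -> : (k' * B + i' == k * B + aeval r F x) = (k' == k) && (i' == aeval r F x) by [].
apply/eqP/andP=> [E|[/eqP -> /eqP ->] //].
have := congr1 (divn^~ B) E; rewrite /= !divnMDl // !divn_small // !addn0 => kk.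
by move: E; rewrite kk => /addnI ->; rewrite !eqxx.
Qed.

Lemma wp_rand i r F t (Q : _ -> _ -> _ -> Prop) :
  (forall v, G r -> G (update r i v)) ->
  Q (update r i (head 0 t)) F (behead t) -> wp (CRand i) 1 r F t Q.
Proof.
by move=> Gi q g m mF; exists 1, (update r i (head 0 t)), m, F, (behead t); split=> //; exact: Gi.
Qed.

Lemma wp_seq c d k l r F t Q :
  wp c k r F t (fun r' F' t' => wp d l r' F' t' Q) -> wp (CSeq c d) (k + l).+1 r F t Q.
Proof.
move=> H g m mF; have [j [r' [m' [F' [t' [jk E mF' gr' q]]]]]] := H g m mF.
have [j' [r2 [m2 [F2 [t2 [jk' E' mF2 gr2 q2]]]]]] := q gr' _ mF'.
exists (j' + j).+1, r2, m2, F2, t2; split=> //; first by rewrite ltnS addnC leq_add.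
by move=> K; rewrite iterSr iterD /= E E'.
Qed.

Lemma wp_cond x c d k r F t Q : safe r F x ->
  (aeval r F x != 0 -> wp c k r F t Q) -> (aeval r F x = 0 -> wp d k r F t Q) ->
  wp (cond x c d) k.+1 r F t Q.
Proof.
move=> sx H1 H0 g m mF; have E := eval_compile mF sx.
have [z|nz] := eqVneq (aeval r F x) 0.
- have [j [r' [m' [F' [t' [jk E' mF' gr' q]]]]]] := H0 z g m mF.
  exists j.+1, r', m', F', t'; split=> // K.
  by rewrite iterSr /= E z E'.
- have [j [r' [m' [F' [t' [jk E' mF' gr' q]]]]]] := H1 nz g m mF.
  exists j.+1, r', m', F', t'; split=> // K.
  by rewrite iterSr /= E nz E'.
Qed.

(** The index of the invariant counts the iterations that may still occur; a true test forces it to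
    be positive. The loop may stop early, hence the existential index in the postcondition. *)
Lemma wp_while x c k (I : nat -> _ -> _ -> _ -> Prop) j r F t :
  (forall j r F t, G r -> I j r F t -> safe r F x /\
     (aeval r F x != 0 -> exists2 j', j = j'.+1 & wp c k r F t (I j'))) ->
  I j r F t ->
  wp (while x c) (j * k.+1).+1 r F t (fun r' F' t' => (exists j', I j' r' F' t') /\ aeval r' F' x = 0).
Proof.
move=> H; elim: j r F t => [|j IH] r F t i g m mF; have [sx Hb] := H _ _ _ _ g i;
  have E := eval_compile mF sx.
- have [z|nz] := eqVneq (aeval r F x) 0; last by have [] := Hb nz.
  exists 1, r, m, F, t; split=> // [K|]; first by rewrite /= E z.
  by split=> //; exists 0.
- have [z|nz] := eqVneq (aeval r F x) 0.
    exists 1, r, m, F, t; split=> // [K|]; first by rewrite /= E z.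
    by split=> //; exists j.+1.
  have [j' [jj'] Hc] := Hb nz.
  have [j1 [r1 [m1 [F1 [t1 [jk1 E1 mF1 g1 i1]]]]]] := Hc g m mF.
  rewrite -jj' in i1.
  have [j2 [r2 [m2 [F2 [t2 [jk2 E2 mF2 g2 q2]]]]]] := IH _ _ _ i1 g1 m1 mF1.
  exists (j2 + j1).+1, r2, m2, F2, t2; split=> //; first by lia.
  by move=> K; rewrite iterSr /= E nz iterD E1 E2.
Qed.

(** Each iteration adds 3 steps to the body: the test, the unfolding of the sequence and the
    increment. The final 3 are the initialisation, its sequence and the failing test. Register [j]
    is read again at each test, so the invariant must fix it. *)
Lemma wp_for i j c k nb (I : nat -> _ -> _ -> _ -> Prop) r F t :
  nb < W -> (forall r v, G r -> G (update r i v)) ->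
  (forall x r F t, G r -> I x r F t -> r j = nb) ->
  (G r -> I 0 (update r i 0) F t) ->
  (forall x r F t, G r -> x < nb -> r i = x -> I x r F t ->
     wp c k r F t (fun r' F' t' => r' i = x /\ I x.+1 (update r' i x.+1) F' t')) ->
  wp (for_loop i j c) (nb * (k + 3) + 3) r F t (I nb).
Proof.
move=> nbW Gi Ij I0 H; pose J y r F t := exists x, [/\ x <= nb, y = nb - x, r i = x & I x r F t].
apply: wp_G => g; apply: wp_le.
  apply: wp_seq; apply: wp_assign; [exact: Gi|exact: ltnW|].
  apply: (@wp_weaken _ _ _ _ _ _ (fun r' F' t' => (exists j', J j' r' F' t') /\
     aeval r' F' (AReg i < AReg j)%A = 0)); last 2 first.
  - exact: leqnn.
  - move=> r' F' t' g' [[_ [x [xn _ ri Ix]]]] /=.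
    rewrite (Ij _ _ _ _ g' Ix) ri; case: ltnP => // nx _.
    by rewrite (_ : nb = x) //; apply/eqP; rewrite eqn_leq nx.
  apply: (@wp_while _ _ k.+2 J nb); last by exists 0; rewrite subn0 /update eqxx /=; split=> //; exact: I0.
  move=> y r' F' t' g' [x [xn -> ri Ix]]; split=> //=.
  rewrite (Ij _ _ _ _ g' Ix) ri; case: ltnP => // xnb _; exists (nb - x.+1); first by lia.
  apply: wp_le.
    apply: wp_seq; apply: wp_weaken (H _ _ _ _ g' xnb ri Ix) (leqnn _) _ => r2 F2 t2 g2 [r2i Ix2].
    apply: wp_assign; [exact: Gi|by rewrite /= r2i; split=> //; lia|].
    by rewrite /= r2i addn1; exists x.+1; split=> //; rewrite /update eqxx.
  by lia.
nia.
Qed.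

End Logic.

(** * Dyadic blocks of an ordered vertex set *)

Section Blocks.
Variables (V : finType) (L : nat) (pos : V -> nat).
Local Notation N := (2 ^ L).
Hypothesis pos_lt : forall v, pos v < N.

(* Blocks are numbered as in a binary heap: the root is block 1, the children of
   block [b] are [2 b] and [2 b + 1], and the leaf of [v] is [N + pos v]. *)
Definition height (b : nat) : nat := L - trunc_log 2 b.
Definition block (b : nat) : {set V} :=
  [set v | (N + pos v) %/ 2 ^ height b == b].

Lemma pow2L_gt0 : 0 < N. Proof. by rewrite expn_gt0. Qed.

Lemma height_lt b : 0 < b < N -> 0 < height b.
Proof.
move=> /andP[b0 bN]; rewrite /height subn_gt0.
by have := trunc_logP (isT : 1 < 2) b0; move/leq_ltn_trans/(_ bN); rewrite ltn_exp2l.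
Qed.

Lemma height_child b c : 0 < b < N -> c < 2 -> height b = (height (b.*2 + c)).+1.
Proof.
move=> bN c2; have := height_lt bN; rewrite /height.
have -> : trunc_log 2 (b.*2 + c) = (trunc_log 2 b).+1; last by lia.
rewrite trunc_log2S; last by lia.
by congr (trunc_log 2 _).+1; lia.
Qed.

Lemma block_child b c v : 0 < b < N -> c < 2 -> v \in block (b.*2 + c) -> v \in block b.
Proof.
move=> bN c2; rewrite !inE (height_child bN c2) => /eqP E.
by rewrite expnS mulnC divnMA E; lia.
Qed.

Lemma block_leaf u v : (v \in block (N + pos u)) = (pos v == pos u).
Proof.
rewrite inE /height (_ : trunc_log 2 _ = L) ?subnn ?divn1 ?eqn_add2l //.
by apply: trunc_log_eq; rewrite // leq_addr /= expnS; have := pos_lt u; lia.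
Qed.

(** A block containing [v] is determined by its height, being [(N + pos v) %/ 2 ^ height b], and
    there are [L.+1] heights. *)
Lemma sum_block v : \sum_(b < 2 * N) (v \in block b) <= L.+1.
Proof.
rewrite -big_mkcond /= sum1dep_card -[X in _ <= X]card_ord.
have hL (b : 'I_(2 * N)) : height b < L.+1 by rewrite ltnS leq_subr.
pose h (b : 'I_(2 * N)) : 'I_L.+1 := Ordinal (hL b).
rewrite -(card_in_imset (f := h)); first exact: max_card.
move=> b b'; rewrite !inE => /eqP E /eqP E' /(congr1 val) /= hh.
by apply/val_inj; rewrite /= -E -E' hh.
Qed.

Definition convex (T : {set V}) : Prop :=
  forall u v w, u \in T -> w \in T -> pos u <= pos v <= pos w -> v \in T.

Definition cuts (T : {set V}) (b : nat) : bool :=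
  ~~ [disjoint T & block b] && ~~ (block b \subset T).

(* A block cut by an interval contains one of its ends. *)
Lemma sum_cuts T : convex T -> \sum_(b < 2 * N) cuts T b <= 2 * L.+1.
Proof.
move=> cT; have [->|[x xT]] := set_0Vmem T.
  rewrite big1 // => b _; rewrite /cuts (_ : [disjoint set0 & _]) //.
  by rewrite -setI_eq0 set0I.
case: (arg_minnP pos xT) => u uT umin; case: (arg_maxnP pos xT) => w wT wmax.
have cutP b : cuts T b -> (u \in block b) || (w \in block b).
  move=> /andP[/pred0Pn[v /= /andP[vT vb]] /subsetPn[z zb zT]].
  apply: contraNT zT; rewrite negb_or => /andP[ub wb].
  apply: (cT u z w) => //; move: vb zb ub wb (umin v vT) (wmax v vT); rewrite !inE.
  move: (2 ^ height b) => k /eqP vb /eqP zb ub wb uv vw.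
  apply/andP; split; rewrite leqNgt; apply/negP => lt.
  - case/negP: ub; rewrite eqn_leq -{1}vb -zb.
    by rewrite !leq_div2r // leq_add2l // ltnW.
  - case/negP: wb; rewrite eqn_leq -{1}zb -vb.
    by rewrite !leq_div2r // leq_add2l // ltnW.
apply: (@leq_trans (\sum_(b < 2 * N) ((u \in block b) + (w \in block b)))).
  by apply: leq_sum => b _; have := cutP b; case: (cuts T b) => // /(_ isT); do 2!case: (_ \in _).
by rewrite big_split /= (mul2n L.+1) -addnn leq_add ?sum_block.
Qed.

Definition pattern (f : V -> bool) (b : nat) : {set V} := [set v in block b | f v].

(** Empty and full patterns are discarded: there are at most two of them per block, and they are
    what a pattern degenerates to when all columns of the block have become equal. *)
Definition mixed (A : {set V}) (f : V -> V -> bool) (b : nat) : {set {set V}} :=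
  [set pattern (f x) b | x in A] :\ set0 :\ block b.

(* Rows modified on sets that do not cut a block and on which the new row is
   constant keep their pattern on the block or become constant there. *)
Lemma mixed_step (A A' : {set V}) (f g : V -> V -> bool) (o : V -> V)
    (D : V -> {set V}) (T : V -> {set V}) b :
  (forall x, x \in A -> o x \in A') ->
  (forall x v, x \in A -> f x v != g (o x) v -> exists2 y, y \in D x & v \in T y) ->
  (forall x y v v', x \in A -> y \in D x -> v \in T y -> v' \in T y -> f x v = f x v') ->
  #|mixed A f b| <= #|mixed A' g b| + \sum_(x in A) \sum_(y in D x) cuts (T y) b.
Proof.
move=> oA fg fT.
(* Only rows with a modification that cuts the block can contribute a pattern not already counted
   for [g]. *)
pose C := [set x in A | [exists y in D x, cuts (T y) b]].
have sub : mixed A f b \subset mixed A' g b :|: [set pattern (f x) b | x in C].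
  apply/subsetP => P; rewrite !inE => /and3P[Pb P0 /imsetP[x xA PE]].
  have [xC|xC] := boolP (x \in C); first by rewrite PE imset_f ?orbT.
  rewrite Pb P0 /=; apply/orP; left; apply/imsetP; exists (o x); first exact: oA.
  move: xC; rewrite inE xA /= => /existsPn nocut.
  have dis y : y \in D x -> [disjoint T y & block b].
    move=> yD; apply: contraT => dj.
    have := nocut y; rewrite yD /= /cuts dj /= negbK => /subsetP bT.
    have /pred0Pn[v /= /andP[vT vb]] := dj.
    case fxv: (f x v); [case/negP: Pb|case/negP: P0]; rewrite PE; apply/eqP/setP => z; rewrite !inE.
    - have [zb|//] := boolP (_ == b); rewrite (fT x y z v) ?fxv // bT //.
      by rewrite inE.
    - have [zb|//] := boolP (_ == b); rewrite (fT x y z v) ?fxv // bT //.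
      by rewrite inE.
  rewrite PE; apply/setP => z; rewrite !inE; have [zb|//] := boolP (_ == b).
  apply/eqP; apply: contraT => /fg -/(_ xA)[y yD zT].
  have := dis y yD; rewrite disjoint_sym => /disjointFr/(_ _); move=> /(_ z).
  by rewrite inE zb zT => /(_ isT).
apply: leq_trans (subset_leq_card sub) _; apply: leq_trans (leq_card_setU _ _) _.
rewrite leq_add2l; apply: leq_trans (leq_imset_card _ _) _.
rewrite -sum1_card (eq_bigl (fun x => (x \in A) && [exists y in D x, cuts (T y) b])); last by move=> x; rewrite inE.
rewrite big_mkcondr; apply: leq_sum => x xA; case: existsP => // -[y /andP[yD cy]].
by rewrite (bigD1 y) //= cy.
Qed.

End Blocks.

(** * Counting block patterns along a sequence of merging rounds *)

Section Chain.
Variables (V : finType) (e : rel V) (L : nat) (pos : V -> nat).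
Local Notation N := (2 ^ L).
Hypotheses (pos_lt : forall v, pos v < N) (sym_e : symmetric e).
Variables (r lead : nat -> V -> V) (Delta : nat).

(** A clustering is given by the map from a vertex to its representative; the maps used are
    idempotent, so the representatives are the fixed points. *)
Definition alive (f : V -> V) : {set V} := [set x | f x == x].
Definition row_diff (A : {set V}) (x y : V) : {set V} :=
  [set z in A | e x z != e y z].

Hypotheses (r0 : forall u, r 0 u = u)
  (rS : forall j u, r j.+1 u = lead j (r j u))
  (r_alive : forall j u, r j u \in alive (r j))
  (lead_r : forall j u, u \in alive (r j) -> lead j u \in alive (r j)).

Lemma alive_succ j : alive (r j.+1) \subset alive (r j).
Proof.
apply/subsetP => x; rewrite inE => /eqP <-; rewrite rS.
by apply: lead_r; apply: r_alive.
Qed.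

(** The matrix of round [j] keeps the rows of alive vertices, and each column is a copy of the
    column of its representative. For [j = 0] it is the adjacency matrix. *)
Local Notation mixed_count j :=
  (\sum_(b < 2 * N) #|mixed L pos (alive (r j)) (fun x v => e x (r j v)) b|).

(* Splitting the clusters of round [j.+1] into those of round [j], first for the
   columns and then for the rows. *)
Lemma mixed_round j :
  (forall y, convex pos [set u | r j u == y]) ->
  (forall x, x \in alive (r j) -> #|row_diff (alive (r j)) x (lead j x)| <= Delta) ->
  mixed_count j + #|alive (r j.+1)| * (Delta * (4 * L.+1))
    <= mixed_count j.+1 + #|alive (r j)| * (Delta * (4 * L.+1)).
Proof.
move=> cvx small.
pose A := alive (r j); pose A' := alive (r j.+1).
pose T y := [set u | r j u == y].
pose Dr x := row_diff A x (lead j x).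
pose Dc p := [set y in A | e p y != e p (lead j y)].
have A'A : A' \subset A := alive_succ j.
have rows b : #|mixed L pos A (fun x v => e x (r j v)) b| <=
    #|mixed L pos A' (fun x v => e x (r j v)) b| + \sum_(x in A) \sum_(y in Dr x) cuts L pos (T y) b.
  apply: (@mixed_step _ _ _ _ _ _ _ (lead j)).
  - by move=> x; rewrite [in X in X -> _]inE => /eqP <-; rewrite -rS; exact: r_alive.
  - move=> x v xA ne; exists (r j v); last by rewrite inE.
    by rewrite inE ne andbT; exact: r_alive.
  - by move=> x y v v' _ _; rewrite !inE => /eqP -> /eqP ->.
have cols b : #|mixed L pos A' (fun x v => e x (r j v)) b| <=
    #|mixed L pos A' (fun x v => e x (r j.+1 v)) b| + \sum_(x in A') \sum_(y in Dc x) cuts L pos (T y) b.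
  apply: (@mixed_step _ _ _ _ _ _ _ id) => //.
  - move=> x v xA /=; rewrite rS => ne; exists (r j v); last by rewrite inE.
    by rewrite inE ne andbT; exact: r_alive.
  - by move=> x y v v' _ _; rewrite !inE => /eqP -> /eqP ->.
(* A vertex that stays alive is its own leader and has no row difference, so only the vertices lost
   in the round are charged. *)
have sumD : \sum_(x in A) #|Dr x| <= (#|A| - #|A'|) * Delta.
  rewrite -cardsDS // -sum_nat_const.
  rewrite (bigID (fun x => x \in A')) /= big1 ?add0n; last first.
    move=> x /andP[xA]; rewrite inE rS => /eqP xE; apply/eqP; rewrite cards_eq0.
    have rx : r j x = x by apply/eqP; move: xA; rewrite inE.
    by rewrite rx in xE; rewrite /Dr xE; apply/eqP/setP => z; rewrite !inE eqxx andbF.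
  rewrite [leqRHS](eq_bigl (fun x => (x \in A) && (x \notin A'))); last first.
    by move=> x; rewrite in_setD andbC.
  by apply: leq_sum => x /andP[xA _]; exact: small.
(* Double counting: by symmetry of [e], a change of row [p] at column [y] is a difference at column
   [p] between the rows of [y] and of its leader. *)
have sumDc : \sum_(x in A') #|Dc x| <= \sum_(x in A) #|Dr x|.
  under eq_bigr do rewrite -sum1_card; under [leqRHS]eq_bigr do rewrite -sum1_card.
  rewrite (exchange_big_dep (mem A)) /=; last by move=> x y _; rewrite inE => /andP[].
  apply: leq_sum => y yA; rewrite !sum1_card; apply: subset_leq_card.
  apply/subsetP => p; rewrite -!topredE /= => /andP[/(subsetP A'A) pA].
  rewrite !inE => /andP[_ pD]; change (p \in Dr y); move: pA; rewrite !inE => ->; rewrite (sym_e y p) (sym_e (lead j y) p) pD; exact: isT.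
(* A changed column [y] stands for the convex cluster [T y], which cuts at most [2 * L.+1]
   blocks. *)
have sumcut (B : {set V}) (D : V -> {set V}) :
    \sum_(b < 2 * N) \sum_(x in B) \sum_(y in D x) cuts L pos (T y) b <= (\sum_(x in B) #|D x|) * (2 * L.+1).
  rewrite exchange_big big_distrl /=; apply: leq_sum => x _.
  rewrite exchange_big /= -sum_nat_const; apply: leq_sum => z _.
  exact: sum_cuts (cvx z).
have Hr : mixed_count j <= \sum_(b < 2 * N) #|mixed L pos A' (fun x v => e x (r j v)) b| +
    \sum_(b < 2 * N) \sum_(x in A) \sum_(y in Dr x) cuts L pos (T y) b.
  by rewrite -big_split; apply: leq_sum => b _; exact: rows.
have Hc : \sum_(b < 2 * N) #|mixed L pos A' (fun x v => e x (r j v)) b| <= mixed_count j.+1 +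
    \sum_(b < 2 * N) \sum_(x in A') \sum_(y in Dc x) cuts L pos (T y) b.
  by rewrite -big_split; apply: leq_sum => b _; exact: cols.
have H1 := sumcut A Dr; have H2 := sumcut A' Dc.
have AA : #|A'| <= #|A| := subset_leq_card A'A.
move: Hr Hc H1 H2 sumD sumDc AA; rewrite -/A -/A'.
move: (\sum_(b < _) #|_|) (\sum_(b < _) #|_|) (\sum_(b < _) #|_|) => m1 m2 m3.
move: (\sum_(b < _) \sum_(x in A) _) (\sum_(b < _) \sum_(x in A') _) => t1 t2.
move: (\sum_(x in A) _) (\sum_(x in A') _) #|A| #|A'| => s1 s2 a a' h1 h2 h3 h4 h5 h6 h7.
have h8 : s1 * (4 * L.+1) <= (a - a') * (Delta * (4 * L.+1)).
  by rewrite [leqRHS]mulnA leq_mul2r h5 orbT.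
have h9 : s2 * (2 * L.+1) <= s1 * (2 * L.+1) by rewrite leq_mul2r h6 orbT.
rewrite mulnBl in h8; have : a' * (Delta * (4 * L.+1)) <= a * (Delta * (4 * L.+1)) by rewrite leq_mul2r h7 orbT.
lia.
Qed.

(** The rounds telescope: the total charge is proportional to the number of vertices that disappear,
    and at the end every row is constant, which leaves no mixed pattern. *)
Lemma mixed_chain T :
  (forall j, j < T -> forall y, convex pos [set u | r j u == y]) ->
  (forall j, j < T -> forall x, x \in alive (r j) ->
     #|row_diff (alive (r j)) x (lead j x)| <= Delta) ->
  #|alive (r T)| = 1 ->
  \sum_(b < 2 * N) #|mixed L pos setT e b| <= #|V| * (Delta * (4 * L.+1)).
Proof.
move=> cvx small aT.
have chain j : j <= T -> mixed_count 0 + #|alive (r j)| * (Delta * (4 * L.+1)) <=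
    mixed_count j + #|alive (r 0)| * (Delta * (4 * L.+1)).
  elim: j => // j IH jT; have := IH (ltnW jT); have := mixed_round (cvx j jT) (small j jT).
  by lia.
have := chain T (leqnn T); rewrite [X in _ <= X + _]big1.
  rewrite add0n => /(leq_trans (leq_addr _ _)).
  have -> : alive (r 0) = setT by apply/setP => x; rewrite !inE r0 eqxx.
  rewrite cardsT; congr (_ <= _); apply: eq_bigr => b _; congr #|pred_of_set _|.
  rewrite /mixed; congr (_ :\ _ :\ _); apply: eq_in_imset => x _.
  by apply/setP => v; rewrite !inE r0.
move=> b _; apply/eqP; rewrite cards_eq0 -subset0; apply/subsetP => P.
rewrite !inE => /and3P[Pb P0 /imsetP[x xA PE]].
have rc v v' : r T v = r T v'.
  by have /eqP/cards1P[z zE] := aT; have := r_alive T v; have := r_alive T v'; rewrite zE !inE => /eqP -> /eqP ->.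
case exv: (e x (r T x)); [case/eqP: Pb|case/eqP: P0]; rewrite PE; apply/setP => v; rewrite !inE (rc v x) exv ?andbT ?andbF //.
Qed.

(** The only nonempty pattern that is not mixed is the full one, hence one more per block index. *)
Lemma pattern_count : \sum_(b < 2 * N) #|[set pattern L pos (e x) b | x : V] :\ set0| <=
  2 * N + \sum_(b < 2 * N) #|mixed L pos setT e b|.
Proof.
rewrite -[X in X + _]muln1 -[X in X * 1]card_ord -sum_nat_const -big_split /=.
apply: leq_sum => b _.
rewrite (cardsD1 (block L pos b)) leq_add ?leq_b1 //.
apply: subset_leq_card; rewrite /mixed; apply/subsetP => P; rewrite !inE => /and3P[-> -> /imsetP[x _ ->]] /=.
exact: imset_f.
Qed.

End Chain.

(** * Merging rows that agree on sampled columns *)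

Section Merge.
Variables (n : nat) (e : rel 'I_n).
Implicit Types (rep : 'I_n -> 'I_n) (ys : seq nat).

(** Samples are natural numbers, not vertices: a value that is not the index of an alive vertex
    imposes no condition. *)
Definition agree rep ys (x y : 'I_n) : bool :=
  all (fun a : nat => [forall z in alive rep, (z == a :> nat) ==> (e x z == e y z)]) ys.

(** Taking the least alive vertex of the class makes the leader the first one met by the scan of the
    program. *)
Definition leader rep ys (x : 'I_n) : 'I_n :=
  [arg min_(z < x | (z \in alive rep) && agree rep ys z x) (z : nat)].

Definition merge_reps rep ys (u : 'I_n) : 'I_n := leader rep ys (rep u).

Lemma agree_refl rep ys x : agree rep ys x x.
Proof. by apply/allP => a _; apply/forall_inP => z _; rewrite eqxx implybT. Qed.

Lemma agree_sym rep ys x y : agree rep ys x y = agree rep ys y x.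
Proof. by apply: eq_all => a; apply: eq_forallb => z; rewrite [e x z == _]eq_sym. Qed.

Lemma agree_trans rep ys y x z : agree rep ys x y -> agree rep ys y z -> agree rep ys x z.
Proof.
move=> /allP xy /allP yz; apply/allP => a ays; apply/forall_inP => u uA.
have /forall_inP/(_ u uA) := xy a ays; have /forall_inP/(_ u uA) := yz a ays.
by case: (u == a :> nat) => //= /eqP <- /eqP ->.
Qed.

Lemma agree_catr rep ys a x y : agree rep (rcons ys a) x y =
  agree rep ys x y && [forall z in alive rep, (z == a :> nat) ==> (e x z == e y z)].
Proof. by rewrite /agree all_rcons andbC. Qed.

Lemma leaderP rep ys x : x \in alive rep ->
  [/\ leader rep ys x \in alive rep, agree rep ys (leader rep ys x) x &
      forall z, z \in alive rep -> agree rep ys z x -> leader rep ys x <= z].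
Proof.
move=> xA; rewrite /leader; case: arg_minnP => [|z /andP[zA zx] zmin].
  by rewrite xA agree_refl.
by split=> // y yA yx; apply: zmin; rewrite yA.
Qed.

Lemma leader_eq rep ys x y : x \in alive rep -> y \in alive rep ->
  (leader rep ys x == leader rep ys y) = agree rep ys x y.
Proof.
move=> xA yA; have [lxA lx lxmin] := leaderP ys xA; have [lyA ly lymin] := leaderP ys yA.
apply/eqP/idP => [E|xy].
  by apply: (agree_trans (y := leader rep ys x)); [rewrite agree_sym|rewrite E].
apply/val_inj/eqP; rewrite eqn_leq lxmin ?lymin //.
- exact: agree_trans lx xy.
- by apply: agree_trans ly _; rewrite agree_sym.
Qed.

Lemma leader_id rep ys x : x \in alive rep -> leader rep ys (leader rep ys x) = leader rep ys x.
Proof.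
move=> xA; have [lxA lx _] := leaderP ys xA.
by apply/eqP; rewrite leader_eq.
Qed.

Lemma merge_reps_idem rep ys : (forall u, rep u \in alive rep) ->
  forall u, merge_reps rep ys u \in alive (merge_reps rep ys).
Proof.
move=> idr u; rewrite inE /merge_reps.
have [lA _ _] := leaderP ys (idr u); move: (lA); rewrite inE => /eqP ->.
by rewrite leader_id.
Qed.

Lemma alive_merge rep ys : (forall u, rep u \in alive rep) ->
  alive (merge_reps rep ys) = leader rep ys @: alive rep.
Proof.
move=> idr; apply/setP => x; apply/idP/imsetP => [|[y yA ->]].
  by rewrite inE => /eqP <-; exists (rep x).
have [lA _ _] := leaderP ys yA; rewrite inE /merge_reps; move: (lA); rewrite inE => /eqP ->.
by rewrite leader_id.
Qed.

Lemma agree_cons rep a ys x y : agree rep (a :: ys) x y =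
  ~~ [exists z in row_diff e (alive rep) x y, z == a :> nat] && agree rep ys x y.
Proof.
rewrite /agree /= negb_exists; congr (_ && _); apply: eq_forallb => z.
rewrite !inE; case: (rep z == z) => //=.
by case: (_ == _); case: (_ == _).
Qed.

(* Each near twin that is deleted from [U] is a lost class, unless it agrees with its
   twin. *)
Lemma leader_imset_del rep ys (U : {set 'I_n}) w q :
  U \subset alive rep -> w \in U -> q \in U -> w != q ->
  #|leader rep ys @: U| <= #|leader rep ys @: (U :\ w)| + ~~ agree rep ys w q.
Proof.
move=> /subsetP UA wU qU wq; have [ag|_] := boolP (agree rep ys w q).
  rewrite addn0; apply: subset_leq_card; apply/subsetP => _ /imsetP[x xU ->].
  have [->|xw] := eqVneq x w; last by rewrite imset_f // !inE xw.
  have /eqP -> : leader rep ys w == leader rep ys q by rewrite leader_eq // UA.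
  by rewrite imset_f // !inE eq_sym wq.
rewrite -(setD1K wU) imsetU1 addn1; apply: leq_trans (leq_card_setU _ _) _.
by rewrite cards1 setU1K ?inE ?eqxx.
Qed.

(** The definition of [sd] is applied to the subgraph induced by [U]. It ignores the columns [w] and
    [q], hence the 2, and says nothing about the alive columns outside [U], hence the last term. *)
Lemma near_twins d rep (U : {set 'I_n}) : sd e <= d -> U \subset alive rep -> 1 < #|U| ->
  exists w q, [/\ w \in U, q \in U, w != q &
    #|row_diff e (alive rep) w q| <= d + 2 + #|alive rep :\: U|].
Proof.
move=> sdd UA U1; rewrite /sd in sdd; move: sdd; case: ex_minnP => d0 /forallP/(_ U).
rewrite U1 /= => /existsP[w /andP[wU /existsP[q /andP[qU /andP[wq dwq]]]]] _ d0d.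
exists w, q; split=> //.
have sub : row_diff e (alive rep) w q \subset
   ((nbhd e U w :\ q) :\: (nbhd e U q :\ w) :|: (nbhd e U q :\ w) :\: (nbhd e U w :\ q))
   :|: [set w; q] :|: (alive rep :\: U).
  apply/subsetP => z; rewrite !inE => /andP[zA]; rewrite zA.
  have [->|zw] := eqVneq z w; first by rewrite orbT.
  have [->|zq] := eqVneq z q; first by rewrite ?orbT.
  by case: (z \in U) => /=; rewrite ?orbF ?orbT //; case: (e w z); case: (e q z).
apply: leq_trans (subset_leq_card sub) _; apply: leq_trans (leq_card_setU _ _) _.
rewrite leq_add2r; apply: leq_trans (leq_card_setU _ _) _.
rewrite cards2 wq leq_add //; exact: leq_trans dwq d0d.
Qed.

Variables (N s Delta : nat).
Implicit Types t : seq nat.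

(** Round [j] reads its own stretch of [s] words of the tape. The default 0 of [nth] is what the
    machine draws from an exhausted tape. *)
Definition samples t j : seq nat := mkseq (fun i => nth 0 t (j * s + i) %% N) s.

Fixpoint rep_at rep t j : 'I_n -> 'I_n :=
  if j is j'.+1 then merge_reps (rep_at rep t j') (samples t j') else rep.

Lemma samples_drop t j : samples (drop s t) j = samples t j.+1.
Proof. by apply: eq_mkseq => i; rewrite nth_drop mulSn addnA. Qed.

Lemma samples_cat t1 t2 : size t1 = s -> samples (t1 ++ t2) 0 = map (modn^~ N) t1.
Proof.
move=> t1s; apply: (@eq_from_nth _ 0); rewrite size_mkseq ?size_map // => i is_.
by rewrite nth_mkseq // (nth_map 0) ?t1s // nth_cat t1s mul0n add0n is_.
Qed.

(** Unfolds the first round instead of the last one, as needed to condition on the first [s]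
    words. *)
Lemma rep_atSl rep t j : rep_at rep t j.+1 = rep_at (merge_reps rep (samples t 0)) (drop s t) j.
Proof. by elim: j => //= j ->; rewrite samples_drop. Qed.

Lemma rep_at_idem rep t j : (forall u, rep u \in alive rep) ->
  forall u, rep_at rep t j u \in alive (rep_at rep t j).
Proof. by move=> idr; elim: j => //= j IH; exact: merge_reps_idem. Qed.

Definition bad_round rep ys : bool :=
  [exists x in alive rep, Delta < #|row_diff e (alive rep) x (leader rep ys x)|].

Fixpoint bad_run rep t j : bool :=
  if j is j'.+1 then
    bad_round rep (samples t 0) || bad_run (merge_reps rep (samples t 0)) (drop s t) j'
  else false.

Lemma bad_runP rep t j : ~~ bad_run rep t j ->
  forall i, i < j -> ~~ bad_round (rep_at rep t i) (samples t i).
Proof.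
elim: j rep t => [//|j IH] rep t /norP[b0 bj] [_|i ij]; first exact: b0.
rewrite rep_atSl -samples_drop; exact: IH.
Qed.

End Merge.

(** * Breadth-first search *)

Section BFS.
Variables (succ : nat -> seq nat) (a : nat).

Fixpoint walk_to (k v : nat) : Prop :=
  if k is k'.+1 then exists2 u, walk_to k' u & v \in succ u else v = a.

(* [Q] lists the [t] visited nodes, whose successors have been treated for the first
   [h]; [D] is 0 on unvisited nodes and the distance plus 1 on visited ones. *)
Record bfs_inv (h t : nat) (Q D : nat -> nat) : Prop := BfsInv {
  bfs_head : h <= t;
  bfs_src : D a = 1;
  bfs_visited : forall v, D v <> 0 <-> exists2 i, i < t & Q i = v;
  bfs_inj : forall i j, i < t -> j < t -> Q i = Q j -> i = j;
  bfs_mono : forall i j, i <= j -> j < t -> D (Q i) <= D (Q j);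
  bfs_close : forall i j, h <= i -> i < t -> j < t -> D (Q j) <= (D (Q i)).+1;
  bfs_done : forall i v, i < h -> v \in succ (Q i) -> D v <> 0 /\ D v <= (D (Q i)).+1;
  bfs_walk : forall v, D v <> 0 -> walk_to (D v).-1 v
}.

Lemma bfs_init (Q D : nat -> nat) : Q 0 = a -> (forall v, D v = (v == a)) -> bfs_inv 0 1 Q D.
Proof.
move=> Qa DE; have Da : D a = 1 by rewrite DE eqxx.
split=> //.
- move=> v; rewrite DE; split; first by case: eqP => // -> _; exists 0.
  by move=> [[|i] // _ <-]; rewrite Qa eqxx.
- by move=> [|i] [|j].
- by move=> [|i] [|j].
- by move=> [|i] [|j].
- by move=> v; rewrite DE; case: eqP => // -> _.
Qed.

(** [bfs_close] bounds all entries of the queue by the value given to the new last node, which keeps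
    the queue sorted by distance. *)
Lemma bfs_push h t Q D v : bfs_inv h t Q D -> h < t -> v \in succ (Q h) -> D v = 0 ->
  bfs_inv h t.+1 (update Q t v) (update D v (D (Q h)).+1).
Proof.
move=> [ht Da vis inj mono close don wlk] h_t vs Dv.
have Qv i : i < t -> Q i <> v by move=> it Qi; have [_ []] := vis v; [exists i|].
have Dx i : i < t -> update D v (D (Q h)).+1 (Q i) = D (Q i).
  by move=> /Qv/eqP/negbTE E; rewrite /update E.
have Qx i : i < t -> update Q t v i = Q i by rewrite /update; case: eqP => // ->; rewrite ltnn.
have ltS i : i < t.+1 -> i = t \/ i < t by rewrite ltnS leq_eqVlt => /orP[/eqP|]; [left|right].
have Qt : update Q t v t = v by rewrite /update eqxx.
have Dt : update D v (D (Q h)).+1 v = (D (Q h)).+1 by rewrite /update eqxx.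
split.
- by rewrite leqW.
- by rewrite /update; case: eqP => // E; rewrite E Dv in Da.
- move=> u; split.
    rewrite {1}/update; case: eqP => [->|_ /vis[i it <-]]; first by exists t.
    by exists i; rewrite ?Qx // ltnW.
  move=> [i]; rewrite ltnS leq_eqVlt => /orP[/eqP -> <-|it <-]; first by rewrite Qt Dt.
  by rewrite Qx // Dx //; apply/vis; exists i.
- move=> i j /ltS[->|it] /ltS[->|jt] //.
  + by rewrite Qt Qx // => /esym/Qv => /(_ jt).
  + by rewrite Qt Qx // => /Qv => /(_ it).
  + by rewrite !Qx //; exact: inj.
- move=> i j ij; rewrite ltnS leq_eqVlt => /orP[/eqP jt|jt]; last first.
    have it := leq_ltn_trans ij jt; by rewrite !Qx // !Dx // mono.
  move: ij; rewrite jt leq_eqVlt => /orP[/eqP -> //|it].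
  by rewrite Qt Dt Qx // Dx // close.
- move=> i j hi /ltS[->|it] /ltS[->|jt] //.
  + by rewrite Qt Dt Qx // Dx // leqW // close.
  + by rewrite Qt Dt Qx // Dx // ltnS mono.
  + by rewrite !Qx // !Dx // close.
- move=> i u ih us; have it := ltn_trans ih h_t.
  rewrite Qx // in us *; rewrite Dx //; have [Du uD] := don _ _ ih us.
  by rewrite /update; case: eqP => // E; rewrite E Dv in Du.
- move=> u; rewrite /update; case: eqP => [-> _ /=|_ /wlk //].
  have Dh : D (Q h) <> 0 by apply/vis; exists h.
  have := wlk _ Dh; case: (D (Q h)) Dh => // d _ w.
  by exists (Q h).
Qed.

Lemma bfs_next h t Q D : bfs_inv h t Q D -> h < t ->
  (forall v, v \in succ (Q h) -> D v <> 0) -> bfs_inv h.+1 t Q D.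
Proof.
move=> [ht Da vis inj mono close don wlk] h_t all; split=> //.
- by move=> i j hi; apply: close; exact: ltnW.
- move=> i v; rewrite ltnS leq_eqVlt => /orP[/eqP ->|]; last exact: don.
  move=> vs; split; first exact: all.
  by have /vis[j jt <-] := all _ vs; exact: close.
Qed.

(** With an exhausted queue no walk beats [D], by induction along the walk; [bfs_walk] provides a
    walk attaining it, so [D] is the distance plus 1. *)
Lemma bfs_end t Q D : bfs_inv t t Q D ->
  forall k v, walk_to k v -> D v <> 0 /\ D v <= k.+1.
Proof.
move=> I; elim=> [v ->|k IH v [u /IH[Du uk] vu]]; first by rewrite (bfs_src I).
have [i it Qi] := (bfs_visited I u).1 Du; rewrite -Qi in vu.
have [Dv vD] := bfs_done I it vu; split=> //.
by apply: leq_trans vD _; rewrite Qi ltnS.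
Qed.

End BFS.

(** * The digraph of distinct block patterns *)

Section Compressed.
Variables (n : nat) (e : rel 'I_n) (L : nat) (pos : 'I_n -> nat).
Local Notation N := (2 ^ L).
Hypotheses (L_gt0 : 0 < L) (nN : n < N) (pos_lt : forall v, pos v < N)
  (pos_inj : injective pos).
Variables (C : nat -> nat -> nat) (inv : nat -> nat).

(* [C b u] is 0 if row [u] has no 1 in block [b]; otherwise it is [u'.+1] for the first
   row [u'] that has the same children codes as [u]. Codes of leaves are the entries. *)
Record codes : Prop := Codes {
  code_leaf : forall u y : 'I_n, C (N + pos y) u = e u y;
  code_pad : forall p (u : 'I_n), p < N -> (forall y, pos y != p) -> C (N + p) u = 0;
  code_zero : forall b (u : 'I_n), 0 < b < N ->
    (C b u == 0) = (C b.*2 u == 0) && (C b.*2.+1 u == 0);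
  code_rep : forall b (u : 'I_n), 0 < b < N -> C b u != 0 ->
    exists u' : 'I_n, [/\ C b u = u'.+1, C b.*2 u' = C b.*2 u & C b.*2.+1 u' = C b.*2.+1 u];
  code_eq : forall b (u u' : 'I_n), 0 < b < N ->
    C b.*2 u = C b.*2 u' -> C b.*2.+1 u = C b.*2.+1 u' -> C b u = C b u'
}.

Hypotheses (HC : codes) (inv_pos : forall y, inv (pos y) = y).

Definition node (b c : nat) : seq nat := if c == 0 then [::] else [:: b * N + c].

(** Node [b * N + c] stands for the patterns with code [c] on block [b]; on an inner block, [c.-1]
    is a row with the same codes on both halves. Code 0 gives no node, so there are no arcs to empty
    patterns. A leaf block leads to the root of the row of its vertex. *)
Definition node_succ (v : nat) : seq nat :=
  let b := v %/ N in let c := v %% N in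
  if b < N then node b.*2 (C b.*2 c.-1) ++ node b.*2.+1 (C b.*2.+1 c.-1)
  else node 1 (C 1 (inv (b - N))).

Definition leaf (y : 'I_n) : nat := (N + pos y) * N + 1.

Lemma mem_node b c v : v \in node b c -> c != 0 /\ v = b * N + c.
Proof. by rewrite /node; case: eqP => //= _; rewrite inE => /eqP ->. Qed.

Lemma node_mem b c : c != 0 -> b * N + c \in node b c.
Proof. by rewrite /node => /negbTE ->; rewrite inE eqxx. Qed.

Lemma N_gt1 : 1 < N. Proof. by rewrite -{1}(expn0 2) ltn_exp2l. Qed.

Lemma child_cases b : 0 < b < 2 * N -> b < N \/ exists2 p, p < N & b = N + p.
Proof. by move=> /andP[b0 bN]; case: (ltnP b N) => [|Nb]; [left|right; exists (b - N); lia]. Qed.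

Lemma code_le b (u : 'I_n) : 0 < b < 2 * N -> C b u <= n.
Proof.
move=> b0N; have n0 : 0 < n by apply: leq_ltn_trans (ltn_ord u).
have [bN|[p pN ->]] := child_cases b0N.
  have [-> //|c0] := eqVneq (C b u) 0.
  have b0 : 0 < b < N by move: b0N; rewrite bN => /andP[->].
  by have [u' [-> _ _]] := code_rep HC b0 c0.
have [/existsP[y /eqP <-]|none] := boolP [exists y, pos y == p].
  by rewrite (code_leaf HC); case: (e u y).
by rewrite (code_pad HC) // => y; apply: contraNneq none => <-; apply/existsP; exists y.
Qed.

Lemma code_lt b (u : 'I_n) : 0 < b < 2 * N -> C b u < N.
Proof. by move=> /code_le/leq_ltn_trans; apply. Qed.

Lemma divn_node b c : c < N -> (b * N + c) %/ N = b.
Proof. by move=> cN; rewrite divnMDl ?pow2L_gt0 // divn_small ?addn0. Qed.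

Lemma modn_node b c : c < N -> (b * N + c) %% N = c.
Proof. by move=> cN; rewrite modnMDl modn_small. Qed.

Lemma succ_inner b (u : 'I_n) : 0 < b < N -> C b u != 0 ->
  node_succ (b * N + C b u) = node b.*2 (C b.*2 u) ++ node b.*2.+1 (C b.*2.+1 u).
Proof.
move=> bN c0; have cN : C b u < N by apply: code_lt; lia.
rewrite /node_succ divn_node // modn_node //; have /andP[_ ->] := bN.
by have [u' [-> /= -> ->]] := code_rep HC bN c0.
Qed.

Lemma succ_leaf (y : 'I_n) : node_succ (leaf y) = node 1 (C 1 y).
Proof.
rewrite /node_succ divn_node ?N_gt1 //.
by rewrite ltnNge leq_addr /= addKn inv_pos.
Qed.

Lemma has_walk0 (x y : 'I_n) : has_walk e x y 0 = (y == x).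
Proof.
apply/existsP/eqP => [[p]|->]; first by rewrite (tuple0 p) => /eqP.
by exists [tuple] => /=.
Qed.

Lemma has_walkS (x z : 'I_n) k :
  has_walk e x z k.+1 <-> exists2 y, has_walk e x y k & e y z.
Proof.
split=> [/existsP[p /andP[ep /eqP zE]]|[y /existsP[p /andP[ep /eqP yE]] yz]].
  move: (size_tuple p) ep zE; case/lastP: (tval p) => [//|q w].
  rewrite size_rcons => -[/eqP sq]; rewrite rcons_path last_rcons => /andP[eq_ ew] ->.
  by exists (last x q) => //; apply/existsP; exists (Tuple sq); rewrite /= eq_ eqxx.
apply/existsP; exists [tuple of rcons p z].
by rewrite /= rcons_path ep last_rcons -yE yz eqxx.
Qed.

(** Induction up the tree from the leaf of [y], whose code is the entry 1: an ancestor has a child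
    with nonzero code. *)
Lemma code_above (z y : 'I_n) l : e z y -> l <= L -> C ((N + pos y) %/ 2 ^ l) z != 0.
Proof.
move=> zy; elim: l => [|l IH] lL; first by rewrite divn1 (code_leaf HC) zy.
have := IH (ltnW lL); rewrite expnSr divnMA; set b := (N + pos y) %/ 2 ^ l => bz.
have b2N : b < 2 * N by rewrite /b ltn_divLR ?expn_gt0 //; have := pos_lt y; have := expn_gt0 2 l; nia.
have b2 : 1 < b.
  rewrite /b leq_divRL ?expn_gt0 // -expnS; apply: leq_trans (leq_addr _ _).
  by rewrite leq_exp2l.
rewrite (code_zero HC); last by apply/andP; lia.
rewrite negb_and; have [E|E] : b = (b %/ 2).*2 \/ b = (b %/ 2).*2.+1 by lia.
- by rewrite -E bz.
- by rewrite -E bz orbT.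
Qed.

(** An edge from [z] to [y] becomes one arc from the leaf of [z] to the root of row [z], and [L]
    arcs down to the leaf of [y]. *)
Lemma walk_compressed x y j : has_walk e x y j ->
  walk_to node_succ (leaf x) (j * L.+1) (leaf y).
Proof.
elim: j y => [|j IH] y; first by rewrite has_walk0 => /eqP ->.
move=> /has_walkS[z /IH wz zy].
(* [i] is the depth reached in the tree; the ancestor of the leaf of [y] at that depth is
   [(N + pos y) %/ 2 ^ (L - i)]. *)
suff H i : i <= L -> let b := (N + pos y) %/ 2 ^ (L - i) in
    walk_to node_succ (leaf x) (j * L.+1 + i.+1) (b * N + C b z).
  rewrite mulSn [L.+1 + _]addnC; have := H L (leqnn L); cbv zeta.
  by rewrite subnn divn1 (code_leaf HC) zy.
elim: i => [|i IHi] iL /=.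
  rewrite subn0 addn1; exists (leaf z) => //.
  have -> : (N + pos y) %/ N = 1 by rewrite divnDl // divnn pow2L_gt0 divn_small.
  by rewrite succ_leaf node_mem //; have := code_above zy (leqnn L); rewrite divnDl // divnn pow2L_gt0 divn_small.
rewrite addnS; have := IHi (ltnW iL) => /= w.
exists ((N + pos y) %/ 2 ^ (L - i) * N + C ((N + pos y) %/ 2 ^ (L - i)) z) => //.
have nz := code_above zy (leq_subr i L); have nz' := code_above zy (leq_subr i.+1 L).
move: nz nz'; rewrite (_ : L - i = (L - i.+1).+1); last by lia.
rewrite expnSr divnMA; set b := (N + pos y) %/ 2 ^ (L - i.+1) => nz nz'.
have b2N : b < 2 * N by rewrite /b ltn_divLR ?expn_gt0 //; have := pos_lt y; have := expn_gt0 2 (L - i.+1); nia.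
have b2 : 1 < b.
  rewrite /b leq_divRL ?expn_gt0 // -expnS; apply: leq_trans (leq_addr _ _).
  by rewrite leq_exp2l //; lia.
rewrite succ_inner //; last by apply/andP; lia.
rewrite mem_cat; have [E|E] : b = (b %/ 2).*2 \/ b = (b %/ 2).*2.+1 by lia.
- by rewrite -E node_mem.
- by rewrite -E node_mem ?orbT.
Qed.

(** Invariant of an arbitrary walk. Nodes are shared between rows, so an inner node does not
    determine the row; [z] is one row through which the walk can be read, and this suffices because
    the codes below depend only on the node. *)
Definition at_node (x : 'I_n) (k v : nat) : Prop :=
  exists j z, has_walk e x z j /\
   ((k = j * L.+1 /\ v = leaf z) \/
    exists b, [/\ 0 < b < N, k = j * L.+1 + (trunc_log 2 b).+1, C b z != 0 & v = b * N + C b z]).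

Lemma walk_at x k v : walk_to node_succ (leaf x) k v -> at_node x k v.
Proof.
elim: k v => [v ->|k IH v /=]; first by exists 0, x; rewrite has_walk0 eqxx; split=> //; left.
move=> [u /IH[j [z [wz [[-> ->]|[b [bN -> cz ->]]]]]]].
  rewrite succ_leaf => /mem_node[c0 ->]; exists j, z; split=> //; right; exists 1.
  by rewrite trunc_log1 addn1 N_gt1.
have tl c : c < 2 -> trunc_log 2 (b.*2 + c) = (trunc_log 2 b).+1.
  move=> c2; rewrite trunc_log2S; last by lia.
  by congr (trunc_log 2 _).+1; lia.
have child c : c < 2 -> C (b.*2 + c) z != 0 ->
    at_node x (j * L.+1 + (trunc_log 2 b).+1).+1 ((b.*2 + c) * N + C (b.*2 + c) z).
  move=> c2 nz; have [bcN|[p pN bE]] := @child_cases (b.*2 + c) ltac:(lia).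
    by exists j, z; split=> //; right; exists (b.*2 + c); rewrite tl // addnS; split=> //; lia.
  have [/existsP[y /eqP yp]|none] := boolP [exists y, pos y == p]; last first.
    move: nz; rewrite bE (code_pad HC) // => y; apply: contraNneq none => <-.
    by apply/existsP; exists y.
  have nz' := nz; rewrite bE -yp (code_leaf HC) in nz'.
  have zy : e z y by case: (e z y) nz'.
  exists j.+1, y; split; first by apply/has_walkS; exists z.
  left; split; last by rewrite bE -yp (code_leaf HC) zy.
  have bL : trunc_log 2 (b.*2 + c) = L by apply: trunc_log_eq; rewrite // bE leq_addr expnS; lia.
  by move: (tl c c2); rewrite bL mulSn => <-; rewrite addnC addSn.
rewrite succ_inner // mem_cat => /orP[] /mem_node[c0 ->].
- by have := @child 0 isT; rewrite addn0; apply.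
- by have := @child 1 isT; rewrite addn1; apply.
Qed.

Lemma leaf_inj x y : leaf x = leaf y -> x = y.
Proof.
move=> E; apply: pos_inj; have := congr1 (divn^~ N) E; rewrite /= !divn_node ?N_gt1 //.
exact: addnI.
Qed.

(** Inner nodes have a block index below [N], so a walk standing on a leaf is between two edges and
    its length is a multiple of [L.+1]. *)
Lemma compressed_walk x y k : walk_to node_succ (leaf x) k (leaf y) ->
  exists2 j, k = j * L.+1 & has_walk e x y j.
Proof.
move=> /walk_at[j [z [wz [[-> /leaf_inj ->]|[b [bN _ cz E]]]]]]; first by exists j.
have := congr1 (divn^~ N) E; rewrite /= !divn_node ?N_gt1 //; last by apply: code_lt; lia.
by move: bN; lia.
Qed.

Lemma distance_of_bfs (x y : 'I_n) D t Q : bfs_inv node_succ (leaf x) t t Q D ->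
  (if D (leaf y) == 0 then n else (D (leaf y)).-1 %/ L.+1) = odflt n (distance e x y).
Proof.
move=> I; have lo := bfs_end I; have hi := bfs_walk I.
have key k : has_walk e x y k -> D (leaf y) <> 0 /\ (D (leaf y)).-1 %/ L.+1 <= k.
  move=> /walk_compressed/lo[D0 Dk]; split=> //.
  by rewrite -ltnS ltn_divLR // mulSn; lia.
rewrite /distance; destruct (@idP (connect e x y)) as [xy|nxy] => /=.
  case: ex_minnP => m wm mmin; have [D0 Dm] := key _ wm.
  case: eqP => // _; apply/eqP; rewrite eqn_leq Dm /=.
  have [j jE wj] := compressed_walk (hi _ D0).
  by rewrite jE mulnK // mmin.
case: eqP => // D0; have [j _ /existsP[p /andP[ep /eqP yE]]] := compressed_walk (hi _ D0).
by case: nxy; apply/connectP; exists p.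
Qed.

(** Children have larger indices than their parent, whence the induction on [2 * N - b]. This is
    what bounds the number of codes by that of patterns. *)
Lemma code_pattern b (u u' : 'I_n) : 0 < b < 2 * N ->
  pattern L pos (e u) b = pattern L pos (e u') b -> C b u = C b u'.
Proof.
have [m] := ubnP (2 * N - b); elim: m b => // m IH b bm b0N.
have [bN|[p pN ->]] := child_cases b0N => E.
  have b0 : 0 < b < N by lia.
  have sub c : c < 2 -> C (b.*2 + c) u = C (b.*2 + c) u'.
    move=> c2; apply: IH; [lia|lia|apply/setP => v].
    have /setP/(_ v) := E; rewrite !in_set.
    have [vb|//] := boolP ((N + pos v) %/ 2 ^ height L (b.*2 + c) == b.*2 + c).
    by have := block_child b0 c2 (_ : v \in block L pos (b.*2 + c)); rewrite !inE => /(_ vb) ->.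
  by apply: (code_eq HC b0); [have := sub 0 isT; rewrite addn0|have := sub 1 isT; rewrite addn1].
have [/existsP[y /eqP yp]|none] := boolP [exists y, pos y == p].
  rewrite -yp !(code_leaf HC); have /setP/(_ y) := E; rewrite !in_set.
  by have := block_leaf pos_lt y y; rewrite inE yp eqxx => -> /= ->.
by rewrite !(code_pad HC) // => y; apply: contraNneq none => <-; apply/existsP; exists y.
Qed.

Lemma code_pattern0 b (u : 'I_n) : 0 < b < 2 * N ->
  C b u != 0 -> pattern L pos (e u) b != set0.
Proof.
have [m] := ubnP (2 * N - b); elim: m b => // m IH b bm b0N.
have [bN|[p pN ->]] := child_cases b0N.
  have b0 : 0 < b < N by lia.
  have sub c : c < 2 -> C (b.*2 + c) u != 0 -> pattern L pos (e u) b != set0.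
    move=> c2 nz; have /set0Pn[v] := IH (b.*2 + c) ltac:(lia) ltac:(lia) nz.
    rewrite inE => /andP[/(block_child b0 c2) vb euv].
    by apply/set0Pn; exists v; rewrite inE vb.
  rewrite (code_zero HC u b0) negb_and => /orP[nz|nz].
  - by apply: (sub 0); rewrite ?addn0.
  - by apply: (sub 1); rewrite ?addn1.
have [/existsP[y /eqP yp]|none] := boolP [exists y, pos y == p].
  rewrite -yp (code_leaf HC) => nz; apply/set0Pn; exists y; rewrite inE block_leaf // eqxx.
  by case: (e u y) nz.
by rewrite (code_pad HC) // => y; apply: contraNneq none => <-; apply/existsP; exists y.
Qed.

Definition nodes (b : nat) : seq nat :=
  undup [seq b * N + C b u | u : 'I_n <- enum 'I_n & C b u != 0].

Lemma size_nodes b : 0 < b < 2 * N ->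
  size (nodes b) <= #|[set pattern L pos (e u) b | u : 'I_n] :\ set0|.
Proof.
move=> bN; rewrite cardE; set P := enum _.
pose f (p : {set 'I_n}) := if [pick u | pattern L pos (e u) b == p] is Some u then b * N + C b u else 0.
rewrite -(size_map f); apply: uniq_leq_size; first exact: undup_uniq.
move=> v; rewrite mem_undup => /mapP[u]; rewrite mem_filter => /andP[nz _] ->.
apply/mapP; exists (pattern L pos (e u) b).
  by rewrite mem_enum !inE code_pattern0 //=; apply/imsetP; exists u.
by rewrite /f; case: pickP => [u' /eqP/(code_pattern bN) -> //|/(_ u)]; rewrite eqxx.
Qed.

(** The source is listed apart: if no vertex is adjacent to [x], its leaf is not the node of any
    pattern. *)
Lemma walk_nodes x k v : walk_to node_succ (leaf x) k v ->
  v \in leaf x :: flatten [seq nodes b | b <- iota 0 (2 * N)].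
Proof.
case: k => [/= ->|k]; first exact: mem_head.
move=> /walk_at H; rewrite inE; apply/orP; right.
have mem b (u : 'I_n) : 0 < b < 2 * N -> C b u != 0 ->
    b * N + C b u \in flatten [seq nodes b | b <- iota 0 (2 * N)].
  move=> bN nz; apply/flattenP; exists (nodes b).
    by apply: map_f; rewrite mem_iota; lia.
  by rewrite mem_undup; apply: map_f; rewrite mem_filter nz mem_enum.
case: H => j [z [wz [[kE ->]|[b [bN _ nz ->]]]]]; last by apply: mem => //; lia.
case: j wz kE => // j /has_walkS[u _ uz] _.
have := mem (N + pos z) u; rewrite (code_leaf HC) uz => -> //.
by have := pos_lt z; have := N_gt1; lia.
Qed.

Lemma bfs_size x h t Q D : bfs_inv node_succ (leaf x) h t Q D ->
  t <= (\sum_(b < 2 * N) size (nodes b)).+1.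
Proof.
move=> I; have -> : t = size [seq Q i | i <- iota 0 t] by rewrite size_map size_iota.
have -> : (\sum_(b < 2 * N) size (nodes b)).+1 =
    size (leaf x :: flatten [seq nodes b | b <- iota 0 (2 * N)]).
  rewrite /= size_flatten /shape -map_comp sumnE big_map.
  by rewrite -[iota _ _](_ : index_iota 0 (2 * N) = _) ?big_mkord // /index_iota subn0.
apply: uniq_leq_size => [|v /mapP[i]].
  rewrite map_inj_in_uniq ?iota_uniq // => i j; rewrite !mem_iota => it jt.
  exact: (bfs_inj I).
rewrite mem_iota => it ->; apply: walk_nodes (bfs_walk I _).
by apply/(bfs_visited I); exists i.
Qed.

End Compressed.

(** * The program *)

Section FirstIndex.
Variables (n : nat) (P : pred nat) (key : nat -> nat).

Definition first_index (k : nat) : nat := find (fun x => P x && (key x == k)) (iota 0 n).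

(** Content of cell [k] after the items below [x] have been inserted; 0 marks an empty cell, so
    indices are shifted by 1. *)
Definition first_table (x k : nat) : nat :=
  if first_index k < x then (first_index k).+1 else 0.

Lemma first_index_le x : x < n -> P x -> first_index (key x) <= x.
Proof.
move=> xn Px; rewrite leqNgt; apply/negP => /(before_find 0).
by rewrite nth_iota // add0n Px eqxx.
Qed.

Lemma first_indexP k : first_index k < n -> P (first_index k) /\ key (first_index k) = k.
Proof.
move=> kn; have : has (fun x => P x && (key x == k)) (iota 0 n) by rewrite has_find size_iota.
by move=> /(nth_find 0); rewrite nth_iota // add0n => /andP[? /eqP].
Qed.

Lemma first_table0 k : first_table 0 k = 0.
Proof. by rewrite /first_table ltn0. Qed.

Lemma first_table_get x : x < n -> P x ->
  (first_table x (key x) == 0) = (first_index (key x) == x).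
Proof.
move=> xn Px; have := first_index_le xn Px; rewrite /first_table leq_eqVlt.
by case: eqP => [->|_ /= ->] //; rewrite ltnn eqxx.
Qed.

Lemma first_tableS x k : x < n -> P x ->
  first_table x.+1 k = if k == key x then (first_index (key x)).+1 else first_table x k.
Proof.
move=> xn Px; case: eqP => [->|kx].
  by rewrite /first_table ltnS first_index_le.
rewrite /first_table ltnS leq_eqVlt; case: eqP => //= fx.
have fn : first_index k < n by rewrite fx.
by have [_] := first_indexP fn; rewrite fx => /esym.
Qed.

Lemma first_table_skip x k : x < n -> ~~ P x -> first_table x.+1 k = first_table x k.
Proof.
move=> xn Px; rewrite /first_table ltnS leq_eqVlt; case: eqP => //= fx.
have fn : first_index k < n by rewrite fx.
by have [Px'] := first_indexP fn; rewrite fx in Px'; rewrite Px' in Px.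
Qed.

Lemma first_index_eq x y : x < n -> y < n -> P x -> P y ->
  (first_index (key x) == first_index (key y)) = (key x == key y).
Proof.
move=> xn yn Px Py; apply/eqP/eqP => [E|->] //.
have [_ <-] := first_indexP (leq_ltn_trans (first_index_le xn Px) xn).
by rewrite E; have [_ ->] := first_indexP (leq_ltn_trans (first_index_le yn Py) yn).
Qed.

End FirstIndex.

Definition frame (xs : seq nat) (r r0 : nat -> nat) : Prop :=
  forall i, i \notin xs -> r i = r0 i.

Definition aframe (ks : seq nat) (F F0 : nat -> nat -> nat) : Prop :=
  forall k, k \notin ks -> F k = F0 k.

Lemma frame_update xs r r0 i v : i \in xs -> frame xs r r0 -> frame xs (update r i v) r0.
Proof.
move=> ixs fr j jxs; rewrite /update; case: eqP => [E|_]; last exact: fr.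
by rewrite E ixs in jxs.
Qed.

Lemma aframe_set ks F F0 k i v : k \in ks -> aframe ks F F0 -> aframe ks (set_array F k i v) F0.
Proof.
move=> kks fr j jks; rewrite set_array_neq; first exact: fr.
by apply: contraNneq jks => ->.
Qed.

Lemma frame_trans xs zs ys r1 r2 r3 : all (mem ys) xs -> all (mem ys) zs ->
  frame xs r1 r2 -> frame zs r2 r3 -> frame ys r1 r3.
Proof.
move=> /allP xy /allP zy f g i iy.
by rewrite f ?g //; apply: contra iy => h; [exact: zy|exact: xy].
Qed.

Lemma aframe_trans xs zs ys F1 F2 F3 : all (mem ys) xs -> all (mem ys) zs ->
  aframe xs F1 F2 -> aframe zs F2 F3 -> aframe ys F1 F3.
Proof.
move=> /allP xy /allP zy f g i iy.
by rewrite f ?g //; apply: contra iy => h; [exact: zy|exact: xy].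
Qed.

(** * Offsets inside clusters and their behaviour under merging *)

Section Clusters.
Variables (n : nat) (e : rel 'I_n).

(** When the clusters with leader [p] are placed one after the other in the order of their
    representatives, this is where the cluster of such a representative [x] begins; at [x = n] it is
    the total size. *)
Definition weight_below (rep : 'I_n -> 'I_n) ys (sz : nat -> nat) (p : 'I_n) (x : nat) : nat :=
  \sum_(z : 'I_n | [&& z \in alive rep, z < x & leader e rep ys z == p]) sz z.

Lemma weight_belowS rep ys sz p (x : 'I_n) : weight_below rep ys sz p x.+1 =
  weight_below rep ys sz p x + (if (x \in alive rep) && (leader e rep ys x == p) then sz x else 0).
Proof.
rewrite /weight_below; case: ifP => xp.
  rewrite (bigD1 x) /=; last by rewrite ltnSn andbCA andTb.
  rewrite addnC; congr (_ + _); apply: eq_bigl => z.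
  rewrite ltnS [z < x]ltn_neqAle (_ : (z != x) = (z != x :> nat)) //.
  by case: (z \in alive rep) => //=; case: (z == x :> nat); rewrite /= ?andbF ?andbT.
rewrite addn0; apply: eq_bigl => z; rewrite ltnS leq_eqVlt.
case: (z =P x :> nat) => [/val_inj ->|_] //=; by rewrite ltnn andbF /=.
Qed.

Lemma weight_below_le rep ys sz p x :
  weight_below rep ys sz p x <= \sum_(z in alive rep) sz z.
Proof.
rewrite /weight_below big_mkcond [leqRHS]big_mkcond /=; apply: leq_sum => z _.
by case: (z \in alive rep) => //=; case: (_ && _).
Qed.

Lemma weight_below_mono rep ys sz p x y : x <= y ->
  weight_below rep ys sz p x <= weight_below rep ys sz p y.
Proof.
move=> xy; rewrite /weight_below big_mkcond [leqRHS]big_mkcond /=; apply: leq_sum => z _.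
case: (z \in alive rep) => //=; case: (ltnP z x) => //= zx.
by rewrite (leq_trans zx xy).
Qed.

Definition cluster (f : 'I_n -> 'I_n) (x : 'I_n) : {set 'I_n} := [set u | f u == x].

(* The members of the cluster of [x] are numbered by [off] from 0 to its size. *)
Record layout (rep : 'I_n -> 'I_n) (sz off : nat -> nat) : Prop := Layout {
  layout_idem : forall u, rep u \in alive rep;
  layout_size : forall x : 'I_n, x \in alive rep -> sz x = #|cluster rep x|;
  layout_lt : forall u : 'I_n, off u < sz (rep u);
  layout_inj : forall u v : 'I_n, rep u = rep v -> off u = off v -> u = v
}.

(** Offsets are comparable only inside a cluster of [rep]. Once [rep] has a single cluster, this
    says that the clusters of [f] are intervals. *)
Definition contiguous (f rep : 'I_n -> 'I_n) (off : nat -> nat) : Prop :=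
  forall u v w, f u = f w -> rep v = rep u -> off u <= off v <= off w -> f v = f u.

Lemma weight_total (rep : 'I_n -> 'I_n) ys (sz off : nat -> nat) p :
  layout rep sz off -> p \in alive (merge_reps e rep ys) ->
  weight_below rep ys sz p n = #|cluster (merge_reps e rep ys) p|.
Proof.
move=> lay pA; rewrite /weight_below -sum1dep_card.
rewrite [RHS](partition_big rep (fun z => [&& z \in alive rep, z < n & leader e rep ys z == p])) /=.
  apply: eq_bigr => z /and3P[zA _ zp]; rewrite (layout_size lay zA) -sum1dep_card.
  apply: eq_bigl => u; apply/eqP/andP => [uz|[_ /eqP] //].
  by rewrite /merge_reps uz zp.
by move=> u up; rewrite (layout_idem lay) ltn_ord.
Qed.

Lemma layout_total (rep : 'I_n -> 'I_n) (sz off : nat -> nat) : layout rep sz off ->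
  \sum_(z in alive rep) sz z = n.
Proof.
move=> lay; rewrite -[RHS]card_ord -sum1_card [RHS](partition_big rep (mem (alive rep))) /=.
  apply: eq_bigr => z zA; rewrite (layout_size lay zA) -sum1dep_card.
  by apply: eq_bigl => u.
by move=> u _; exact: (layout_idem lay).
Qed.

Section Step.
Variables (rep : 'I_n -> 'I_n) (ys : seq nat) (sz off sz' off' : nat -> nat).
Local Notation rep' := (merge_reps e rep ys).
Local Notation wb := (weight_below rep ys sz).
Hypotheses (lay : layout rep sz off)
  (sz'E : forall x : 'I_n, x \in alive rep -> leader e rep ys x = x -> sz' x = wb x n)
  (off'E : forall u : 'I_n, off' u = off u + wb (rep' u) (rep u)).

(** The part of [u] ends at the weight up to and including [rep u], which is at or before the start
    of the part of [v]. *)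
Lemma shift_lt (u v : 'I_n) : rep' u = rep' v -> rep u < rep v -> off' u < off' v.
Proof.
move=> uv ruv; rewrite !off'E -uv; apply: (@leq_trans (wb (rep' u) (rep v))); last exact: leq_addl.
apply: leq_trans (weight_below_mono _ _ _ _ ruv).
rewrite weight_belowS (layout_idem lay) eqxx /= addnC ltn_add2l.
exact: (layout_lt lay).
Qed.

Lemma layout_merge : layout rep' sz' off'.
Proof.
have idr := layout_idem lay.
have sz'_card x : x \in alive rep' -> sz' x = #|cluster rep' x|.
  move=> xA'; have := xA'; rewrite alive_merge // => /imsetP[y yA xE].
  have [lA _ _] := leaderP e ys yA.
  by rewrite sz'E ?(weight_total lay) // xE ?leader_id.
split=> //.
- exact: merge_reps_idem.
- move=> u; have [lA _ _] := leaderP e ys (idr u).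
  rewrite sz'E ?leader_id // off'E.
  apply: leq_trans (weight_below_mono _ _ _ _ (ltn_ord (rep u))).
  rewrite weight_belowS idr eqxx /= addnC ltn_add2l.
  exact: (layout_lt lay).
- move=> u v uv oe; case: (ltngtP (rep u) (rep v)) => [lt|lt|/val_inj E].
  + by have := shift_lt uv lt; rewrite oe ltnn.
  + by have := shift_lt (esym uv) lt; rewrite oe ltnn.
  + by move: oe; rewrite !off'E uv E => /addIn; exact: (layout_inj lay).
Qed.

(** A cluster of [f] lies in one cluster of [rep], which is shifted as a whole; the other clusters
    of [rep] lie entirely before or after it. *)
Lemma contiguous_merge f : (forall u v, f u = f v -> rep u = rep v) ->
  contiguous f rep off -> contiguous f rep' off'.
Proof.
move=> fr cf u v w fuw vu /andP[uv vw].
have ruw := fr _ _ fuw.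
case: (ltngtP (rep v) (rep u)) => [lt|lt|/val_inj E].
- by have := shift_lt vu lt; rewrite ltnNge uv.
- have wv : rep' w = rep' v by rewrite vu /merge_reps ruw.
  by rewrite ruw in lt; have := shift_lt wv lt; rewrite ltnNge vw.
- apply: (cf _ _ w) => //; move: uv vw; rewrite !off'E /merge_reps E -ruw.
  by rewrite !leq_add2r => -> ->.
Qed.

End Step.
End Clusters.

(* Arrays: 0 input and output, 1 representatives, 2 offsets in the cluster, 3 cluster
   sizes, 4 classes, 5 table, 6 leaders, 7 shifts, 8 inverse of the offsets, 9 codes,
   10 table, 11 distances, 12 queue. Registers: 0 n, 1 B, 2 N, 3 log N, 4 sample size,
   5 number of rounds, 7 time stamp. Tables are not cleared: addresses in arrays 5 and 11
   contain the time stamp or the source, so that they were not used before. *)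
Definition refine_code : cmd :=
  (for_loop 9 0
    (12 ::= (%7 * %2 + 4$[%9]) * #2 + 0$[%9 * %0 + %11];;
     cond (5$[%12] == #0) (put 5[%12] <~ %9 + #1) CSkip;;
     put 4[%9] <~ 5$[%12]))%C.

(** A drawn number that is not an alive vertex is dropped but still uses a time stamp, so that the
    stamps depend only on the number of draws. *)
Definition sample_code : cmd :=
  (CRand 11;; 11 ::= %11 %% %2;; 7 ::= %7 + #1;;
   cond ((%11 < %0) * (1$[%11] == %11)) refine_code CSkip)%C.

(** The first vertex with a given key finds an empty cell and becomes the leader. Its entry in array
    3 is the size accumulated so far, which is the shift of the next cluster that joins it. *)
Definition leader_code : cmd :=
  (for_loop 9 0
    (cond (1$[%9] == %9)
      (12 ::= (%7 * %2 + 4$[%9]) * #2;;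
       cond (5$[%12] == #0) (put 5[%12] <~ %9 + #1) CSkip;;
       13 ::= 5$[%12] - #1;;
       put 6[%9] <~ %13;;
       cond (%13 == %9) (put 7[%9] <~ #0)
         (put 7[%9] <~ 3$[%13];; put 3[%13] <~ 3$[%13] + 3$[%9]))
      CSkip))%C.

Definition move_code : cmd :=
  (for_loop 9 0
    (13 ::= 1$[%9];;
     put 2[%9] <~ 2$[%9] + 7$[%13];;
     put 1[%9] <~ 6$[%13]))%C.

Definition round_code : cmd :=
  (for_loop 9 0 (put 4[%9] <~ #0);;
   for_loop 10 8 sample_code;;
   7 ::= %7 + #1;;
   leader_code;;
   move_code)%C.

(* The last round takes no sample and merges all remaining clusters. *)
Definition rounds_code : cmd :=
  (for_loop 9 0 (put 1[%9] <~ %9;; put 3[%9] <~ #1);;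
   7 ::= #0;;
   14 ::= %5 + #1;;
   for_loop 6 14 (8 ::= %4 * (%6 < %5);; round_code))%C.

Definition leaves_code : cmd :=
  (for_loop 9 0
    (11 ::= 2$[%9];;
     put 8[%11] <~ %9;;
     12 ::= (%2 + %11) * %2;;
     for_loop 10 0 (put 9[%12 + %10] <~ 0$[%10 * %0 + %9])))%C.

(** The key combines the block with the codes of its two halves; a row that is empty on both halves
    keeps code 0. *)
Definition level_code : cmd :=
  (for_loop 9 0
    (12 ::= 9$[(%11 + %11) * %2 + %9];;
     13 ::= 9$[(%11 + %11 + #1) * %2 + %9];;
     cond (%12 + %13 == #0) CSkip
       (15 ::= (%11 * %2 + %12) * %2 + %13;;
        cond (10$[%15] == #0) (put 10[%15] <~ %9 + #1) CSkip;;
        put 9[%11 * %2 + %9] <~ 10$[%15])))%C.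

Definition tree_code : cmd :=
  (leaves_code;;
   14 ::= %2 - #1;;
   for_loop 10 14 (11 ::= %2 - %10 - #1;; level_code))%C.

Definition push_code : cmd :=
  (cond (%16 == #0) CSkip
    (17 ::= %15 * %2 + %16;;
     cond (11$[%7 + %17] == #0)
       (put 11[%7 + %17] <~ %12 + #1;;
        put 12[%9] <~ %17;;
        9 ::= %9 + #1) CSkip))%C.

Definition visit_code : cmd :=
  (11 ::= 12$[%8];;
   12 ::= 11$[%7 + %11];;
   13 ::= %11 %/ %2;;
   cond (%13 < %2)
     (14 ::= %11 %% %2 - #1;;
      15 ::= %13 + %13;; 16 ::= 9$[%15 * %2 + %14];; push_code;;
      15 ::= %15 + #1;; 16 ::= 9$[%15 * %2 + %14];; push_code)
     (15 ::= #1;; 16 ::= 9$[%2 + 8$[%13 - %2]];; push_code);;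
   8 ::= %8 + #1)%C.

Definition output_code : cmd :=
  (for_loop 10 0
    (12 ::= 11$[%7 + ((%2 + 2$[%10]) * %2 + #1)];;
     cond (%12 == #0) (put 0[%0 * %0 + (%6 * %0 + %10)] <~ %0)
       (put 0[%0 * %0 + (%6 * %0 + %10)] <~ (%12 - #1) %/ (%3 + #1))))%C.

Definition search_code : cmd :=
  (for_loop 6 0
    (7 ::= %6 * (%2 * %2 * #2);;
     11 ::= (%2 + 2$[%6]) * %2 + #1;;
     put 12[#0] <~ %11;;
     put 11[%7 + %11] <~ #1;;
     8 ::= #0;;
     9 ::= #1;;
     while (%8 < %9) visit_code;;
     output_code))%C.

Lemma bool_neq0 (b : bool) : (nat_of_bool b != 0) = b. Proof. by case: b. Qed.

(** * Correctness and step counts of the commands *)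

Section Program.
Variables (w n B N L s T : nat).
Local Notation W := (2 ^ w).
Hypotheses (W_gt1 : 1 < W) (B_gt0 : 0 < B) (BW : 16 * B <= W).
Hypotheses (n_gt0 : 0 < n) (nN : n < N) (NB : N * N * N * 8 <= B).

Definition globals (r : nat -> nat) : Prop :=
  forall i, i < 6 -> r i = nth 0 [:: n; B; N; L; s; T] i.

Local Notation wp := (wp w B globals).

Lemma globalsP r : globals r ->
  [/\ r 0 = n, r 1 = B, r 2 = N, r 3 = L & r 4 = s /\ r 5 = T].
Proof. by move=> g; rewrite !g. Qed.

Lemma globals_update i r v : 5 < i -> globals r -> globals (update r i v).
Proof.
move=> i5 g j j6; rewrite /update; case: eqP => [ji|_]; last exact: g.
by move: i5 j6; rewrite ji; lia.
Qed.

Lemma assignP i x r F t (Q : _ -> _ -> _ -> Prop) : 5 < i -> safe w B r F x ->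
  Q (update r i (aeval r F x)) F t -> wp (assign i x) 1 r F t Q.
Proof. by move=> i5 sx q; apply: wp_assign => // v; exact: globals_update. Qed.

Lemma storeP k x y r F t (Q : _ -> _ -> _ -> Prop) :
  safe w B r F (ALoad k x) -> safe w B r F y ->
  Q r (set_array F k (aeval r F x) (aeval r F y)) t -> wp (store k x y) 1 r F t Q.
Proof. exact: wp_store. Qed.

Lemma condP x c d k r F t Q : safe w B r F x ->
  (aeval r F x != 0 -> wp c k r F t Q) -> (aeval r F x = 0 -> wp d k r F t Q) ->
  wp (cond x c d) k.+1 r F t Q.
Proof. exact: wp_cond. Qed.

Lemma forP i j c k nb (I : nat -> _ -> _ -> _ -> Prop) r F t : 5 < i -> nb < W ->
  (forall x r F t, globals r -> I x r F t -> r j = nb) ->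
  (globals r -> I 0 (update r i 0) F t) ->
  (forall x r F t, globals r -> x < nb -> r i = x -> I x r F t ->
     wp c k r F t (fun r' F' t' => r' i = x /\ I x.+1 (update r' i x.+1) F' t')) ->
  wp (for_loop i j c) (nb * (k + 3) + 3) r F t (I nb).
Proof. by move=> i5 nbW Ij I0 H; apply: wp_for => // r' v; exact: globals_update. Qed.

Lemma whileP x c k (I : nat -> _ -> _ -> _ -> Prop) j r F t :
  (forall j r F t, globals r -> I j r F t -> safe w B r F x /\
     (aeval r F x != 0 -> exists2 j', j = j'.+1 & wp c k r F t (I j'))) ->
  I j r F t ->
  wp (while x c) (j * k.+1).+1 r F t
    (fun r' F' t' => (exists j', I j' r' F' t') /\ aeval r' F' x = 0).
Proof. exact: wp_while. Qed.

Lemma N_le_B : N <= B.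
Proof.
have N0 : 0 < N by exact: leq_trans nN.
by apply: leq_trans NB; rewrite -!mulnA leq_pmulr // !muln_gt0 N0.
Qed.

Lemma B_lt_W : 4 * B < W. Proof. by lia. Qed.

Lemma idx_lt i j : i < n -> j < n -> i * n + j < n * n.
Proof. by move=> i_n jn; apply: (@leq_trans (i.+1 * n)); [rewrite mulSn addnC ltn_add2r|rewrite leq_mul2r i_n orbT]. Qed.

Lemma nn_lt_B : n * n + n * n <= B.
Proof. by have : n * n <= N * N; [rewrite leq_mul // ltnW|move: NB nN; nia]. Qed.

(** The key of a vertex packs its old class and its new bit. The stamp [st] places all keys in a
    stretch of array 5 that is still zero, and leaves the later stretches so. *)
Lemma refineP (cls bit : nat -> nat) st y ra Fa ta :
  ra 7 = st -> ra 11 = y -> y < n -> st.+1 * N * 2 <= B ->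
  (forall i, i < n -> Fa 4 i = cls i) -> (forall i, i < n -> cls i <= n) ->
  (forall i, i < n -> Fa 0 (i * n + y) = bit i) -> (forall i, bit i < 2) ->
  (forall k, st * N * 2 <= k < B -> Fa 5 k = 0) ->
  wp refine_code (n * 10 + 3) ra Fa ta (fun r F t =>
    [/\ frame [:: 9; 12] r ra, aframe [:: 4; 5] F Fa, t = ta,
      forall k, st.+1 * N * 2 <= k < B -> F 5 k = 0 &
      forall i, i < n -> F 4 i <= n /\
        forall j, j < n -> (F 4 i == F 4 j) = (cls i == cls j) && (bit i == bit j)]).
Proof.
move=> ra7 ra11 yn stB Fcls clsn Fbit bit2 fresh.
pose key i := (st * N + cls i) * 2 + bit i.
have keyB i : i < n -> st * N * 2 <= key i < st.+1 * N * 2.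
  by move=> i_n; have := clsn i i_n; have := bit2 i; rewrite /key mulSn; lia.
pose fi i := first_index n predT key (key i).
have fin i : i < n -> fi i < n by move=> i_n; exact: leq_ltn_trans (first_index_le key i_n (isT : predT i)) i_n.
pose I x r F t := [/\ frame [:: 9; 12] r ra, aframe [:: 4; 5] F Fa, t = ta,
  forall i, i < n -> F 4 i = if i < x then (fi i).+1 else cls i &
  forall k, st * N * 2 <= k < B -> F 5 k = first_table n predT key x k].
apply: wp_weaken; [|exact: leqnn|].
- apply: (@forP 9 0 _ 7 n I) => //.
  + by have := N_le_B; have := B_lt_W; lia.
  + by move=> x r F t /globalsP[].
  + by move=> g; split=> //; apply: frame_update.
  + move=> x r F t g xn r9 [fr afr -> F4 F5].
    have [r0 r1 r2 _ _] := globalsP g.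
    have r7 : r 7 = st by rewrite fr.
    have r11 : r 11 = y by rewrite fr.
    have F0x : F 0 (x * n + y) = bit x by rewrite afr ?Fbit.
    have F4x : F 4 x = cls x by rewrite F4 // ltnn.
    have kx := keyB x xn; have kxB : key x < B by lia.
    have nB := N_le_B; have BltW := B_lt_W.
    have idx := idx_lt xn yn; have nnB := nn_lt_B.
    have F5x : F 5 (key x) = first_table n predT key x (key x) by rewrite F5 //; lia.
    have := first_table_get key xn (isT : predT x); rewrite -F5x -/(fi x) => F5x0.
    have F5v : F 5 (key x) <> 0 -> F 5 (key x) = (fi x).+1.
      by rewrite F5x /first_table -/(fi x); case: ltnP.
    have kE : (r 7 * r 2 + F 4 (r 9)) * 2 + F 0 (r 9 * r 0 + r 11) = key x.
      by rewrite r7 r2 r9 F4x r0 r11 F0x.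
    have stNB : st * N <= B by move: stB; rewrite mulSn; lia.
    have bx := bit2 x; have cx := clsn x xn; have kd : key x = (st * N + cls x) * 2 + bit x by [].
    apply: wp_le.
      apply: wp_seq; apply: assignP => //=.
        by rewrite r0 r1 r2 r7 r9 r11 F4x F0x; do ![split => //]; lia.
      rewrite kE; apply: wp_seq.
      (* Both branches of the test leave in the cell the first vertex with this key, plus 1; the
         rest of the body is common to them. *)
      have final : forall F', F' 5 (key x) = (fi x).+1 -> aframe [:: 5] F' F ->
        (forall k, st * N * 2 <= k < B -> k != key x -> F' 5 k = F 5 k) ->
        wp (put 4[%9] <~ 5$[%12])%C 1 (update r 12 (key x)) F' ta (fun r' F' t' => r' 9 = x /\ I x.+1 (update r' 9 x.+1) F' t').
        move=> F' F'5 aF' oF'; apply: storeP; rewrite ?[safe _ _ _ _ _]/=.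
        - by rewrite /update /= r1 r9; split=> //; lia.
        - by rewrite /update /= r1; split=> //; lia.
        rewrite /= -[update r 12 _ 9]/(r 9) -[update r 12 _ 12]/(key x) r9 F'5.
        split; first by [].
        split=> //.
        - by do 2![apply: frame_update => //].
        - by apply: aframe_set => //; exact: (aframe_trans _ _ aF' afr).
        - move=> i i_n; rewrite /set_array /= ltnS.
          case: eqP => [->|ix]; first by rewrite leqnn.
          by rewrite aF' // F4 // [i <= x]leq_eqVlt (introF eqP ix).
        - move=> k kB; rewrite /set_array /= first_tableS //.
          by case: eqP => [->|kx'] //; rewrite oF' ?F5 //; apply/eqP.
      apply: condP.
      - by rewrite /update /= r1; split=> //; lia.
      - rewrite /= -[update r 12 _ 12]/(key x) F5x0 bool_neq0 => /eqP fx; apply: storeP.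
        + by rewrite /update /= r1; split=> //; lia.
        + by rewrite /update /= r9; split=> //; lia.
        rewrite /= -[update r 12 _ 12]/(key x) -[update r 12 _ 9]/(r 9) r9; apply: final.
        + by rewrite /set_array !eqxx addn1 fx.
        + by apply: aframe_set.
        + by move=> k kB kk; rewrite /set_array (negbTE kk).
      - rewrite /= -[update r 12 _ 12]/(key x) => /eqP; rewrite eqb0 => nz; apply: wp_le; first apply: wp_skip.
          by apply: final => //; apply: F5v; apply/eqP.
        by [].
    by [].
- move=> r F t g [fr afr -> F4 F5]; split=> //.
    move=> k kB; rewrite F5; last by move: kB; rewrite mulSn; lia.
    rewrite /first_table; case: ltnP => // kn.
    have [_ E] := first_indexP kn; have := keyB _ kn; rewrite E; lia.
  move=> i i_n; rewrite F4 // i_n; split=> [|j jn]; first exact: fin.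
  rewrite F4 // jn eqSS first_index_eq // /key.
  have := bit2 i; have := bit2 j; move: (cls i) (cls j) (bit i) (bit j) => a b c d.
  by move=> d2 c2; apply/eqP/andP => [E|[/eqP -> /eqP ->]] //; split; apply/eqP; lia.
Qed.

Variable e : rel 'I_n.

(** The machine indexes by naturals, so the relation is extended by false outside ['I_n]. *)
Definition adj (i j : nat) : bool := [exists x : 'I_n, exists y : 'I_n, [&& x == i :> nat, y == j :> nat & e x y]].

Lemma adjE (x y : 'I_n) : adj x y = e x y.
Proof.
apply/existsP/idP => [[x' /existsP[y' /and3P[/eqP/val_inj -> /eqP/val_inj ->]]] //|exy].
by exists x; apply/existsP; exists y; rewrite !eqxx.
Qed.

Definition fresh (st : nat) (F : nat -> nat -> nat) : Prop :=
  forall k, st * N * 2 <= k < B -> F 5 k = 0.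

Definition holds_input (F : nat -> nat -> nat) : Prop :=
  forall i j, i < n -> j < n -> F 0 (i * n + j) = adj i j.

(** A sample outside the alive set leaves the classes alone, which is right because [agree] ignores
    it. *)
Lemma sampleP (rep : 'I_n -> 'I_n) ys st ra Fa ta : ra 7 = st -> st.+2 * N * 2 <= B ->
  holds_input Fa -> (forall u : 'I_n, Fa 1 u = rep u) ->
  (forall i, i < n -> Fa 4 i <= n) ->
  (forall x y : 'I_n, (Fa 4 x == Fa 4 y) = agree e rep ys x y) ->
  fresh st.+1 Fa ->
  wp sample_code (n * 10 + 10) ra Fa ta (fun r F t =>
    [/\ frame [:: 7; 9; 11; 12] r ra, aframe [:: 4; 5] F Fa, t = behead ta,
       r 7 = st.+1 /\ fresh st.+2 F &
       (forall i, i < n -> F 4 i <= n) /\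
       (forall x y : 'I_n, (F 4 x == F 4 y) = agree e rep (rcons ys (head 0 ta %% N)) x y)]).
Proof.
move=> ra7 stB inp Frep clsn cls fr; apply: wp_G => g; have [r0 r1 r2 _ _] := globalsP g.
have nB := N_le_B; have BltW := B_lt_W.
have N0 : 0 < N by exact: leq_trans nN.
set y := head 0 ta %% N; have yN : y < N by rewrite ltn_mod.
have stW : st.+1 < W by move: stB; rewrite mulSn; nia.
apply: wp_le.
  apply: wp_seq; apply: wp_rand => [v|]; first exact: globals_update.
  apply: wp_seq; apply: assignP => //; rewrite /= -[update ra _ _ 11]/(head 0 ta) -[update ra _ _ 2]/(ra 2) r2 -/y.
  set r' := update _ 11 y.
  apply: wp_seq; apply: assignP => //.
    by rewrite /r' /update /= ra7; split=> //; lia.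
  rewrite /= -[r' 7]/(ra 7) ra7 addn1; set r'' := update _ 7 _.
  have fr'' : frame [:: 7; 9; 11; 12] r'' ra by do 3![apply: frame_update => //].
  have Fy : forall z : 'I_n, z = y :> nat -> (Fa 1 y == y) = (z \in alive rep).
    by move=> z zy; rewrite -zy Frep inE.
  apply: condP.
  - rewrite /= -[r'' 11]/y -[r'' 0]/(ra 0) -[r'' 1]/(ra 1) r0 r1; do ![split=> //]; try lia.
  - rewrite /= -[r'' 11]/y -[r'' 0]/(ra 0) r0 => nz.
    have /andP[yn /eqP Fyy] : (y < n) && (Fa 1 y == y) by case: (y < n) nz; case: (Fa 1 y == y).
    pose z := Ordinal yn.
    have zA : z \in alive rep by rewrite -Fy // Fyy.
    apply: wp_weaken.
      apply: (@refineP (Fa 4) (adj^~ y) st.+1 y) => //.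
      + by move=> i i_n; exact: inp.
      + by move=> i; case: (adj i y).
    exact: leqnn.
    move=> r F t g' [fr1 fr2 -> fr5 F4]; split=> //.
    + exact: (frame_trans _ _ fr1 fr'').
    + by split=> //; rewrite fr1.
    + split=> [i i_n|x x']; first by have [] := F4 i i_n.
      have [_ -> //] := F4 x (ltn_ord x).
      rewrite cls agree_catr; congr (_ && _).
      have -> : (nat_of_bool (adj x y) == nat_of_bool (adj x' y)) = (e x z == e x' z).
        by rewrite -(adjE x z) -(adjE x' z) /=; do 2!case: (adj _ _).
      apply/eqP/forall_inP => [E u uA|/(_ z zA)]; last by rewrite eqxx => /eqP.
      by apply/implyP => /eqP uy; rewrite (_ : u = z) ?E //; apply: val_inj.
  - rewrite /= -[r'' 11]/y -[r'' 0]/(ra 0) r0 => z0.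
    apply: wp_le; first apply: wp_skip; last by lia.
    split=> //; first split=> //.
    + by move=> k kB; apply: fr; move: kB; rewrite mulSn; lia.
    + split=> // x x'; rewrite cls agree_catr -[LHS]andbT; congr (_ && _); apply/esym/forall_inP => u uA.
      apply/implyP => /eqP uy; move: z0; rewrite (Fy u uy) uA.
      by rewrite -uy ltn_ord.
by lia.
Qed.

Lemma classesP (rep : 'I_n -> 'I_n) ss st ra Fa ta : ra 7 = st -> ra 8 = ss -> ss <= N -> (st + ss).+1 * N * 2 <= B ->
  holds_input Fa -> (forall u : 'I_n, Fa 1 u = rep u) ->
  (forall i, i < n -> Fa 4 i = 0) -> fresh st.+1 Fa ->
  wp (for_loop 10 8 sample_code) (ss * (n * 10 + 13) + 3) ra Fa ta (fun r F t =>
    [/\ frame [:: 7; 9; 10; 11; 12] r ra, aframe [:: 4; 5] F Fa, t = drop ss ta,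
       r 7 = st + ss /\ fresh (st + ss).+1 F &
       (forall i, i < n -> F 4 i <= n) /\
       (forall x y : 'I_n, (F 4 x == F 4 y) =
          agree e rep (mkseq (fun i => nth 0 ta i %% N) ss) x y)]).
Proof.
move=> ra7 ra8 ssN stB inp Frep cls0 fr.
have nB := N_le_B; have BltW := B_lt_W.
pose ys x := mkseq (fun i => nth 0 ta i %% N) x.
pose I x r F t := [/\ frame [:: 7; 9; 10; 11; 12] r ra, aframe [:: 4; 5] F Fa, t = drop x ta,
       r 7 = st + x /\ fresh (st + x).+1 F &
       (forall i, i < n -> F 4 i <= n) /\
       (forall x' y : 'I_n, (F 4 x' == F 4 y) = agree e rep (ys x) x' y)].
apply: (wp_weaken (Q := I ss)); [|exact: leqnn|by []].
rewrite (_ : ss * (n * 10 + 13) = ss * (n * 10 + 10 + 3)); last by lia.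
apply: forP => //.
- by lia.
- by move=> x r F t g [fr' _ _ _ _]; rewrite fr'.
- move=> g; split=> //.
  + by apply: frame_update.
  + by rewrite drop0.
  + by rewrite addn0 -[update _ _ _ 7]/(ra 7).
  + by split=> [i /cls0 -> //|x y]; rewrite !cls0 // eqxx.
- move=> x r F t g xss r10 [fr1 fr2 -> [r7 fr5] [cn ag]].
  have stB' : (st + x).+2 * N * 2 <= B.
    by apply: leq_trans stB; do 2![apply: leq_mul => //]; lia.
  apply: wp_weaken.
    apply: (@sampleP rep (ys x) (st + x)) => //.
    + by move=> i j i_n jn; rewrite fr2 // inp.
    + by move=> u; rewrite fr2.
  exact: leqnn.
  move=> r' F' t' g' [f1 f2 -> [r'7 f5] [cn' ag']]; split; first by rewrite f1.
  split.
  + by apply: frame_update => //; exact: (frame_trans _ _ f1 fr1).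
  + exact: (aframe_trans _ _ f2 fr2).
  + by rewrite -drop1 drop_drop add1n.
  + by rewrite -[update _ _ _ 7]/(r' 7) addnS.
  + by split=> // x' y; rewrite ag' /ys mkseqS -[head 0 _]nth0 nth_drop addn0.
Qed.

Lemma leadersP (rep : 'I_n -> 'I_n) ys st ra (Fa : nat -> nat -> nat) ta :
  ra 7 = st -> st.+1 * N * 2 <= B -> (forall u : 'I_n, Fa 1 u = rep u) ->
  (forall i, i < n -> Fa 4 i <= n) ->
  (forall x y : 'I_n, (Fa 4 x == Fa 4 y) = agree e rep ys x y) -> fresh st Fa ->
  \sum_(z in alive rep) Fa 3 z <= n ->
  wp leader_code (n * 20 + 3) ra Fa ta (fun r F t =>
    [/\ frame [:: 9; 12; 13] r ra, aframe [:: 3; 5; 6; 7] F Fa, t = ta, fresh st.+1 F &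
      forall x : 'I_n, x \in alive rep ->
        [/\ F 6 x = leader e rep ys x, F 7 x = weight_below e rep ys (Fa 3) (leader e rep ys x) x &
           leader e rep ys x = x -> F 3 x = weight_below e rep ys (Fa 3) x n]]).
Proof.
move=> ra7 stB Frep clsn cls fr szn.
pose P i := Fa 1 i == i; pose key i := (st * N + Fa 4 i) * 2.
have PE (x : 'I_n) : P x = (x \in alive rep) by rewrite inE /P Frep.
have keyE (x y : 'I_n) : (key x == key y) = agree e rep ys x y.
  by rewrite -cls /key eqn_mul2r /= eqn_add2l.
have keyB i : i < n -> st * N * 2 <= key i < st.+1 * N * 2.
  by move=> i_n; have := clsn i i_n; rewrite /key mulSn; lia.
(* Keys coincide exactly on agreeing vertices, so the first alive index with the key of [x] is the
   least of its class. *)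
have fiE (x : 'I_n) : x \in alive rep -> first_index n P key (key x) = leader e rep ys x.
  move=> xA; have [lA lx lmin] := leaderP e ys xA.
  have fl : first_index n P key (key x) <= leader e rep ys x.
    by have /eqP <- : key (leader e rep ys x) == key x; rewrite ?keyE // first_index_le ?PE.
  have fn := leq_ltn_trans fl (ltn_ord _); have [Pf kf] := first_indexP fn.
  apply/eqP; rewrite eqn_leq fl /=; apply: (lmin (Ordinal fn)); rewrite -?PE // -keyE.
  by apply/eqP.
pose ld (x : 'I_n) := leader e rep ys x.
pose wb p x := weight_below e rep ys (Fa 3) p x.
(* An alive vertex already scanned has its leader and shift; if it is a leader, its entry in array 3
   is the weight collected so far. Sizes of alive vertices not yet scanned are unchanged. *)
pose I x r F t := [/\ frame [:: 9; 12; 13] r ra, aframe [:: 3; 5; 6; 7] F Fa, t = ta,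
  forall k, st * N * 2 <= k < B -> F 5 k = first_table n P key x k &
  forall z : 'I_n, z \in alive rep ->
    [/\ z < x -> F 6 z = ld z /\ F 7 z = wb (ld z) z,
        z < x -> ld z = z -> F 3 z = wb z x & x <= z -> F 3 z = Fa 3 z]].
have nB := N_le_B; have BltW := B_lt_W.
apply: wp_weaken; [|exact: leqnn|].
- rewrite (_ : n * 20 = n * (17 + 3)) //; apply: (@forP 9 0 _ 17 n I) => //; first by lia.
  + by move=> x r F t /globalsP[].
  + move=> g; split=> //; by apply: frame_update.
  + move=> x r F t g xn r9 [f1 f2 -> F5 Fz].
    have [r0 r1 r2 _ _] := globalsP g.
    have r7 : r 7 = st by rewrite f1.
    pose xo := Ordinal xn.
    have wbS p : wb p x.+1 = wb p x + (if (xo \in alive rep) && (ld xo == p) then Fa 3 x else 0).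
      exact: (weight_belowS e rep ys (Fa 3) p xo).
    have F1x : F 1 x = rep xo by rewrite f2 // -Frep.
    have F4x : F 4 x = Fa 4 x by rewrite f2.
    have kx := keyB x xn; have kxB : key x < B by lia.
    have stNB : st * N <= B by move: stB; rewrite mulSn; lia.
    have cx := clsn x xn; have kd : key x = (st * N + Fa 4 x) * 2 by [].
    apply: wp_le; first apply: condP.
    * by rewrite /= r9 r1; do ![split=> //]; lia.
    * rewrite /= r9 F1x bool_neq0 => /eqP xA; have {}xA : xo \in alive rep by rewrite inE; apply/eqP/val_inj.
      have fx : first_index n P key (key x) = ld xo := fiE xo xA.
      have [_ _ /(_ (leqnn _)) F3x] := Fz xo xA; rewrite /= in F3x.
      have [lA lx lmin] := leaderP e ys xA; rewrite -/(ld xo) in lA lx lmin.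
      have lex : ld xo <= x := lmin xo xA (agree_refl _ _ _ _).
      have ldl : ld (ld xo) = ld xo := leader_id e ys xA.
      have kE : (r 7 * r 2 + F 4 (r 9)) * 2 = key x by rewrite r7 r2 r9 F4x.
      apply: wp_seq; apply: assignP => //=.
        by rewrite r7 r1 r2 r9 F4x; do ![split=> //]; lia.
      rewrite kE; set r1' := update r 12 _.
      have Px : P x by rewrite -[x]/(nat_of_ord xo) PE.
      have F5x : F 5 (key x) = first_table n P key x (key x) by rewrite F5 //; lia.
      have := first_table_get key xn Px; rewrite -F5x fx => F5x0.
      apply: (@wp_seq _ _ _ _ _ 2).
      have tail : forall F', F' 5 (key x) = (ld xo).+1 -> aframe [:: 5] F' F ->
        (forall k, st * N * 2 <= k < B -> k != key x -> F' 5 k = F 5 k) ->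
        wp (13 ::= 5$[%12] - #1;; put 6[%9] <~ %13;;
          cond (%13 == %9) (put 7[%9] <~ #0)
          (put 7[%9] <~ 3$[%13];; put 3[%13] <~ 3$[%13] + 3$[%9]))%C 8 r1' F' ta
          (fun r' F' t' => r' 9 = x /\ I x.+1 (update r' 9 x.+1) F' t').
        move=> F' F'5 aF' oF'; apply: wp_le.
          apply: wp_seq; apply: assignP => //.
            by rewrite /= -[r1' 1]/(r 1) -[r1' 12]/(key x) r1 F'5; do ![split=> //]; lia.
          rewrite /= -[r1' 12]/(key x) F'5 subn1 /=; set r2' := update r1' 13 _.
          have r2'9 : r2' 9 = x by rewrite -[LHS]/(r 9).
          have r2'1 : r2' 1 = B by rewrite -[LHS]/(r 1).
          have r2'13 : r2' 13 = ld xo by [].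
          have fr2' : frame [:: 9; 12; 13] r2' ra by do 2![apply: frame_update => //].
          apply: wp_seq; apply: storeP => //=.
            by rewrite r2'1 r2'9; do ![split=> //]; lia.
          rewrite r2'9 r2'13.
          have ldW : ld xo < B by have := ltn_ord (ld xo); lia.
          have F'3 : F' 3 = F 3 by rewrite aF'.
          have F'6 : F' 6 = F 6 by rewrite aF'.
          have F'7 : F' 7 = F 7 by rewrite aF'.
          have tab k : st * N * 2 <= k < B -> F' 5 k = first_table n P key x.+1 k.
            move=> kB; rewrite first_tableS // fx; case: eqP => [-> //|kx'].
            by rewrite oF' ?F5 //; apply/eqP.
          have aF2 : aframe [:: 3; 5; 6; 7] F' Fa.
            exact: (aframe_trans _ _ aF' f2).
          apply: (@condP _ _ _ 3).
          * by [].

          * rewrite /= r2'9 r2'13 bool_neq0 => /eqP lx0.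
            (* A leader is the least of its class, so no earlier vertex joined it: its shift is 0
               and its own size starts the sum. *)
            have lxo : ld xo = xo by apply: val_inj.
            apply: wp_le; first apply: storeP => //=; last by [].
              by rewrite r2'1 r2'9; do ![split=> //]; lia.
            by lia.
            rewrite r2'9; split=> //; split=> //.
            - by apply: frame_update.
            - by do 2!apply: aframe_set => //.
            move=> z zA; have [z1 z2 z3] := Fz z zA; rewrite /set_array /= F'3 F'6 F'7; split.
            - rewrite ltnS leq_eqVlt => /orP[/eqP zx|zx].
                have -> : z = xo by apply: val_inj.
                rewrite eqxx; split=> //; rewrite /wb /weight_below big1 // => z' /and3P[z'A z'x /eqP z'l].
                have [_ _ /(_ _ z'A (agree_refl _ _ _ _))] := leaderP e ys z'A.
                by rewrite z'l lxo leqNgt z'x.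
              by have [-> ->] := z1 zx; rewrite !ltn_eqF.
            - rewrite ltnS leq_eqVlt => /orP[/eqP zx|zx] lz.
                have zxo : z = xo by apply: val_inj.
                rewrite zxo wbS xA lxo eqxx F3x.
                rewrite /wb /weight_below big1 // => z' /and3P[z'A z'x /eqP z'l].
                have [_ _ /(_ _ z'A (agree_refl _ _ _ _))] := leaderP e ys z'A.
                by rewrite z'l leqNgt z'x.
              rewrite z2 // wbS xA lxo.
              by case: eqP => [E|_]; rewrite ?addn0 //; move: zx; rewrite -E ltnn.
            - by move=> xz; apply: z3; exact: ltnW.
          * rewrite /= r2'9 r2'13 => /eqP; rewrite eqb0 => lx0.
            have ltx : ld xo < x by rewrite ltn_neqAle lx0.
            have [_ /(_ ltx ldl) F3l _] := Fz _ lA.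
            (* The accumulated size never exceeds [n], so the addition cannot overflow. *)
            have wbn : wb (ld xo) x + Fa 3 x <= n.
              by apply: leq_trans szn; have := weight_below_le e rep ys (Fa 3) (ld xo) (nat_of_ord xo).+1;
                rewrite weight_belowS xA eqxx.
            apply: (wp_le (k := (1 + 1).+1)) => //; apply: wp_seq; apply: storeP => //=.
              by rewrite r2'1 r2'9; do ![split=> //]; lia.
            rewrite r2'9 r2'13; apply: storeP => //=.
              rewrite r2'1 r2'13 r2'9 /set_array /= F'3 F3l F3x.
              by do ![split=> //]; lia.
            rewrite r2'13 r2'9 /set_array /= F'3 F3l F3x.
            split=> //; split=> //.
            - by apply: frame_update.
            - by do 3!apply: aframe_set => //.
            move=> z zA; have [z1 z2 z3] := Fz z zA; rewrite /set_array /= F'3 F'6 F'7; split.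
            - rewrite ltnS leq_eqVlt => /orP[/eqP zx|zx].
                have -> : z = xo by apply: val_inj.
                by rewrite eqxx.
              by have [-> ->] := z1 zx; rewrite !ltn_eqF.
            - rewrite ltnS leq_eqVlt => /orP[/eqP zx|zx] lz.
                have zxo : z = xo by apply: val_inj.
                by move: ltx; rewrite -zxo lz zx ltnn.
              rewrite wbS xA z2 //.
              rewrite -val_eqE eq_sym; case: eqP => [E|_]; last by rewrite addn0.
              by congr (_ + _); rewrite /wb; congr (weight_below _ _ _ _ _); apply: val_inj.
            - move=> xz; rewrite z3 ?(ltnW xz) //; case: eqP => // E.
              by move: ltx; rewrite -E ltnNge (ltnW xz).
        by lia.
      apply: condP.
      - by rewrite /= -[r1' 1]/(r 1) -[r1' 12]/(key x) r1; do ![split=> //]; lia.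
      - rewrite /= -[r1' 12]/(key x) F5x0 bool_neq0 => /eqP fxx; apply: storeP => //=.
        + by rewrite -[r1' 9]/(r 9) r9; do ![split=> //]; lia.
        rewrite -[r1' 9]/(r 9) -[r1' 12]/(key x) r9; apply: tail.
        + by rewrite /set_array !eqxx addn1 fxx.
        + by apply: aframe_set.
        + by move=> k kB kk; rewrite /set_array (negbTE kk).
      - rewrite /= -[r1' 12]/(key x) => /eqP; rewrite eqb0 => nz; apply: wp_skip.
        apply: tail => //; move: nz; rewrite F5x /first_table fx; by case: ltnP.
    * rewrite /= r9 F1x => xA.
      have {}xA : xo \notin alive rep by rewrite inE -val_eqE; apply/eqP => E; move: xA; rewrite E eqxx.
      apply: wp_le; first apply: wp_skip; last by [].
      split=> //; split=> //; first by apply: frame_update.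
        by move=> k kB; rewrite first_table_skip ?F5 // -[x]/(nat_of_ord xo) PE.
      move=> z zA; have [z1 z2 z3] := Fz z zA.
      have zx : z <> x :> nat by move=> E; move: xA; rewrite (_ : xo = z) ?zA //; apply: val_inj.
      split; rewrite ?ltnS.
      - by move=> zx'; apply: z1; rewrite ltn_neqAle zx' andbT; apply/eqP.
      - move=> zx' lz; rewrite z2 //; last by rewrite ltn_neqAle zx' andbT; apply/eqP.
        by rewrite wbS (negbTE xA) addn0.
      - by move=> xz; apply: z3; exact: ltnW.
    by [].
- move=> r F t g [f1 f2 -> F5 Fz]; split=> //.
    move=> k kB; rewrite F5; last by move: kB; rewrite mulSn; lia.
    rewrite /first_table; case: ltnP => // kn.
    have [_ E] := first_indexP kn; have := keyB _ kn; rewrite E; lia.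
  move=> x xA; have [x1 x2 _] := Fz x xA.
  by have [-> ->] := x1 (ltn_ord x); split=> // /(x2 (ltn_ord x)).
Qed.

Lemma moveP (rep lead : 'I_n -> 'I_n) ra (Fa : nat -> nat -> nat) ta :
  (forall u : 'I_n, Fa 1 u = rep u) -> (forall u : 'I_n, Fa 6 (rep u) = lead (rep u)) ->
  (forall u : 'I_n, Fa 2 u + Fa 7 (rep u) <= n) ->
  wp move_code (n * 10 + 3) ra Fa ta (fun r F t =>
    [/\ frame [:: 9; 13] r ra, aframe [:: 1; 2] F Fa, t = ta,
      forall u : 'I_n, F 1 u = lead (rep u) & forall u : 'I_n, F 2 u = Fa 2 u + Fa 7 (rep u)]).
Proof.
move=> F1 F6 F27; have nB := N_le_B; have BltW := B_lt_W.
pose I x r F t := [/\ frame [:: 9; 13] r ra, aframe [:: 1; 2] F Fa, t = ta,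
  forall u : 'I_n, F 1 u = if u < x then lead (rep u) else rep u &
  forall u : 'I_n, F 2 u = if u < x then Fa 2 u + Fa 7 (rep u) else Fa 2 u].
apply: wp_weaken; [|exact: leqnn|].
- rewrite (_ : n * 10 = n * (7 + 3)) //; apply: (@forP 9 0 _ 7 n I) => //; first by lia.
  + by move=> x r F t /globalsP[].
  + by move=> g; split=> //; apply: frame_update.
  + move=> x r F t g xn r9 [f1 f2 -> G1 G2]; pose xo := Ordinal xn.
    have [r0 r1 r2 _ _] := globalsP g.
    have F1x : F 1 x = rep xo by have := G1 xo; rewrite ltnn.
    have F2x : F 2 x = Fa 2 xo by have := G2 xo; rewrite ltnn.
    have F7x : F 7 (rep xo) = Fa 7 (rep xo) by rewrite f2.
    have F6x : F 6 (rep xo) = lead (rep xo) by rewrite f2.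
    have := F27 xo => le27; have rn := ltn_ord (rep xo); have xnn := ltn_ord xo.
    apply: wp_le.
      apply: wp_seq; apply: assignP => //=; first by rewrite r9 r1; do ![split=> //]; lia.
      rewrite r9 F1x; set r' := update _ _ _.
      have r'9 : r' 9 = x by rewrite -[LHS]/(r 9).
      have r'1 : r' 1 = B by rewrite -[LHS]/(r 1).
      have r'13 : r' 13 = rep xo by [].
      apply: wp_seq; apply: storeP => //=; rewrite ?r'9 ?r'1 ?r'13 ?F2x ?F7x.
        by do ![split=> //]; lia.
        by do ![split=> //]; lia.
      apply: storeP => //=; rewrite ?r'9 ?r'1 ?r'13; try by do ![split=> //]; lia.
      rewrite [set_array F 2 _ _ 6 _]/set_array /= F6x; split=> //; split=> //.
      * by do 2![apply: frame_update => //].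
      * by do 2![apply: aframe_set => //].
      * move=> u; rewrite /set_array /= ltnS leq_eqVlt; case: (u =P x :> nat) => [ux|_] /=; last exact: G1.
        by have -> : u = xo by apply: val_inj.
      * move=> u; rewrite /set_array /= ltnS leq_eqVlt; case: (u =P x :> nat) => [ux|_] /=; last exact: G2.
        by have -> : u = xo by apply: val_inj.
    by [].
- by move=> r F t g [f1 f2 -> G1 G2]; split=> // u; rewrite ?G1 ?G2 ltn_ord.
Qed.

Lemma clearP ra (Fa : nat -> nat -> nat) ta :
  wp (for_loop 9 0 (put 4[%9] <~ #0)) (n * 4 + 3) ra Fa ta (fun r F t =>
    [/\ frame [:: 9] r ra, aframe [:: 4] F Fa, t = ta & forall i, i < n -> F 4 i = 0]).
Proof.
have nB := N_le_B; have BltW := B_lt_W.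
apply: (@forP 9 0 _ 1 n (fun x r F t => [/\ frame [:: 9] r ra, aframe [:: 4] F Fa, t = ta &
  forall i, i < x -> F 4 i = 0])) => //; first by lia.
- by move=> x r F t /globalsP[].
- by move=> g; split=> //; apply: frame_update.
- move=> x r F t g xn r9 [f1 f2 -> F4]; have [r0 r1 _ _ _] := globalsP g.
  apply: storeP => /=; rewrite ?r9 ?r1; [by split=> //; lia|by lia|].
  split=> //; split=> //; first by apply: frame_update.
    by apply: aframe_set.
  by move=> i; rewrite ltnS leq_eqVlt /set_array /=; case: (i == x) => //= /F4.
Qed.

(** A round uses [ss] stamps for the samples and one more for the table of leaders. *)
Lemma roundP (rep : 'I_n -> 'I_n) ss st ra (Fa : nat -> nat -> nat) ta :
  ra 7 = st -> ra 8 = ss -> ss <= N -> (st + ss).+2 * N * 2 <= B ->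
  holds_input Fa -> (forall u : 'I_n, Fa 1 u = rep u) -> layout rep (Fa 3) (Fa 2) ->
  fresh st.+1 Fa ->
  wp round_code (ss * (n * 10 + 13) + n * 34 + 17) ra Fa ta (fun r F t =>
    let ys := mkseq (fun i => nth 0 ta i %% N) ss in
    [/\ frame [:: 7; 9; 10; 11; 12; 13] r ra, aframe [:: 1; 2; 3; 4; 5; 6; 7] F Fa, t = drop ss ta,
       r 7 = (st + ss).+1 /\ fresh (st + ss).+2 F &
       [/\ forall u : 'I_n, F 1 u = merge_reps e rep ys u,
           layout (merge_reps e rep ys) (F 3) (F 2) &
           forall f, (forall u v, f u = f v -> rep u = rep v) ->
             contiguous f rep (Fa 2) -> contiguous f (merge_reps e rep ys) (F 2)]]).
Proof.
move=> ra7 ra8 ssN stB inp Frep lay fr; have nB := N_le_B; have BltW := B_lt_W.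
set ys := mkseq _ _.
apply: wp_le.
  apply: wp_seq; apply: wp_weaken; [exact: clearP|exact: leqnn|].
  move=> r F t g [f1 f2 -> F4].
  apply: wp_seq; apply: wp_weaken.
    apply: (@classesP rep ss st) => //.
    - by rewrite f1.
    - by rewrite f1.
    - by apply: leq_trans stB; rewrite !leq_mul2r; lia.
    - by move=> i j i_n jn; rewrite f2 // inp.
    - by move=> u; rewrite f2.
    - by move=> k kB; rewrite f2 // fr.
  exact: leqnn.
  move=> rb Fb tb gb /= [h1 h2 -> [r7 frF] [cn ag]]; rewrite -/ys in ag.
  have {h1} fb1 : frame [:: 7; 9; 10; 11; 12; 13] rb ra by exact: (frame_trans _ _ h1 f1).
  have {h2} fb2 : aframe [:: 4; 5] Fb Fa by exact: (aframe_trans _ _ h2 f2).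
  apply: wp_seq; apply: assignP => //.
    by rewrite /= r7; do ![split => //]; move: stB; rewrite mulSn; nia.
  rewrite /= r7 addn1; set r' := update rb 7 _.
  have f1' : frame [:: 7; 9; 10; 11; 12; 13] r' ra by apply: frame_update.
  have F3 : Fb 3 = Fa 3 by rewrite fb2.
  apply: wp_seq; apply: wp_weaken.
    apply: (@leadersP rep ys (st + ss).+1) => //.
    - by move=> u; rewrite fb2.
    - by rewrite F3 (layout_total lay).
  exact: leqnn.
  move=> r2 F2 t2 g2 /= [h1 h2 -> fr2 Hl]; rewrite F3 in Hl.
  have idr := layout_idem lay.
  have F2E : F2 2 = Fa 2 by rewrite h2 // fb2.
  have F1E : F2 1 = Fa 1 by rewrite h2 // fb2.
  pose off' u := Fa 2 u + F2 7 (F2 1 u).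
  have off'E (u : 'I_n) : off' u = Fa 2 u + weight_below e rep ys (Fa 3) (merge_reps e rep ys u) (rep u).
    by rewrite /off' F1E Frep; have [_ -> _] := Hl _ (idr u).
  have sz'E (x : 'I_n) : x \in alive rep -> leader e rep ys x = x -> F2 3 x = weight_below e rep ys (Fa 3) x n.
    by move=> xA; have [_ _] := Hl x xA.
  have lay' := layout_merge lay sz'E off'E.
  apply: wp_weaken.
    apply: (@moveP rep (leader e rep ys)).
    - by move=> u; rewrite F1E.
    - by move=> u; have [] := Hl _ (idr u).
    - move=> u; have := layout_lt lay' u; rewrite /off' F1E Frep F2E => /ltnW/leq_trans; apply.
      by rewrite (layout_size lay' (layout_idem lay' _)) -[X in _ <= X]card_ord max_card.
  exact: leqnn.
  move=> r3 F3' t3 g3 /= [k1 k2 -> G1 G2].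
  have off3 (u : 'I_n) : F3' 2 u = off' u by rewrite G2 F2E /off' F1E Frep.
  have F33 : F3' 3 = F2 3 by rewrite k2.
  split=> //.
  - have q : frame [:: 7; 9; 10; 11; 12; 13] r2 ra by exact: (frame_trans _ _ h1 f1').
    exact: (frame_trans _ _ k1 q).
  - have q : aframe [:: 3; 4; 5; 6; 7] F2 Fa by exact: (aframe_trans _ _ h2 fb2).
    exact: (aframe_trans _ _ k2 q).
  - by rewrite k1 // h1 //; split=> // k kB; rewrite k2 // fr2.
  - split=> //.
    + rewrite F33; case: lay' => i1 i2 i3 i4; split=> //.
      * by move=> u; rewrite off3.
      * by move=> u v uv; rewrite !off3; exact: i4.
    + move=> f fr' cf; have := contiguous_merge lay off'E fr' cf.
      by move=> c u v x fux vu; rewrite !off3; exact: c.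
by lia.
Qed.

Hypothesis stamps : (T * s.+1 + 2) * N * 2 <= B.
Hypothesis s_le_N : s <= N.
Hypothesis T_lt : T.+1 < W.

Definition cost_rounds : nat :=
  T.+1 * (s * (n * 10 + 13) + n * 34 + 22) + n * 6 + 20.

(** After the extra round without samples all vertices form one cluster, so on every tape the
    offsets inject the vertices into the numbers below [n], and the clusters of all earlier rounds
    are intervals. *)
Lemma roundsP ra (Fa : nat -> nat -> nat) ta :
  holds_input Fa -> (forall k i, 0 < k < 16 -> i < B -> Fa k i = 0) ->
  wp rounds_code cost_rounds ra Fa ta (fun r F t =>
    [/\ aframe [:: 1; 2; 3; 4; 5; 6; 7] F Fa, forall u v : 'I_n, F 2 u = F 2 v -> u = v,
        forall u : 'I_n, F 2 u < n &
        forall j, j <= T -> forall y, convex (fun u : 'I_n => F 2 u) (cluster (rep_at e N s id ta j) y)]).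
Proof.
move=> inp zero; have nB := N_le_B; have BltW := B_lt_W.
pose rp j := rep_at e N s id ta j.
have idr j : forall u, rp j u \in alive (rp j).
  by apply: rep_at_idem => u; rewrite inE.
have rpS j : rp j.+1 = merge_reps e (rp j) (samples N s ta j) by [].
have rp_fine j i u v : rp j u = rp j v -> rp (j + i) u = rp (j + i) v.
  by move=> E; elim: i => [|i IH]; rewrite ?addn0 // addnS !rpS /merge_reps IH.
(* [minn x T] counts the rounds that draw words, each using [s.+1] stamps; [x - T] is 1 after the
   extra round, which uses a single stamp. *)
pose I x r F t := [/\ aframe [:: 1; 2; 3; 4; 5; 6; 7] F Fa,
  r 14 = T.+1, t = drop (minn x T * s) ta,
  r 7 = minn x T * s.+1 + (x - T) /\ fresh (r 7).+1 F &
  let rep := if x <= T then rp x else merge_reps e (rp T) [::] in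
  [/\ forall u : 'I_n, F 1 u = rep u, layout rep (F 3) (F 2) &
      forall j, j <= minn x T -> contiguous (rp j) rep (F 2)]].
apply: (wp_weaken (Q := I T.+1)); last 2 first.
- exact: leqnn.
- move=> r F t g [f1 _ _ _]; rewrite /= ltnn; set rep := merge_reps _ _ _ => -[F1 lay cvx].
  (* Agreement on an empty sample always holds. *)
  have rep_eq u v : rep u = rep v by apply/eqP; rewrite leader_eq ?idr.
  split=> //.
  + by move=> u v; apply: (layout_inj lay).
  + move=> u; apply: leq_trans (layout_lt lay u) _.
    by rewrite (layout_size lay (layout_idem lay _)) -[X in _ <= X]card_ord max_card.
  + move=> j jT y u v x; rewrite !inE => /eqP uy /eqP xy h.
    by rewrite -uy; apply/eqP; apply: (cvx j _ u v x) => //; rewrite ?(minn_idPr _) /rp ?uy ?xy.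
apply: wp_le.
  pose J x (r : nat -> nat) F t := [/\ aframe [:: 1; 3] F Fa, t = ta &
    forall u : 'I_n, u < x -> F 1 u = u /\ F 3 u = 1].
  apply: wp_seq; apply: (wp_weaken (Q := J n)); [|exact: leqnn|].
    apply: (@forP 9 0 _ 3 n J) => //; first by lia.
    - by move=> x r F t /globalsP[].
    - move=> x r F t g xn r9 [f2 -> Fu]; have [r0 r1 _ _ _] := globalsP g.
      apply: (wp_le (k := (1 + 1).+1)) => //; apply: wp_seq; apply: storeP => /=; rewrite ?r9 ?r1 //.
        by split=> //; lia.
      apply: storeP => /=; rewrite ?r9 ?r1 //; first by split=> //; lia.
      split=> //; split=> //.
        by do 2!apply: aframe_set => //.
      move=> u; rewrite ltnS leq_eqVlt /set_array /=; case: eqP => [//|_ /= ux].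
      exact: Fu.
  move=> r F t g [f2 -> Fu].
  apply: wp_seq; apply: assignP => //; first by move=> /=; lia.
  apply: wp_seq; apply: assignP => //.
    have [_ _ _ _ [_ r5]] := globalsP g.
    by rewrite /= -[update r 7 _ 5]/(r 5) r5; do ![split=> //]; lia.
  have [_ _ _ _ [_ r5]] := globalsP g.
  rewrite /= -[update r 7 _ 5]/(r 5) r5 addn1; set r' := update _ 14 _.
  apply: (@forP 6 14 _ (s * (n * 10 + 13) + n * 34 + 17 + 2) T.+1 I) => //.
  - by move=> x r2 F2 t2 _ [].
  - move=> _; split=> //.
    + by apply: (aframe_trans (xs := [:: 1; 3]) (zs := [::]) _ _ f2).
    + by rewrite min0n mul0n drop0.
    + split=> [|k kB]; first by rewrite min0n mul0n /= sub0n.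
      rewrite f2 // zero //; by case/andP: kB.
    + rewrite /=; split=> [u||j].
      * by have [] := Fu u (ltn_ord u).
      * split=> [u|x _|u|u v //]; first by rewrite inE.
        - have [_ ->] := Fu x (ltn_ord x); rewrite (_ : cluster _ x = [set x]) ?cards1 //.
          by apply/setP => u; rewrite !inE.
        - by have [_ ->] := Fu u (ltn_ord u); rewrite f2 // zero //; have := ltn_ord u; lia.
      * by rewrite min0n leqn0 => /eqP ->; move=> u v x /= -> -> _.
  - move=> x r2 F2 t2 g2 xT r6 [f3 r14 -> [r7 fr] [F1 lay cvx]].
    rewrite ltnS in xT; rewrite xT in F1 lay cvx; rewrite (minn_idPl xT) in cvx r7.
    have [r0 r1 rN _ [r4 r5']] := globalsP g2.
    rewrite (eqP (_ : x - T == 0)) ?addn0 in r7; last by rewrite subn_eq0.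
    pose ss := s * (x < T).
    have ssN : ss <= N by rewrite /ss; case: (x < T); rewrite ?muln1 ?muln0.
    have xsT : x * s.+1 <= T * s.+1 by rewrite leq_mul2r xT orbT.
    apply: wp_le.
      apply: wp_seq; apply: assignP => //.
        rewrite /= r4 r6 r5' -/ss; do ![split=> //]; lia.
      rewrite /= r4 r6 r5' -/ss; set r3 := update r2 8 ss.
      apply: wp_weaken.
        apply: (@roundP (rp x) ss (x * s.+1)) => //.
        + by apply: leq_trans stamps; do 2![apply: leq_mul => //]; rewrite /ss; case: (ltnP x T) => h; [have : x.+1 * s.+1 <= T * s.+1 by [rewrite leq_mul2r h orbT]; rewrite mulSn; lia|lia].
        + by move=> i j i_n jn; rewrite f3 // inp.
        + by rewrite -r7.
      exact: leqnn.
      move=> r4' F4 t4 g4; set ys := mkseq _ _ => /= -[h1 h2 -> [r47 fr4] [G1 G2 G3]].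
      have r4'7 : r4' 7 = minn x.+1 T * s.+1 + (x.+1 - T).
        rewrite r47 /ss; case: (ltnP x T) => h.
          by rewrite (minn_idPl h) muln1 mulSn (eqP (_ : x.+1 - T == 0)) ?subn_eq0 //; lia.
        by have -> : x = T; [lia|rewrite muln0 (minn_idPr _) ?leqnSn // subSnn addn0 addn1].
      have repE : (if x.+1 <= T then rp x.+1 else merge_reps e (rp T) [::]) = merge_reps e (rp x) ys.
        case: ltnP => h.
          rewrite rpS; congr (merge_reps _ _ _); rewrite /ys /ss h muln1.
          by apply: eq_mkseq => i; rewrite nth_drop (minn_idPl xT).
        by rewrite /ys /ss ltnNge h muln0 /=; congr (merge_reps _ (rp _) _); lia.
      split; first by rewrite h1.
      split.
      + exact: (aframe_trans _ _ h2 f3).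
      + by rewrite -[update _ _ _ 14]/(r4' 14) h1.
      + rewrite drop_drop; congr drop; rewrite (minn_idPl xT) /ss; case: (ltnP x T) => h.
          by rewrite (minn_idPl h) muln1 mulSn.
        by rewrite muln0 add0n (minn_idPr _) 1?leqW //; congr (_ * _); lia.
      + rewrite -[update _ _ _ 7]/(r4' 7) -r4'7; split=> //.
        by rewrite r47.
      + rewrite repE; split=> // j jx.
        have jx' : j <= x \/ j = x.+1 /\ x < T.
          by move: jx; rewrite leq_min leq_eqVlt ltnS => /andP[/orP[/eqP ->|->]]; [right|left].
        case: jx' => [{}jx|[-> h]].
          apply: G3 => [u v|]; last exact: cvx.
          by rewrite -(subnKC jx); exact: rp_fine.
        by rewrite -repE h => u v z _ ->.
    by lia.
rewrite /cost_rounds; nia.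
Qed.

(** * Computing the codes of the block patterns *)

Section CodeForm.
Variable C : nat -> nat -> nat.

Definition code_key (b u : nat) : nat := (b * N + C b.*2 u) * N + C b.*2.+1 u.
Definition code_live (b u : nat) : bool := ~~ ((C b.*2 u == 0) && (C b.*2.+1 u == 0)).
(** Closed form of what the scan of a block writes, given the codes of its halves; the properties in
    [codes] are derived from it. *)
Definition code_form (b u : nat) : nat :=
  if code_live b u then (first_index n (code_live b) (code_key b) (code_key b u)).+1 else 0.

Lemma code_key_inj b u v : C b.*2 u < N -> C b.*2 v < N -> C b.*2.+1 u < N -> C b.*2.+1 v < N ->
  code_key b u = code_key b v -> C b.*2 u = C b.*2 v /\ C b.*2.+1 u = C b.*2.+1 v.
Proof.
move=> u1 v1 u2 v2 E; have N0 : 0 < N by exact: leq_trans u1.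
split.
- have := congr1 (divn^~ N) E; rewrite /code_key /= !divnMDl // !divn_small // !addn0.
  exact: addnI.
- by have := congr1 (modn^~ N) E; rewrite /code_key /= !modnMDl !modn_small.
Qed.

Lemma code_form_le b u : u < n -> code_form b u <= n.
Proof.
move=> un; rewrite /code_form; case: ifP => // l.
exact: leq_ltn_trans (first_index_le _ un l) un.
Qed.

End CodeForm.

Lemma code_form_ext C C' b u : (forall v, v < n -> C b.*2 v = C' b.*2 v) ->
  (forall v, v < n -> C b.*2.+1 v = C' b.*2.+1 v) -> u < n -> code_form C b u = code_form C' b u.
Proof.
move=> e1 e2 un; rewrite /code_form /code_live /code_key !e1 ?e2 //; case: ifP => // _; congr _.+1.
apply: eq_in_find => v; rewrite mem_iota => /andP[_ vn].
by rewrite e1 ?e2.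
Qed.

Lemma mul_idx a b c d : a < b -> c < d -> a * d + c < b * d.
Proof. by move=> ab cd; apply: (@leq_trans (a.+1 * d)); [rewrite mulSn addnC ltn_add2r|rewrite leq_mul2r ab orbT]. Qed.

Lemma idx_eq k a c : c < N -> (k == a * N + c) = (k %/ N == a) && (k %% N == c).
Proof.
move=> cN; have N0 : 0 < N by exact: leq_trans cN.
apply/eqP/andP => [->|[/eqP <- /eqP <-]]; last exact: divn_eq.
by rewrite divnMDl // divn_small // addn0 modnMDl modn_small.
Qed.

Lemma levelP b ra (Fa : nat -> nat -> nat) ta : ra 11 = b -> 0 < b < N ->
  let C b u := Fa 9 (b * N + u) in
  (forall u, u < n -> C b u = 0 /\ C b.*2 u <= n /\ C b.*2.+1 u <= n) ->
  (forall k, b * N * N <= k < b.+1 * N * N -> Fa 10 k = 0) ->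
  wp level_code (n * 20 + 3) ra Fa ta (fun r F t =>
    [/\ frame [:: 9; 12; 13; 15] r ra, aframe [:: 9; 10] F Fa, t = ta,
       forall k, F 9 k = if (k %/ N == b) && (k %% N < n) then code_form C b (k %% N) else Fa 9 k &
       forall k, k < b * N * N -> F 10 k = Fa 10 k]).
Proof.
move=> ra11 /andP[b0 bN] C Cn zero; have nB := N_le_B; have BltW := B_lt_W.
have N0 : 0 < N by exact: leq_trans nN.
pose key := code_key C b; pose P := code_live C b.
have CltN u : u < n -> C b.*2 u < N /\ C b.*2.+1 u < N.
  by move=> /Cn[_ [c1 c2]]; split; exact: leq_ltn_trans nN.
have keyB u : u < n -> b * N * N <= key u < b.+1 * N * N.
  move=> un; have [c1 c2] := CltN u un; rewrite /key /code_key.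
  rewrite mul_idx ?mul_idx // andbT mulnDl -addnA leq_addr //.
have NNN : b.+1 * N * N <= N * N * N by rewrite !leq_mul2r bN !orbT.
have b2 : b.*2.+2 * N <= 2 * N * N by rewrite leq_mul2r; apply/orP; right; lia.
have N2B : 2 * N * N <= B.
  apply: leq_trans NB; rewrite mulnAC -mulnA mulnC.
  by rewrite -!mulnA leq_mul2l leq_mul2l; apply/orP; right; apply/orP; right; lia.
pose I x r F t := [/\ frame [:: 9; 12; 13; 15] r ra, aframe [:: 9; 10] F Fa, t = ta,
   forall k, F 9 k = if (k %/ N == b) && (k %% N < x) then code_form C b (k %% N) else Fa 9 k &
   forall k, F 10 k = if b * N * N <= k < b.+1 * N * N then first_table n P key x k else Fa 10 k].
apply: (wp_weaken (Q := I n)); last 2 first.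
- exact: leqnn.
- move=> r F t g [f1 f2 -> F9 F10]; split=> // k kb.
  by rewrite F10 leqNgt kb.
rewrite (_ : n * 20 = n * (17 + 3)) //; apply: forP => //; first by lia.
- by move=> x r F t /globalsP[].
- move=> g; split=> //.
  + by apply: frame_update.
  + by move=> k; rewrite andbF.
  + move=> k; case: ifP => // kb; by rewrite zero // first_table0.
- move=> x r F t g xn r9 [f1 f2 -> F9 F10]; have [r0 r1 rN _ _] := globalsP g.
  have r11 : r 11 = b by rewrite f1.
  have [c1 c2] := CltN x xn; have [Cb0 _] := Cn x xn.
  have xN : x < N := ltn_trans xn nN.
  have F9c c : b < c -> F 9 (c * N + x) = C c x.
    move=> bc; rewrite F9 divnMDl // divn_small // addn0.
    by rewrite (gtn_eqF bc).
  have F92 : F 9 ((r 11 + r 11) * r 2 + r 9) = C b.*2 x.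
    by rewrite r11 addnn rN r9 F9c //; lia.
  have F93 : F 9 ((r 11 + r 11 + 1) * r 2 + r 9) = C b.*2.+1 x.
    by rewrite r11 addnn addn1 rN r9 F9c //; lia.
  have kx := keyB x xn; have kxE : key x = (b * N + C b.*2 x) * N + C b.*2.+1 x by [].
  have i1 : b.*2 * N + x < 2 * N * N by apply: leq_trans b2; rewrite mulSn mulSn; lia.
  have i2 : b.*2.+1 * N + x < 2 * N * N by apply: leq_trans b2; rewrite mulSn [leqRHS]mulSn mulSn; lia.
  have i0 : b * N + x < 2 * N * N by apply: leq_ltn_trans i1; rewrite leq_add2r leq_mul2r; lia.
  have F10x : F 10 (key x) = first_table n P key x (key x) by rewrite F10 kx.
  have NNNB : N * N * N <= B by move: NB; lia.
  apply: wp_le.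
    apply: wp_seq; apply: assignP => //=.
      by rewrite r1 r11 rN r9 addnn; do ![split=> //]; lia.
    rewrite F92; set rA := update r 12 _.
    apply: wp_seq; apply: assignP => //=.
      rewrite -[rA 1]/(r 1) -[rA 11]/(r 11) -[rA 2]/(r 2) -[rA 9]/(r 9) r1 r11 rN r9 addnn addn1.
      by do ![split=> //]; lia.
    rewrite -[rA 11]/(r 11) -[rA 2]/(r 2) -[rA 9]/(r 9) F93; set rB := update rA 13 _.
    have rB2 : rB 2 = N by rewrite -[LHS]/(r 2).
    have rB11 : rB 11 = b by rewrite -[LHS]/(r 11).
    have rB12 : rB 12 = C b.*2 x by [].
    have rB13 : rB 13 = C b.*2.+1 x by [].
    have fB : frame [:: 9; 12; 13; 15] rB ra by do 2![apply: frame_update => //].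
    have liveE : (C b.*2 x + C b.*2.+1 x == 0) = ~~ P x by rewrite addn_eq0 /P /code_live negbK.
    apply: (@condP _ _ _ 8).
    + by rewrite /= rB12 rB13; do ![split=> //]; lia.
    + rewrite /= rB12 rB13 bool_neq0 liveE => Px; apply: wp_le; first apply: wp_skip; last by [].
      split=> //; split=> //; first by apply: frame_update.
        move=> k; rewrite F9; case: eqP => //= kb; rewrite [k %% N < x.+1]ltnS [k %% N <= x]leq_eqVlt.
        case: (k %% N =P x) => //= kx'; rewrite kx' ltnn /code_form -/(P x) (negbTE Px).
        by rewrite (divn_eq k N) kb kx'.
      by move=> k; rewrite F10 first_table_skip.
    + rewrite /= rB12 rB13 liveE => /eqP; rewrite eqb0 negbK => Px.
      have F10x0 := first_table_get key xn Px; rewrite -F10x in F10x0.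
      have fx := first_index_le key xn Px.
      apply: wp_le.
        apply: wp_seq; apply: assignP => //=.
          by rewrite rB2 rB11 rB12 rB13; do ![split=> //]; lia.
        rewrite rB2 rB11 rB12 rB13 -kxE; set rC := update rB 15 _.
        have rC1 : rC 1 = B by rewrite -[LHS]/(rB 1).
        have rC2 : rC 2 = N by rewrite -[LHS]/(rB 2).
        have rC9 : rC 9 = x by rewrite -[LHS]/(rB 9).
        have rC11 : rC 11 = b by rewrite -[LHS]/(rB 11).
        have rC15 : rC 15 = key x by [].
        have tail : forall F', F' 10 (key x) = (first_index n P key (key x)).+1 -> aframe [:: 10] F' F ->
          (forall k, k != key x -> F' 10 k = F 10 k) ->
          wp (put 9[%11 * %2 + %9] <~ 10$[%15])%C 1 rC F' ta
            (fun r' F' t' => r' 9 = x /\ I x.+1 (update r' 9 x.+1) F' t').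
          move=> F' F'k aF' oF'; apply: storeP => /=.
            by rewrite rC1 rC2 rC9 rC11; do ![split=> //]; lia.
            by rewrite rC1 rC15; do ![split=> //]; lia.
          rewrite rC2 rC9 rC11 rC15 F'k; split=> //; split=> //.
          - by do 2![apply: frame_update => //].
          - by apply: aframe_set => //; exact: (aframe_trans _ _ aF' f2).
          - move=> k; rewrite /set_array /= idx_eq // aF' // F9 [k %% N < x.+1]ltnS [k %% N <= x]leq_eqVlt.
            case: (k %/ N =P b) => //= kb; case: (k %% N =P x) => //= ->.
            by rewrite /code_form -/(P x) Px.
          - move=> k; rewrite /set_array /=; have [->|kk] := eqVneq k (key x).
              by rewrite F'k kx first_tableS // eqxx.
            by rewrite oF' // F10 first_tableS // (negbTE kk).
        apply: wp_seq; apply: condP.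
        * by rewrite /= rC1 rC15; do ![split=> //]; lia.
        * rewrite /= rC15 F10x0 bool_neq0 => /eqP fxx; apply: storeP => /=.
            by rewrite rC1 rC15; do ![split=> //]; lia.
            by rewrite rC9; do ![split=> //]; lia.
          rewrite rC15 rC9; apply: tail.
          - by rewrite /set_array !eqxx addn1 fxx.
          - by apply: aframe_set.
          - by move=> k kk; rewrite /set_array (negbTE kk).
        * rewrite /= rC15 => /eqP; rewrite eqb0 => nz; apply: wp_skip.
          apply: tail => //; move: nz; rewrite F10x /first_table; by case: ltnP.
      by [].
  by [].
Qed.

Lemma leavesP (pos : 'I_n -> nat) ra (Fa : nat -> nat -> nat) ta :
  holds_input Fa -> (forall u : 'I_n, Fa 2 u = pos u) -> (forall u, pos u < n) -> injective pos ->
  (forall k, k < B -> Fa 9 k = 0) ->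
  wp leaves_code (n * (n * 4 + 20) + 3) ra Fa ta (fun r F t =>
    [/\ frame [:: 9; 10; 11; 12] r ra, aframe [:: 8; 9] F Fa, t = ta, forall y : 'I_n, F 8 (pos y) = y &
       [/\ forall u y : 'I_n, F 9 ((N + pos y) * N + u) = e u y &
         forall k, k < B -> (forall y : 'I_n, k %/ N != N + pos y) -> F 9 k = 0]]).
Proof.
move=> inp F2 posn posi zero; have nB := N_le_B; have BltW := B_lt_W.
have N0 : 0 < N by exact: leq_trans nN.
pose I x r F t := [/\ frame [:: 9; 10; 11; 12] r ra, aframe [:: 8; 9] F Fa, t = ta,
   forall y : 'I_n, y < x -> F 8 (pos y) = y &
   (forall u y : 'I_n, y < x -> F 9 ((N + pos y) * N + u) = e u y) /\
   forall k, k < B -> (forall y : 'I_n, y < x -> k %/ N != N + pos y) -> F 9 k = 0].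
apply: (wp_weaken (Q := I n)); last 2 first.
- exact: leqnn.
- move=> r F t g [f1 f2 -> F8 [F9 F9z]]; split=> // [y|]; first exact: F8.
  by split=> [u y|k kB ky]; [exact: F9|exact: F9z].
rewrite (_ : n * 4 + 20 = n * 4 + 17 + 3); last by lia.
apply: forP => //; first by lia.
- by move=> x r F t /globalsP[].
- by move=> g; split=> //; [apply: frame_update|split=> // k kB _; exact: zero].
- move=> x r F t g xn r9 [f1 f2 -> F8 [F9 F9z]]; have [r0 r1 rN _ _] := globalsP g.
  pose xo := Ordinal xn.
  have F2x : F 2 x = pos xo by rewrite f2 // -F2.
  have px := posn xo; have pN : pos xo < N := ltn_trans px nN.
  have N2B : 2 * N * N <= B.
    apply: leq_trans NB; rewrite mulnAC -mulnA mulnC.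
    by rewrite -!mulnA leq_mul2l leq_mul2l; apply/orP; right; apply/orP; right; lia.
  have rowB u : u < N -> (N + pos xo) * N + u < 2 * N * N.
    move=> uN; have : (N + pos xo).+1 * N <= 2 * N * N by rewrite leq_mul2r; apply/orP; right; lia.
    by rewrite mulSn; lia.
  have row0 := rowB 0 N0; rewrite addn0 in row0.
  apply: wp_le.
    apply: wp_seq; apply: assignP => //=; first by rewrite r9 r1; do ![split=> //]; lia.
    rewrite r9 F2x; set rA := update r 11 _.
    have rA9 : rA 9 = x by rewrite -[LHS]/(r 9).
    have rA1 : rA 1 = B by rewrite -[LHS]/(r 1).
    have rA2 : rA 2 = N by rewrite -[LHS]/(r 2).
    have rA11 : rA 11 = pos xo by [].
    apply: wp_seq; apply: storeP => //=; first by rewrite rA1 rA11; do ![split=> //]; lia.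
    rewrite rA11 rA9; set FA := set_array F 8 _ _.
    apply: wp_seq; apply: assignP => //=; first by rewrite rA2 rA11; do ![split=> //]; lia.
    rewrite rA2 rA11; set rB := update rA 12 _.
    pose J j r2 F' (t : seq nat) := [/\ frame [:: 10] r2 rB, aframe [:: 9] F' FA, t = ta &
      forall k, F' 9 k = if (k %/ N == N + pos xo) && (k %% N < j) then nat_of_bool (adj (k %% N) x) else F 9 k].
    apply: (wp_weaken (Q := J n)).
    - apply: (@forP 10 0 _ 1 n J) => //; first by lia.
      + by move=> j r2 F' t' /globalsP[].
      + move=> _; split=> //; first by apply: frame_update.
        by move=> k; rewrite andbF.
      + move=> j r2 F' t' g2 jn r10 [h1 h2 -> H9]; have [q0 q1 qN _ _] := globalsP g2.
        have r29 : r2 9 = x by rewrite h1.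
        have r212 : r2 12 = (N + pos xo) * N by rewrite h1.
        have row := rowB j (ltn_trans jn nN).
        have := idx_lt jn xn => idx; have nnB := nn_lt_B.
        apply: storeP => /=; rewrite ?r212 ?r10 ?q1 ?q0 ?r29.
        * by do ![split=> //]; lia.
        * by do ![split=> //]; lia.
        rewrite h2 // /FA set_array_neq // f2 // inp //; split=> //; split=> //.
        * by apply: frame_update.
        * by apply: aframe_set.
        * move=> k; rewrite /set_array /= idx_eq ?(ltn_trans jn) // H9.
          case: (k %/ N =P _) => //= _; rewrite [k %% N < j.+1]ltnS [k %% N <= j]leq_eqVlt.
          by case: (k %% N =P j) => //= ->.
    - exact: leqnn.
    - move=> r2 F' t' g2 [h1 h2 -> H9].
      have F'8 : F' 8 = FA 8 by rewrite h2.
      have f1' : frame [:: 9; 10; 11; 12] r2 ra.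
        have q : frame [:: 9; 10; 11; 12] rB ra by do 2![apply: frame_update => //].
        exact: (frame_trans _ _ h1 q).
      split; first by rewrite h1.
      split=> //.
      + by apply: frame_update.
      + have q : aframe [:: 8; 9] FA Fa by apply: aframe_set.
        exact: (aframe_trans _ _ h2 q).
      + move=> y; rewrite ltnS leq_eqVlt F'8 /FA /set_array /= => /orP[/eqP yx|yx].
          have -> : y = xo by apply: val_inj.
          by rewrite eqxx.
        case: eqP => [/posi yE|_]; last exact: F8.
        by rewrite -[x]/(nat_of_ord xo) -yE.
      + have divE (y u : 'I_n) : ((N + pos y) * N + u) %/ N = N + pos y.
          by rewrite divnMDl // divn_small ?addn0 // (ltn_trans (ltn_ord u)).
        have modE (y u : 'I_n) : ((N + pos y) * N + u) %% N = u.
          by rewrite modnMDl modn_small // (ltn_trans (ltn_ord u)).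
        split.
          move=> u y; rewrite ltnS leq_eqVlt H9 divE modE ltn_ord andbT eqn_add2l => /orP[/eqP yx|yx].
            have -> : y = xo by apply: val_inj.
            by rewrite eqxx -[x]/(nat_of_ord xo) adjE.
          case: eqP => [/posi yE|_]; last exact: F9.
          by move: yx; rewrite yE ltnn.
        move=> k kB ky; rewrite H9 (negbTE (ky xo _)) //=.
        by apply: F9z => // y yx; apply: ky; rewrite ltnS ltnW.
  by lia.
Qed.

Hypothesis NE : N = 2 ^ L.

(** Blocks are treated in decreasing order, so that both children are final when a block is
    reached. *)
Lemma treeP (pos : 'I_n -> nat) ra (Fa : nat -> nat -> nat) ta :
  holds_input Fa -> (forall u : 'I_n, Fa 2 u = pos u) -> (forall u, pos u < n) -> injective pos ->
  (forall k, k < B -> Fa 9 k = 0) -> (forall k, k < B -> Fa 10 k = 0) ->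
  wp tree_code (n * (n * 4 + 20) + N * (n * 20 + 10) + 10) ra Fa ta (fun r F t =>
    [/\ aframe [:: 8; 9; 10] F Fa, forall y : 'I_n, F 8 (pos y) = y &
       codes e L pos (fun b u => F 9 (b * N + u))]).
Proof.
move=> inp F2 posn posi z9 z10; have nB := N_le_B; have BltW := B_lt_W.
have N0 : 0 < N by exact: leq_trans nN.
have N2B : 2 * N * N <= B.
  apply: leq_trans NB; rewrite mulnAC -mulnA mulnC.
  by rewrite -!mulnA leq_mul2l leq_mul2l; apply/orP; right; apply/orP; right; lia.
apply: wp_le.
  apply: wp_seq; apply: wp_weaken; [exact: leavesP inp F2 posn posi z9|exact: leqnn|].
  move=> r F t g [f1 f2 -> F8 [F9 F9z]]; have [r0 r1 rN _ _] := globalsP g.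
  apply: wp_seq; apply: assignP => //.
    by rewrite /= rN; do ![split=> //]; lia.
  rewrite /= rN; set rA := update r 14 _.
  have F10z k : k < B -> F 10 k = 0 by move=> kB; rewrite f2 // z10.
  have leafN (y : 'I_n) : N <= N + pos y by exact: leq_addr.
  pose C (F' : nat -> nat -> nat) b u := F' 9 (b * N + u).
  (* After [x] iterations the blocks from [N - x] to [N - 1] are coded; the smaller ones, and their
     stretches of the table, are still zero. *)
  pose I x r2 F' (t : seq nat) := [/\ frame [:: 9; 10; 11; 12; 13; 15] r2 rA, aframe [:: 8; 9; 10] F' Fa, F' 8 = F 8,
    (forall k, k < (N - x) * N * N -> F' 10 k = 0) &
    [/\ forall b u, N <= b -> u < N -> C F' b u = C F b u,
      forall b u, b < N - x -> u < N -> C F' b u = 0 &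
      forall b u, N - x <= b < N -> u < n -> C F' b u = code_form (C F') b u]].
  have C_le x r2 F' t' b u : x < N -> I x r2 F' t' -> b < 2 * N -> u < n -> C F' b u <= n.
    move=> xN [_ _ _ _ [leafs zs forms]] b2 un; have uN := ltn_trans un nN.
    have [bx|xb] := ltnP b (N - x); first by rewrite zs.
    have [bN|Nb] := ltnP b N; first by rewrite forms ?code_form_le //; lia.
    rewrite leafs // /C; have kB : b * N + u < B by apply: leq_trans N2B; exact: mul_idx.
    have [/existsP[y /eqP by_]|none] := boolP [exists y : 'I_n, N + pos y == b].
      by rewrite -by_ (F9 (Ordinal un)); case: (e _ _).
    rewrite F9z // => y; rewrite divnMDl // divn_small // addn0; apply: contraNneq none => ->.
    by apply/existsP; exists y.
  apply: (wp_weaken (Q := I N.-1)).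
  - apply: (@forP 10 14 _ (n * 20 + 3 + 2) N.-1 I) => //; first by lia.
    + by move=> x r2 F' t' g2 [f3 _ _ _ _]; rewrite f3 //= /rA /update /= subn1.
    + move=> _; split=> //.
      * by apply: frame_update.
      * exact: (aframe_trans (xs := [:: 8; 9]) (zs := [::]) _ _ f2).
      * by move=> k; rewrite subn0 => kN; apply: F10z; apply: leq_trans NB; move: kN; lia.
      * split=> //; rewrite subn0 => b u bN; last by lia.
        move=> uN; rewrite /C F9z //; first by apply: leq_trans N2B; apply: mul_idx => //; lia.
        by move=> y; rewrite divnMDl // divn_small // addn0 neq_ltn; apply/orP; left; lia.
    + move=> x r2 F' t' g2 xN r10 HI; have [f3 f4 F'8 F'10 [leafs zs forms]] := HI.
      have [q0 q1 qN _ _] := globalsP g2.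
      pose b := N - x - 1; have b0N : 0 < b < N by rewrite /b; lia.
      have bx : b.+1 = N - x by rewrite /b; lia.
      apply: wp_le.
        apply: wp_seq; apply: assignP => //.
          by rewrite /= qN r10; do ![split=> //]; lia.
        rewrite /= qN r10 -/b; set r3 := update r2 11 b.
        apply: wp_weaken.
          apply: (@levelP b) => //.
          * move=> u un; split; first by apply: zs; [lia|exact: ltn_trans nN].
            by split; apply: (C_le x r2 F' t') => //; lia.
          * by move=> k; rewrite bx => /andP[_ kb]; exact: F'10.
        exact: leqnn.
        move=> r4 F4 t4 g4 [h1 h2 _ H9 H10]; split; first by rewrite h1.
        have Cnew c u : u < N -> C F4 c u = if (c == b) && (u < n) then code_form (C F') b u else C F' c u.
          by move=> uN; rewrite /C H9 divnMDl // divn_small // addn0 modnMDl modn_small.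
        split.
        * apply: frame_update => //.
          have q : frame [:: 9; 10; 11; 12; 13; 15] r3 rA by apply: frame_update.
          exact: (frame_trans _ _ h1 q).
        * exact: (aframe_trans _ _ h2 f4).
        * by rewrite h2.
        * move=> k kb; have kb' : k < b * N * N by move: kb; rewrite (_ : N - x.+1 = b) //; rewrite /b; lia.
          by rewrite H10 // F'10 //; apply: leq_trans kb' _; rewrite !leq_mul2r; lia.
        * split.
          - by move=> c u Nc uN; rewrite Cnew // gtn_eqF ?leafs //; lia.
          - by move=> c u cb uN; rewrite Cnew // ltn_eqF ?zs //; lia.
          - move=> c u cb un; have uN := ltn_trans un nN.
            have ext : code_form (C F4) c u = code_form (C F') c u.
              by apply: code_form_ext => // v vn; rewrite Cnew ?(gtn_eqF (_ : b < _)) // ?(ltn_trans vn) //; lia.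
            rewrite ext Cnew // un andbT; case: eqP => [-> //|cb'].
            by apply: forms => //; lia.
      by lia.
  - exact: leqnn.
  - move=> r2 F' t' g2 HI; have [f3 f4 F'8 F'10 [leafs zs forms]] := HI.
    have nx : N - N.-1 = 1 by lia.
    have form b (u : 'I_n) : 0 < b < N -> C F' b u = code_form (C F') b u by move=> bN; apply: forms; rewrite ?nx.
    have lt b (u : 'I_n) : b < 2 * N -> C F' b u < N.
      by move=> b2; apply: leq_ltn_trans nN; apply: (C_le N.-1 r2 F' t') => //; lia.
    split=> //; first by move=> y; rewrite F'8.
    split; rewrite -?NE.
    + by move=> u y; rewrite -[LHS]/(C F' (N + pos y) u) leafs ?(ltn_trans (ltn_ord u)) // /C F9.
    + move=> p u pN pp; rewrite -[LHS]/(C F' (N + p) u) leafs ?leq_addr ?(ltn_trans (ltn_ord u)) // /C F9z //.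
        apply: leq_trans N2B; apply: mul_idx; [lia|exact: ltn_trans nN].
      by move=> y; rewrite divnMDl // divn_small ?(ltn_trans (ltn_ord u)) // addn0 eqn_add2l eq_sym.
    + move=> b u bN; rewrite -[X in X == 0]/(C F' b u) form // /code_form /code_live.
      by case: (C F' b.*2 u == 0); case: (C F' b.*2.+1 u == 0).
    + move=> b u bN; rewrite -[X in X != 0]/(C F' b u) form // /code_form; case: ifP => // lv _.
      have fn := leq_ltn_trans (first_index_le (code_key (C F') b) (ltn_ord u) lv) (ltn_ord u).
      have [_ kE] := first_indexP fn; exists (Ordinal fn).
      have h1 : b.*2 < 2 * N by lia.
      have h2 : b.*2.+1 < 2 * N by lia.
      have [E1 E2] := code_key_inj (lt _ (Ordinal fn) h1) (lt _ u h1) (lt _ (Ordinal fn) h2) (lt _ u h2) kE.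
      by split=> //; rewrite -[LHS]/(C F' b u) form // /code_form lv.
    + move=> b u u' bN E1 E2; rewrite -[LHS]/(C F' b u) -[RHS]/(C F' b u') !form // /code_form.
      by rewrite /code_live /code_key /C E1 E2.
by lia.
Qed.

(** * Searches from all vertices and the distance matrix *)

Section Search.
Variables (pos : 'I_n -> nat) (Fa : nat -> nat -> nat).
Hypotheses (pos_lt : forall u, pos u < n) (pos_inj : injective pos).
Hypotheses (Fa2 : forall u : 'I_n, Fa 2 u = pos u) (Fa8 : forall y : 'I_n, Fa 8 (pos y) = y).
Let C b u := Fa 9 (b * N + u).
Hypotheses (L_gt0 : 0 < L) (HC : codes e L pos C).
Local Notation succ := (node_succ L C (Fa 8)).
Local Notation row_leaf := (leaf L pos).

Definition visits : nat := (\sum_(b < 2 * 2 ^ L) size (nodes n L C b)).+1.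

Lemma pos_ltN u : pos u < 2 ^ L.
Proof. by rewrite -NE; exact: ltn_trans nN. Qed.

Lemma nN' : n < 2 ^ L. Proof. by rewrite -NE. Qed.

Lemma visits_le : visits <= 2 * N * N.
Proof.
have : \sum_(b < 2 * 2 ^ L) size (nodes n L C b) <= 2 * 2 ^ L * n.
  rewrite -[X in _ <= X * n]card_ord -sum_nat_const; apply: leq_sum => b _.
  apply: leq_trans (size_undup _) _; rewrite size_map size_filter.
  by apply: leq_trans (count_size _ _) _; rewrite -cardE card_ord.
rewrite /visits -NE => h; apply: leq_ltn_trans h _.
by rewrite ltn_pmul2l //; lia.
Qed.

Lemma NN_B : 2 * N * N * N <= B.
Proof. by move: NB; lia. Qed.

(** Decodes a visited node, so that the branch taken by the program matches [node_succ] and its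
    addresses are in range. *)
Lemma visited_cases x k v : walk_to succ (row_leaf x) k v ->
  (exists z : 'I_n, v = (N + pos z) * N + 1) \/
  exists b, exists u : 'I_n, 0 < b < N /\ v = b * N + u.+1.
Proof.
move=> /(walk_at L_gt0 nN' HC Fa8)[j [z [_ [[_ ->]|[b [bN _ cz ->]]]]]].
  by left; exists z; rewrite NE.
right; have [u [-> _ _]] := code_rep HC bN cz.
by exists b, u; rewrite NE.
Qed.

Lemma visited_lt x k v : walk_to succ (row_leaf x) k v -> v < 2 * N * N.
Proof.
move=> /visited_cases[[z ->]|[b [u [bN ->]]]]; apply: mul_idx.
- by have := pos_lt z; lia.
- by lia.
- by lia.
- by have := ltn_ord u; lia.
Qed.

(** Array 11 holds the distances from address [base] on. The bound [D v <= t'] keeps the stored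
    values within a word. *)
Definition search_state base (r : nat -> nat) (F : nat -> nat -> nat) t' Q D : Prop :=
  [/\ r 7 = base, r 9 = t', forall v, v < 2 * N * N -> F 11 (base + v) = D v,
     forall i, i < t' -> F 12 i = Q i & forall v, D v <= t'].

(** Each source has its own stretch of array 11; leaving the others alone keeps the later ones zero
    without any clearing. *)
Definition same_outside base (F F0 : nat -> nat -> nat) : Prop :=
  aframe [:: 11; 12] F F0 /\
  forall k, (k < base) || (base + 2 * N * N <= k) -> F 11 k = F0 11 k.

Lemma same_outside_trans base F1 F2 F3 :
  same_outside base F1 F2 -> same_outside base F2 F3 -> same_outside base F1 F3.
Proof.
by move=> [a1 o1] [a2 o2]; split=> [|k kb]; [exact: (aframe_trans _ _ a1 a2)|rewrite o1 // o2].
Qed.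

(** Visited nodes stay visited, and the node being treated keeps its place and its distance, so the
    pushes for the two halves can be chained. *)
Lemma pushP x base h t' Q D ra Fb tp b c :
  base + 2 * N * N <= B -> search_state base ra Fb t' Q D ->
  bfs_inv succ (row_leaf x) h t' Q D -> h < t' ->
  ra 15 = b -> ra 16 = c -> ra 12 = D (Q h) -> b < 2 * N -> c < N ->
  (c <> 0 -> b * N + c \in succ (Q h)) ->
  wp push_code 9 ra Fb tp (fun r F t =>
    [/\ frame [:: 9; 17] r ra, same_outside base F Fb &
      exists t2 Q2 D2, [/\ search_state base r F t2 Q2 D2, bfs_inv succ (row_leaf x) h t2 Q2 D2, h < t2,
         Q2 h = Q h /\ D2 (Q h) = D (Q h) &
         (forall v, D v <> 0 -> D2 v <> 0) /\ (c <> 0 -> D2 (b * N + c) <> 0)]]).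
Proof.
move=> baseB [r7 r9 FD FQ Dt] I ht r15 r16 r12 b2 cN sc; have BltW := B_lt_W.
apply: wp_G => g; have [r0 r1 rN _ _] := globalsP g.
have nuN : b * N + c < 2 * N * N by exact: mul_idx.
have tv := bfs_size L_gt0 nN' pos_ltN HC Fa8 I; have vB := visits_le.
have N0 : 0 < N by exact: leq_trans nN.
have tB : t' < B.
  apply: leq_ltn_trans tv _; apply: leq_ltn_trans vB _; apply: leq_trans NN_B.
  by rewrite ltn_Pmulr ?muln_gt0 ?N0 //; lia.
apply: (@condP _ _ _ 8).
- by rewrite /=; split=> //; lia.
- rewrite /= r16 bool_neq0 => /eqP c0; apply: wp_le; first apply: wp_skip; last by [].
  split=> //.
  exists t', Q, D; split=> //; split=> // v0; by rewrite c0.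
- rewrite /= r16 => /eqP; rewrite eqb0 => /eqP c0.
  apply: (wp_le (k := (1 + 6).+1)) => //; apply: wp_seq; apply: assignP => //.
    by rewrite /= r15 r16 rN; do ![split=> //]; lia.
  rewrite /= r15 r16 rN; set rA := update ra 17 _.
  have A1 : rA 1 = B by rewrite -[LHS]/(ra 1).
  have A7 : rA 7 = base by rewrite -[LHS]/(ra 7).
  have A9 : rA 9 = t' by rewrite -[LHS]/(ra 9).
  have A12 : rA 12 = D (Q h) by rewrite -[LHS]/(ra 12).
  have A17 : rA 17 = b * N + c by [].
  have fA : frame [:: 9; 17] rA ra by apply: frame_update.
  apply: (@condP _ _ _ 5).
  + by rewrite /= A1 A7 A17; do ![split=> //]; lia.
  + rewrite /= A7 A17 FD // bool_neq0 => /eqP D0.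
    apply: (wp_le (k := (1 + (1 + 1).+1).+1)) => //; apply: wp_seq; apply: storeP.
      by rewrite /= A1 A7 A17; do ![split=> //]; lia.
      by rewrite /= A12; have := Dt (Q h); split=> //; lia.
    rewrite /= A7 A17 A12 [D (Q h) + 1]addn1.
    apply: (wp_le (k := (1 + 1).+1)) => //; apply: wp_seq; apply: storeP.
      by rewrite /= A1 A9; do ![split=> //].
      by [].
    rewrite /= A9 A17; apply: assignP => //; first by rewrite /= A9; do ![split=> //]; lia.
    rewrite /= A9 addn1; split.
    * by apply: frame_update.
    * split; first by do 2![apply: aframe_set => //].
      move=> k kb; rewrite /set_array /=; case: eqP => // kE.
      by move: kb; rewrite kE; lia.
    have Dh : D (Q h) <> 0 by apply/(bfs_visited I); exists h.
    have vs := sc c0.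
    exists t'.+1, (update Q t' (b * N + c)), (update D (b * N + c) (D (Q h)).+1); split.
    * split=> //.
      - by move=> v vN; rewrite /set_array /= eqn_add2l /update; case: eqP => // _; rewrite FD.
      - move=> i; rewrite ltnS leq_eqVlt /set_array /update /=; case: eqP => //= _ it.
        exact: FQ.
      - move=> v; rewrite /update; case: eqP => _; first by rewrite ltnS.
        exact: leqW.
    * exact: bfs_push.
    * exact: leqW.
    * rewrite /update; case: eqP => [E|_]; first by rewrite -E ltnn in ht.
      by split=> //; case: eqP => // E; rewrite E D0 in Dh.
    * split=> [v Dv|_]; rewrite /update ?eqxx //; by case: eqP.
  + rewrite /= A7 A17 FD // => /eqP; rewrite eqb0 => /eqP D0.
    apply: wp_le; first apply: wp_skip; last by [].
    split=> //.
    by exists t', Q, D; split=> //; split=> //.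
Qed.

Lemma visitP x base h t' Q D ra Fb tp :
  base + 2 * N * N <= B -> aframe [:: 0; 11; 12] Fb Fa -> search_state base ra Fb t' Q D ->
  bfs_inv succ (row_leaf x) h t' Q D -> h < t' -> ra 8 = h ->
  wp visit_code 40 ra Fb tp (fun r F t =>
    [/\ frame [:: 8; 9; 11; 12; 13; 14; 15; 16; 17] r ra, same_outside base F Fb, r 8 = h.+1 &
      exists t2 Q2 D2, search_state base r F t2 Q2 D2 /\ bfs_inv succ (row_leaf x) h.+1 t2 Q2 D2]).
Proof.
move=> baseB fb St I ht r8; have [r7 r9 FD FQ Dt] := St; have BltW := B_lt_W.
apply: wp_G => g; have [r0 r1 rN _ _] := globalsP g.
have N0 : 0 < N by exact: leq_trans nN.
have N2B : 2 * N * N <= B by apply: leq_trans NN_B; rewrite leq_pmulr.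
have tv := bfs_size L_gt0 nN' pos_ltN HC Fa8 I; have vB := visits_le.
have hB : h < B.
  apply: leq_trans ht _; apply: leq_trans tv _; exact: leq_trans vB N2B.
pose v := Q h.
have Dv : D v <> 0 by apply/(bfs_visited I); exists h.
have wv := bfs_walk I Dv; have vN := visited_lt wv; have vcase := visited_cases wv.
have F9 : Fb 9 = Fa 9 by rewrite fb.
have F8 : Fb 8 = Fa 8 by rewrite fb.
pose P r F (t : seq nat) := [/\ frame [:: 9; 11; 12; 13; 14; 15; 16; 17] r ra, same_outside base F Fb &
      exists t2 Q2 D2, [/\ search_state base r F t2 Q2 D2, bfs_inv succ (row_leaf x) h t2 Q2 D2, h < t2 &
        Q2 h = v /\ (forall u, u \in succ v -> D2 u <> 0)]].
have fin r F t : P r F t -> globals r ->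
    wp (8 ::= %8 + #1)%C 1 r F t (fun r F t =>
    [/\ frame [:: 8; 9; 11; 12; 13; 14; 15; 16; 17] r ra, same_outside base F Fb, r 8 = h.+1 &
      exists t2 Q2 D2, search_state base r F t2 Q2 D2 /\ bfs_inv succ (row_leaf x) h.+1 t2 Q2 D2]).
  move=> [f1 f2 [t2 [Q2 [D2 [st i2 ht2 [Qh sc]]]]]] g2.
  have e8 : r 8 = h by rewrite f1.
  apply: assignP => //; first by rewrite /= e8; do ![split=> //]; lia.
  rewrite /= e8 addn1; split=> //.
  - apply: frame_update => //; exact: (frame_trans (zs := [::]) _ _ f1).
  - exists t2, Q2, D2; split; last by apply: bfs_next => //; rewrite Qh.
    by case: st.
apply: wp_le.
  apply: wp_seq; apply: assignP => //; first by rewrite /= r1 r8; do ![split=> //].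
  rewrite /= r8 FQ // -/v; set rA := update ra 11 v.
  have A7 : rA 7 = base by rewrite -[LHS]/(ra 7).
  have A1 : rA 1 = B by rewrite -[LHS]/(ra 1).
  apply: wp_seq; apply: assignP => //; first by rewrite /= A7 A1 -[rA 11]/v; do ![split=> //]; lia.
  rewrite /= A7 -[rA 11]/v FD //; set rB := update rA 12 _.
  apply: wp_seq; apply: assignP => //.
  rewrite /= -[rB 11]/v -[rB 2]/(ra 2) rN; set rC := update rB 13 _.
  have C1 : rC 1 = B by rewrite -[LHS]/(ra 1).
  have C2 : rC 2 = N by rewrite -[LHS]/(ra 2).
  have C11 : rC 11 = v by [].
  have C13 : rC 13 = v %/ N by [].
  have fC : frame [:: 9; 11; 12; 13; 14; 15; 16; 17] rC ra by do 3![apply: frame_update => //].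
  apply: (wp_le (k := (31 + 1).+1)) => //.
  apply: wp_seq; apply: (wp_weaken (Q := P)); [|exact: leqnn|by move=> r F t g2 p; exact: fin].
  apply: (@condP _ _ _ 30).
  - by [].
  - rewrite /= C13 C2 bool_neq0 => vin.
    case: vcase => [[z vE]|[b [u [bN vE]]]].
      have : v %/ N = N + pos z by rewrite vE divnMDl // divn_small ?addn0 //; lia.
      by move: vin => /[swap] ->; rewrite ltnNge leq_addr.
    have un := ltn_ord u; have uN : u.+1 < N by lia.
    have vdiv : v %/ N = b by rewrite vE divnMDl // divn_small ?addn0.
    have vmod : v %% N = u.+1 by rewrite vE modnMDl modn_small.
    have idx c : c < 2 * N -> c * N + u < 2 * N * N by move=> cN; apply: mul_idx => //; lia.
    have succE : succ v = node L b.*2 (C b.*2 u) ++ node L b.*2.+1 (C b.*2.+1 u).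
      by rewrite /node_succ -NE vdiv vmod; have /andP[_ ->] := bN.
    have Clt c : 0 < c < 2 * N -> C c u < N by rewrite NE; exact: (code_lt L_gt0 nN' HC).
    have i1 := idx b.*2 ltac:(lia); have i2 := idx b.*2.+1 ltac:(lia).
    apply: (wp_le (k := (1 + (1 + (1 + (9 + (1 + (1 + 9).+1).+1).+1).+1).+1).+1)) => //.
    apply: wp_seq; apply: assignP => //.
      by rewrite /= C11 C2 vmod; do ![split=> //]; lia.
    rewrite /= C11 C2 vmod subn1 [u.+1.-1]/=; set rD := update rC 14 _.
    apply: (wp_le (k := (1 + (1 + (9 + (1 + (1 + 9).+1).+1).+1).+1).+1)) => //.
    apply: wp_seq; apply: assignP => //.
      by rewrite /= -[rD 13]/(rC 13) C13 vdiv; do ![split=> //]; lia.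
    rewrite /= -[rD 13]/(rC 13) C13 vdiv addnn; set rE := update rD 15 _.
    apply: (wp_le (k := (1 + (9 + (1 + (1 + 9).+1).+1).+1).+1)) => //.
    apply: wp_seq; apply: assignP => //.
      rewrite /= -[rE 1]/(rC 1) -[rE 2]/(rC 2) -[rE 14]/(nat_of_ord u) -[rE 15]/(b.*2) C1 C2.
      by do ![split=> //]; lia.
    rewrite /= -[rE 2]/(rC 2) -[rE 14]/(nat_of_ord u) -[rE 15]/(b.*2) C2 F9 -/(C b.*2 u); set rF := update rE 16 _.
    have fF : frame [:: 9; 11; 12; 13; 14; 15; 16; 17] rF ra by do 3![apply: frame_update => //].
    apply: (wp_le (k := (9 + (1 + (1 + 9).+1).+1).+1)) => //.
    apply: wp_seq; apply: wp_weaken.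
      apply: (@pushP x base h t' Q D rF Fb tp b.*2 (C b.*2 u)) => //.
      - by lia.
      - by apply: Clt; lia.
      - by move=> c0; rewrite -/v succE mem_cat NE node_mem //; apply/eqP.
    exact: leqnn.
    move=> r2 F2 t2 g2 [h1 h2 [tq [Q2 [D2 [st2 I2 ht2 [Qh Dh] [mono new]]]]]].
    have [q0 q1 qN _ _] := globalsP g2.
    have e15 : r2 15 = b.*2 by rewrite h1.
    have e14 : r2 14 = u by rewrite h1.
    have e12 : r2 12 = D v by rewrite h1.
    apply: (wp_le (k := (1 + (1 + 9).+1).+1)) => //.
    apply: wp_seq; apply: assignP => //.
      by rewrite /= e15; do ![split=> //]; lia.
    rewrite /= e15 addn1; set rG := update r2 15 _.
    apply: (wp_le (k := (1 + 9).+1)) => //.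
    apply: wp_seq; apply: assignP => //.
      rewrite /= -[rG 1]/(r2 1) -[rG 2]/(r2 2) -[rG 14]/(r2 14) -[rG 15]/(b.*2.+1) q1 qN e14.
      by do ![split=> //]; lia.
    have F29 : F2 9 = Fa 9 by have [a _] := h2; rewrite a.
    rewrite /= -[rG 2]/(r2 2) -[rG 14]/(r2 14) -[rG 15]/(b.*2.+1) qN e14 F29 -/(C b.*2.+1 u); set rH := update rG 16 _.
    apply: wp_weaken.
      apply: (@pushP x base h tq Q2 D2 rH F2 t2 b.*2.+1 (C b.*2.+1 u)) => //.
      - by rewrite -[LHS]/(r2 12) e12 Qh Dh.
      - by lia.
      - by apply: Clt; lia.
      - by move=> c0; rewrite Qh -/v succE mem_cat NE node_mem ?orbT //; apply/eqP.
    exact: leqnn.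
    move=> r3 F3 t3 g3 [k1 k2 [t3' [Q3 [D3 [st3 I3 ht3 [Qh3 Dh3] [mono3 new3]]]]]].
    split.
    + have q : frame [:: 9; 11; 12; 13; 14; 15; 16; 17] rH ra.
        do 2![apply: frame_update => //]; exact: (frame_trans _ _ h1 fF).
      exact: (frame_trans _ _ k1 q).
    + exact: same_outside_trans k2 h2.
    + exists t3', Q3, D3; split=> //; split; first by rewrite Qh3 Qh.
      move=> w' ; rewrite succE mem_cat => /orP[] /mem_node[/eqP c0 ->]; rewrite -NE.
      * by apply: mono3; exact: new.
      * exact: new3.
  - rewrite /= C13 C2 => /eqP; rewrite eqb0 -leqNgt => vout.
    case: vcase => [[z vE]|[b [u [bN vE]]]]; last first.
      have : v %/ N = b by rewrite vE divnMDl // divn_small ?addn0 //; have := ltn_ord u; lia.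
      by move: vout bN => /[swap] /andP[_ bN] /[swap] ->; rewrite leqNgt bN.
    have vdiv : v %/ N = N + pos z by rewrite vE divnMDl // divn_small ?addn0 //; lia.
    have pz := pos_lt z; have zn := ltn_ord z.
    have succE : succ v = node L 1 (C 1 z).
      by rewrite /node_succ -NE vdiv ltnNge leq_addr /= addKn Fa8.
    apply: (wp_le (k := (1 + (1 + 9).+1).+1)) => //.
    apply: wp_seq; apply: assignP => //.
    rewrite [aeval _ _ _]/=; set rD := update rC 15 _.
    have N1 : N + z < 2 * N * N by apply: (@leq_trans (2 * N)); [lia|exact: leq_pmulr].
    have ev16 : aeval rD Fb (9$[%2 + 8$[%13 - %2]])%A = C 1 z.
      rewrite /= -[rD 13]/(rC 13) -[rD 2]/(rC 2) C13 C2 vdiv addKn F8 Fa8 F9.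
      by rewrite /C mul1n.
    apply: (wp_le (k := (1 + 9).+1)) => //.
    apply: wp_seq; apply: assignP => //.
      rewrite /= -[rD 1]/(rC 1) -[rD 13]/(rC 13) -[rD 2]/(rC 2) C1 C13 C2 vdiv addKn F8 Fa8.
      by do ![split=> //]; lia.
    rewrite ev16; set rE := update rD 16 _.
    apply: wp_weaken.
      apply: (@pushP x base h t' Q D rE Fb tp 1 (C 1 z)) => //.
      - by lia.
      - by rewrite NE; apply: (code_lt L_gt0 nN' HC); rewrite -NE; lia.
      - by move=> c0; rewrite -/v succE NE node_mem //; apply/eqP.
    exact: leqnn.
    move=> r3 F3 t3 g3 [k1 k2 [t3' [Q3 [D3 [st3 I3 ht3 [Qh3 Dh3] [mono3 new3]]]]]].
    split=> //.
    + have q : frame [:: 9; 11; 12; 13; 14; 15; 16; 17] rE ra by do 2![apply: frame_update => //].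
      exact: (frame_trans _ _ k1 q).
    + exists t3', Q3, D3; split=> //; split=> // w'.
      by rewrite succE => /mem_node[/eqP c0 ->]; rewrite -NE; exact: new3.
by [].
Qed.

Lemma outputP (x : 'I_n) base t' Q D ra Fb tp :
  base + 2 * N * N <= B -> aframe [:: 0; 11; 12] Fb Fa -> search_state base ra Fb t' Q D ->
  bfs_inv succ (row_leaf x) t' t' Q D -> ra 6 = x ->
  wp output_code (n * 8 + 3) ra Fb tp (fun r F t =>
    [/\ frame [:: 10; 12] r ra, aframe [:: 0] F Fb,
      forall y : 'I_n, F 0 (n * n + (x * n + y)) = odflt n (distance e x y) &
      forall k, k < n * n + x * n -> F 0 k = Fb 0 k]).
Proof.
move=> baseB fb [r7 _ FD _ Dt] I r6; have BltW := B_lt_W; have nnB := nn_lt_B.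
have nB := N_le_B; have N0 : 0 < N by exact: leq_trans nN.
have N2B : 2 * N * N <= B by apply: leq_trans NN_B; rewrite leq_pmulr.
pose K y r F (t : seq nat) := [/\ frame [:: 10; 12] r ra, aframe [:: 0] F Fb,
   forall y' : 'I_n, y' < y -> F 0 (n * n + (x * n + y')) = odflt n (distance e x y') &
   forall k, k < n * n + x * n -> F 0 k = Fb 0 k].
apply: (wp_weaken (Q := K n)); last 2 first.
- exact: leqnn.
- by move=> r F t g [f1 f2 F0 F0k]; split=> // y; exact: F0.
rewrite (_ : n * 8 = n * (5 + 3)) //; apply: forP => //; first by lia.
- by move=> y r F t /globalsP[].
- by move=> g; split=> //; apply: frame_update.
- move=> y r F t g yn r10 [f1 f2 F0 F0k]; have [r0 r1 rN rL _] := globalsP g.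
  pose yo := Ordinal yn; have py := pos_lt yo; have xn := ltn_ord x.
  have e7 : r 7 = base by rewrite f1.
  have e6 : r 6 = x by rewrite f1.
  have F2y : F 2 y = pos yo by rewrite f2 // fb // -Fa2.
  have lN : (N + pos yo) * N + 1 < 2 * N * N by apply: mul_idx; lia.
  have rowN : (N + pos yo) * N <= 2 * N * N by lia.
  have F11 : F 11 (base + ((N + pos yo) * N + 1)) = D (row_leaf yo).
    by rewrite f2 // FD // /leaf -NE.
  have idx := idx_lt xn yn; have xnn : x * n <= n * n by rewrite leq_mul2r ltnW ?orbT.
  have res := distance_of_bfs L_gt0 nN' pos_ltN pos_inj HC Fa8 yo I.
  have LW : L.+1 < W.
    have : L < 2 ^ L by exact: ltn_expl.
    by rewrite -NE; lia.
  have fin v : v = odflt n (distance e x yo) ->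
      K y.+1 (update (update r 12 (D (row_leaf yo))) 10 y.+1) (set_array F 0 (n * n + (x * n + y)) v) t.
    move=> vE; split.
    - by do 2![apply: frame_update => //].
    - by apply: aframe_set.
    - move=> y'; rewrite ltnS leq_eqVlt /set_array /= eqn_add2l eqn_add2l.
      case: (y' =P y :> nat) => [yy _|_ /= yy]; last exact: F0.
      by rewrite vE; congr (odflt n (distance e x _)); apply: val_inj.
    - move=> k kb; rewrite /set_array /=; case: eqP => [kE|_]; last exact: F0k.
      by move: kb; rewrite kE; lia.
  apply: (wp_le (k := (1 + 2).+1)) => //.
  apply: wp_seq; apply: assignP => //.
    by rewrite /= r1 rN r10 e7 F2y; do ![split=> //]; lia.
  rewrite /= rN r10 e7 F2y F11; set rA := update r 12 _.
  have A0 : rA 0 = n by rewrite -[LHS]/(r 0).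
  have A1 : rA 1 = B by rewrite -[LHS]/(r 1).
  have A3 : rA 3 = L by rewrite -[LHS]/(r 3).
  have A6 : rA 6 = x by rewrite -[LHS]/(r 6).
  have A10 : rA 10 = y by rewrite -[LHS]/(r 10).
  have A12 : rA 12 = D (row_leaf yo) by [].
  have safe_addr : safe w B rA F (0$[%0 * %0 + (%6 * %0 + %10)])%A.
    by rewrite /= A0 A1 A6 A10; do ![split=> //]; lia.
  apply: condP.
  + by rewrite /=; split=> //; lia.
  + rewrite /= A12 bool_neq0 => D0; apply: storeP => //.
    rewrite /= A0 A6 A10; split; first by [].

    by apply: fin; rewrite -res D0.
  + rewrite /= A12 => /eqP; rewrite eqb0 => D0; apply: storeP => //.
        have tv := bfs_size L_gt0 nN' pos_ltN HC Fa8 I; rewrite -/visits in tv.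
      have vB := visits_le; have dt := Dt (row_leaf yo); rewrite -lt0n in D0.
      have DW : D (row_leaf yo) < W by lia.
      by rewrite /= A12 A3; split; split=> //; rewrite ?D0 ?addn1.
    rewrite /= A0 A6 A10 A12 A3 subn1 addn1; split; first by [].

    by apply: fin; rewrite -res (negbTE D0).
Qed.

Definition cost_search : nat := n * (visits * 41 + n * 8 + 40) + 3.

Lemma searchP ra ta : (forall k, k < B -> Fa 11 k = 0) ->
  wp search_code cost_search ra Fa ta (fun r F t =>
    forall x y : 'I_n, F 0 (n * n + (x * n + y)) = odflt n (distance e x y)).
Proof.
move=> z11; have BltW := B_lt_W; have nnB := nn_lt_B; have nB := N_le_B.
have N0 : 0 < N by exact: leq_trans nN.
have N2B : 2 * N * N <= B by apply: leq_trans NN_B; rewrite leq_pmulr.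
have N3B := NN_B.
pose I x (r : nat -> nat) F (t : seq nat) := [/\ aframe [:: 0; 11; 12] F Fa,
  forall k, x * (N * N * 2) <= k < B -> F 11 k = 0 &
  forall x' y : 'I_n, x' < x -> F 0 (n * n + (x' * n + y)) = odflt n (distance e x' y)].
apply: (wp_weaken (Q := I n) (k := n * ((visits * 41 + n * 8 + 37) + 3) + 3)); last 2 first.
- by rewrite /cost_search -addnA.
- by move=> r F t g [_ _ F0] x y; exact: F0.
apply: forP => //; first by lia.
- by move=> x r F t /globalsP[].
- move=> x r F t g xn r6 [f2 F11 F0]; have [r0 r1 rN rL _] := globalsP g.
  pose xo := Ordinal xn; have px := pos_lt xo.
  pose base := x * (N * N * 2).
  have baseB : base + 2 * N * N <= B.
    have : x.+1 * (N * N * 2) <= N * (N * N * 2) by rewrite leq_mul2r (leq_trans xn (ltnW nN)) orbT.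
    by rewrite mulSn -/base; lia.
  have F2x : F 2 x = pos xo by rewrite f2 // -Fa2.
  have lN : (N + pos xo) * N + 1 < 2 * N * N by apply: mul_idx; lia.
  have lE : row_leaf xo = (N + pos xo) * N + 1 by rewrite /leaf -NE.
  apply: wp_le.
    apply: wp_seq; apply: assignP => //.
      by rewrite /= rN r6 -/base; do ![split=> //]; lia.
    rewrite /= rN r6 -/base; set rA := update r 7 _.
    apply: wp_seq; apply: assignP => //.
      rewrite /= -[rA 1]/(r 1) -[rA 2]/(r 2) -[rA 6]/(r 6) r1 rN r6 F2x.
      by do ![split=> //]; lia.
    rewrite /= -[rA 2]/(r 2) -[rA 6]/(r 6) rN r6 F2x -lE; set rB := update rA 11 _.
    have B1 : rB 1 = B by rewrite -[LHS]/(r 1).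
    have B7 : rB 7 = base by [].
    have B11 : rB 11 = row_leaf xo by [].
    apply: wp_seq; apply: storeP => //.
      by rewrite /= B1; do ![split=> //]; lia.
    rewrite /= B11; set FA := set_array F 12 _ _.
    apply: wp_seq; apply: storeP => //.
      by rewrite /= B1 B7 B11 lE; do ![split=> //]; lia.
    rewrite /= B7 B11; set FB := set_array FA 11 _ _.
    apply: wp_seq; apply: assignP => //; first by rewrite /=; lia.
    rewrite [aeval _ _ _]/=; set rC := update rB 8 _.
    apply: wp_seq; apply: assignP => //.
    rewrite [aeval _ _ _]/=; set rD := update rC 9 _.
    have fFB : aframe [:: 11; 12] FB F by do 2![apply: aframe_set => //].
    pose D0 v := nat_of_bool (v == row_leaf xo).
    have st0 : search_state base rD FB 1 (fun=> row_leaf xo) D0.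
      split=> //.
      - move=> v vN; rewrite /FB /set_array /= eqn_add2l /D0; case: eqP => // _.
        by apply: F11; rewrite -/base; lia.
      - by move=> [|].
      - by move=> v; rewrite /D0; case: eqP.
    have I0 : bfs_inv succ (row_leaf xo) 0 1 (fun=> row_leaf xo) D0 by apply: bfs_init.
    (* The countdown is the number of nodes that may still be dequeued, as the queue never holds
       more than [visits] nodes. *)
    pose J j r' F' (t' : seq nat) := exists h t1 Q D, [/\ j = visits - h /\ r' 8 = h,
      frame [:: 8; 9; 11; 12; 13; 14; 15; 16; 17] r' rD, same_outside base F' FB,
      search_state base r' F' t1 Q D & bfs_inv succ (row_leaf xo) h t1 Q D].
    apply: wp_seq; apply: wp_weaken.
      apply: (@whileP _ _ 40 J visits) => //.
      + move=> j r' F' t' g' [h [t1 [Q [D [[-> r8] f1 so st inv_]]]]]; have [_ r9 _ _ _] := st.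
        split=> //=; rewrite r8 r9 bool_neq0 => ht; exists (visits - h.+1).
          have := bfs_size L_gt0 nN' pos_ltN HC Fa8 inv_; rewrite -/visits; lia.
        apply: wp_weaken.
          apply: (@visitP xo base h t1 Q D) => //.
          have [a _] := so; have q : aframe [:: 11; 12] F' F by exact: (aframe_trans _ _ a fFB).
          exact: (aframe_trans _ _ q f2).
        exact: leqnn.
        move=> r2 F2 t2 g2 [h1 h2 r28 [t3 [Q3 [D3 [st3 inv3]]]]].
        exists h.+1, t3, Q3, D3; split=> //; first exact: (frame_trans _ _ h1 f1).
        exact: same_outside_trans h2 so.
      + by exists 0, 1, (fun=> row_leaf xo), D0; split=> //; split=> //; rewrite subn0.
    exact: leqnn.
    move=> r2 F2 t2 g2 [[j [h [t1 [Q [D [[_ r8] f1 so st inv_]]]]]] /= /eqP].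
    have [_ r9 _ _ _] := st; rewrite r8 r9 eqb0 -leqNgt => th.
    have ht : h = t1 by apply/eqP; rewrite eqn_leq (bfs_head inv_).
    rewrite ht in inv_; have [a o] := so.
    have aF : aframe [:: 11; 12] F2 F by exact: (aframe_trans _ _ a fFB).
    have r26 : r2 6 = x by rewrite f1.
    apply: wp_weaken.
      apply: (@outputP xo base t1 Q D) => //.
      exact: (aframe_trans _ _ aF f2).
    exact: leqnn.
    move=> r3 F3 t3 g3 [k1 k2 k3 k4]; split; first by rewrite k1.
    split.
    + have q : aframe [:: 0; 11; 12] F3 F by exact: (aframe_trans _ _ k2 aF).
      exact: (aframe_trans _ _ q f2).
    + move=> k kb; rewrite k2 // o; last first.
        by apply/orP; right; move: kb; rewrite mulSn -/base; lia.
      rewrite /FB /FA /set_array /=; case: eqP => [kE|_].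
        by move: kb; rewrite kE lE mulSn -/base; lia.
      by apply: F11; move: kb; rewrite mulSn; lia.
    + move=> x' y; rewrite ltnS leq_eqVlt => /orP[/eqP xx|xx].
        by have -> : x' = xo by [apply: val_inj]; exact: k3.
      rewrite k4; last first.
        have := idx_lt (ltn_ord x') (ltn_ord y); have : x'.+1 * n <= x * n by rewrite leq_mul2r xx orbT.
        by rewrite mulSn /=; have := ltn_ord y; lia.
      by rewrite aF //; exact: F0.
  by lia.
Qed.

End Search.
End Program.

(** * The parameters and the whole program *)

(** Initialisation cannot keep the parameter registers fixed, so the whole program is run under an
    invariant on register 0 only; the stronger one holds once the parameters are set. *)
Lemma wp_change w B (G G' : (nat -> nat) -> Prop) c k r F t Q :
  (forall r', G r' -> G' r') -> G r -> wp w B G c k r F t Q -> wp w B G' c k r F t Q.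
Proof.
move=> GG g H _ m mF; have [j [r' [m' [F' [t' [jk E mF' g' q]]]]]] := H g m mF.
by exists j, r', m', F', t'; split=> //; exact: GG.
Qed.

Definition main_code : cmd := (rounds_code;; tree_code;; search_code)%C.

Section Main.
Variables (w n B N L s T : nat) (e : rel 'I_n).
Local Notation W := (2 ^ w).
Hypotheses (W_gt1 : 1 < W) (B_gt0 : 0 < B) (BW : 16 * B <= W).
Hypotheses (n_gt0 : 0 < n) (nN : n < N) (NB : N * N * N * 8 <= B).
Hypothesis stamps : (T * s.+1 + 2) * N * 2 <= B.
Hypothesis s_le_N : s <= N.
Hypothesis T_lt : T.+1 < W.
Hypotheses (NE : N = 2 ^ L) (L_gt0 : 0 < L).

Definition cost_main (M : nat) : nat :=
  cost_rounds n s T + (n * (n * 4 + 20) + N * (n * 20 + 10) + 10) + (n * (M * 41 + n * 8 + 40) + 3) + 2.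

(** The tape matters only through [M], a bound on the nodes that may use the convexity of the
    clusters of all rounds in the vertex order. *)
Lemma mainP M ra (Fa : nat -> nat -> nat) ta :
  (forall i j, i < n -> j < n -> Fa 0 (i * n + j) = adj e i j) ->
  (forall k i, 0 < k < 16 -> i < B -> Fa k i = 0) ->
  (forall (pos : 'I_n -> nat) C, injective pos -> (forall u, pos u < n) ->
     (forall j, j <= T -> forall y, convex pos (cluster (rep_at e N s id ta j) y)) ->
     codes e L pos C -> (\sum_(b < 2 * 2 ^ L) size (nodes n L C b)).+1 <= M) ->
  wp w B (globals n B N L s T) main_code (cost_main M) ra Fa ta (fun r F t =>
    forall x y : 'I_n, F 0 (n * n + (x * n + y)) = odflt n (distance e x y)).
Proof.
move=> inp zero vis.
apply: wp_le.
  apply: wp_seq; apply: wp_weaken; [exact: (roundsP W_gt1 B_gt0 BW n_gt0 nN NB stamps s_le_N T_lt ta inp zero)|exact: leqnn|].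
  move=> r F t g [f1 inj lt cvx].
  pose pos (u : 'I_n) := F 2 u.
  have inpF : holds_input e F by move=> i j i_n jn; rewrite f1 // inp.
  have z9 k : k < B -> F 9 k = 0 by move=> kB; rewrite f1 // zero.
  have z10 k : k < B -> F 10 k = 0 by move=> kB; rewrite f1 // zero.
  have z11 k : k < B -> F 11 k = 0 by move=> kB; rewrite f1 // zero.
  apply: wp_seq; apply: wp_weaken.
    exact: (treeP W_gt1 B_gt0 BW n_gt0 nN NB stamps s_le_N T_lt NE _ inpF (fun u => erefl (pos u)) lt inj z9 z10).
  exact: leqnn.
  move=> r2 F2 t2 g2 [h1 h2 h3].
  have F22 (u : 'I_n) : F2 2 u = pos u by rewrite h1.
  have z11' k : k < B -> F2 11 k = 0 by rewrite h1 //; exact: z11.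
  apply: wp_weaken.
    exact: (searchP W_gt1 B_gt0 BW n_gt0 nN NB stamps s_le_N T_lt NE lt inj F22 h2 L_gt0 h3 _ z11').
  - apply: (_ : _ <= n * (M * 41 + n * 8 + 40) + 3).
    rewrite /cost_search leq_add2r leq_mul2l !leq_add2r leq_mul2r /=; apply/orP; right.
    exact: (vis pos).
  - by move=> r3 F3 t3 g3 q x y; exact: q.
rewrite /cost_main; lia.
Qed.

End Main.

(** * Computing the parameters from the number of vertices *)

Section Init.
Variables (K C E : nat).

(** Register 5 serves twice, for the power of two near the cube root and then for the number of
    rounds. Register 1 becomes [N ^ E], the size of each array. *)
Definition init_code : cmd :=
  (2 ::= #1;; 3 ::= #0;;
   while (%2 < %0 + #1) (2 ::= %2 + %2;; 3 ::= %3 + #1);;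
   5 ::= #1;;
   while ((%5 < %2) * (%5 * %5 * %5 < #K * %0)) (5 ::= %5 + %5);;
   4 ::= %2 %/ %5;;
   1 ::= #1;; 7 ::= #E;;
   for_loop 6 7 (1 ::= %1 * %2);;
   5 ::= #(8 * C) * (%4 * %3))%C.

Variables (w n : nat).
Local Notation W := (2 ^ w).

Definition size_log : nat := (trunc_log 2 n).+1.
Local Notation L := size_log.
Local Notation N := (2 ^ L).

(* [2 ^ scale] is about the cube root of [n], capped by [N]. *)
Definition scale_cond (a : nat) : bool := (2 ^ a < N) && (2 ^ a * 2 ^ a * 2 ^ a < K * n).
Definition scale : nat := find (predC scale_cond) (iota 0 L).
Definition sample_size : nat := N %/ 2 ^ scale.
Definition round_count : nat := 8 * C * (sample_size * L).

Lemma scale_le : scale <= L.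
Proof. by apply: leq_trans (find_size _ _) _; rewrite size_iota. Qed.

Lemma scale_stop : ~~ scale_cond scale.
Proof.
have := scale_le; rewrite leq_eqVlt => /orP[/eqP E1|lt]; first by rewrite /scale_cond E1 ltnn.
have h : has (predC scale_cond) (iota 0 L) by rewrite has_find size_iota.
by have := nth_find 0 h; rewrite nth_iota.
Qed.

Lemma scale_before a : a < scale -> scale_cond a.
Proof.
move=> lt; have := before_find 0 lt; rewrite nth_iota ?add0n; last exact: leq_trans lt scale_le.
by move/negbFE.
Qed.

Hypotheses (n_gt1 : 1 < n) (E_ge3 : 2 < E) (W_gt1 : 1 < W).
Hypotheses (KW : K * N < W) (EW : E < W) (CW : 8 * C * (N * L) < W) (NW : 16 * N ^ E <= W).

Lemma n_lt_N : n < N.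
Proof. exact: trunc_log_ltn. Qed.

Lemma exp_size_log l : (2 ^ l <= n) = (l < L).
Proof.
apply/idP/idP => [ln|lL]; first by rewrite -(ltn_exp2l _ _ (isT : 1 < 2)) (leq_ltn_trans ln n_lt_N).
by apply: leq_trans (trunc_logP (isT : 1 < 2) (ltnW n_gt1)); rewrite leq_exp2l.
Qed.

Lemma sample_size_le : sample_size <= N.
Proof. exact: leq_div. Qed.

Definition cost_init : nat := L * 6 + E * 4 + 40.

Lemma initP F t r : r 0 = n ->
  wp w (N ^ E) (fun r => r 0 = n) init_code cost_init r F t (fun r' F' t' =>
    [/\ globals n (N ^ E) N L sample_size round_count r', F' = F & t' = t]).
Proof.
move=> _.
have N1 : 1 < N by rewrite -{1}(expn0 2) ltn_exp2l.
have B0 : 0 < N ^ E by rewrite !expn_gt0.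
have Np i : i <= E -> N ^ i <= N ^ E by move=> iE; rewrite leq_exp2l.
have N1E := Np 1 ltac:(lia); rewrite expn1 in N1E.
have N3E : N * N * N <= N ^ E by have := Np 3 E_ge3; rewrite !expnS expn0 muln1 mulnA.
have nN := n_lt_N.
pose G (r : nat -> nat) := r 0 = n.
have asg i x r1 (F1 : nat -> nat -> nat) t1 (Q : _ -> _ -> _ -> Prop) : 0 < i -> safe w (N ^ E) r1 F1 x ->
    Q (update r1 i (aeval r1 F1 x)) F1 t1 -> wp w (N ^ E) G (assign i x) 1 r1 F1 t1 Q.
  move=> i0 sx q; apply: wp_assign => // v g; rewrite /G /update; case: eqP => // E0.
  by rewrite -E0 in i0.
have whl x c k (I : nat -> _ -> _ -> _ -> Prop) j r1 F1 t1 :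
  (forall j r F t, G r -> I j r F t -> safe w (N ^ E) r F x /\
     (aeval r F x != 0 -> exists2 j', j = j'.+1 & wp w (N ^ E) G c k r F t (I j'))) ->
  I j r1 F1 t1 ->
  wp w (N ^ E) G (while x c) (j * k.+1).+1 r1 F1 t1
    (fun r' F' t' => (exists j', I j' r' F' t') /\ aeval r' F' x = 0) by exact: wp_while.
apply: wp_le.
  apply: wp_seq; apply: (asg) => //.
  rewrite [aeval _ _ _]/=; set ra := update r 2 1.
  apply: wp_seq; apply: (asg) => //; first by rewrite /=; lia.
  rewrite [aeval _ _ _]/=; set rb := update ra 3 0.
  pose I1 j (r1 : nat -> nat) F1 t1 := exists2 l, l <= L & [/\ j = L - l, r1 2 = 2 ^ l, r1 3 = l & F1 = F /\ t1 = t].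
  apply: wp_seq; apply: wp_weaken.
    apply: (@whl _ _ 3 I1 L) => [j r1 F1 t1 g [l lL [-> r2 r3 [-> ->]]]|].
      have p2 : 2 ^ l <= N by rewrite leq_exp2l.
      have LN : L < N by exact: ltn_expl.
      split; first by rewrite /= (g : r1 0 = n); do ![split=> //]; lia.
      rewrite /= r2 (g : r1 0 = n) bool_neq0 addn1 ltnS exp_size_log => lL'.
      exists (L - l.+1); first by lia.
      have p2' : 2 ^ l + 2 ^ l <= N by rewrite addnn -mul2n -expnS leq_exp2l.
      apply: (wp_le (k := (1 + 1).+1)) => //; apply: wp_seq; apply: (asg) => //.
        by rewrite /= r2; do ![split=> //]; lia.
      rewrite /= r2; apply: (asg) => //.
        by rewrite /= -[update r1 2 _ 3]/(r1 3) r3; do ![split=> //]; lia.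
      rewrite /= -[update r1 2 _ 3]/(r1 3) r3; exists l.+1 => //; split=> //.
      - by rewrite -[LHS]/(2 ^ l + 2 ^ l) addnn -mul2n -expnS.
      - by rewrite -[LHS]/(l + 1) addn1.
    by exists 0; rewrite // subn0.
  exact: leqnn.
  move=> r1 F1 t1 g [[j [l lL [_ r2 r3 [-> ->]]]]] /=.
  rewrite r2 (g : r1 0 = n) => /eqP; rewrite eqb0 addn1 ltnS exp_size_log => lL'.
  have {lL lL'} lL : l = L by lia.
  rewrite lL in r2 r3.
  apply: wp_seq; apply: (asg) => //.
  rewrite [aeval _ _ _]/=; set rc := update r1 5 1.
  pose I2 j (r2 : nat -> nat) F1 t1 := exists2 a, a <= scale &
    [/\ j = scale - a, r2 5 = 2 ^ a, r2 2 = N & r2 3 = L /\ (F1 = F /\ t1 = t)].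
  have KnW : K * n < W by apply: leq_ltn_trans KW; rewrite leq_mul2l ltnW ?orbT.
  apply: wp_seq; apply: wp_weaken.
    apply: (@whl _ _ 1 I2 scale) => [j' r' F' t' g' [a al [-> r5 r'2 [r'3 [-> ->]]]]|].
      have p2 : 2 ^ a <= N by rewrite leq_exp2l // (leq_trans al scale_le).
      have p22 : 2 ^ a * 2 ^ a <= N * N by rewrite leq_mul.
      have p3 : 2 ^ a * 2 ^ a * 2 ^ a <= N * N * N by rewrite leq_mul.
      have NNE : N * N <= N * N * N by rewrite leq_pmulr // ltnW.
      split.
        rewrite /= (g' : r' 0 = n) r5 r'2; do ![split=> //]; try lia.
          by apply: leq_ltn_trans KW; rewrite leq_pmulr // ltnW.
      rewrite /= (g' : r' 0 = n) r5 r'2 mulnb bool_neq0 -/(scale_cond a) => sc.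
      have al' : a < scale.
        by rewrite ltn_neqAle al andbT; apply: contraTneq sc => ->; exact: scale_stop.
      exists (scale - a.+1); first by lia.
      have p2' : 2 ^ a + 2 ^ a <= N by rewrite addnn -mul2n -expnS leq_exp2l // (leq_trans al' scale_le).
      apply: (asg) => //; first by rewrite /= r5; do ![split=> //]; lia.
      rewrite /= r5; exists a.+1 => //; split=> //.
      by rewrite -[LHS]/(2 ^ a + 2 ^ a) addnn -mul2n -expnS.
    by exists 0; rewrite // subn0.
  exact: leqnn.
  move=> r' F' t' g' [[j' [a al [_ r'5 r'2 [r'3 [-> ->]]]]]] /=.
  rewrite (g' : r' 0 = n) r'5 r'2 mulnb => /eqP; rewrite eqb0 -/(scale_cond a) => sc.
  have {al sc} aE : a = scale.
    by apply/eqP; rewrite eqn_leq al leqNgt; apply: contra sc; exact: scale_before.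
  rewrite aE in r'5.
  apply: wp_seq; apply: (asg) => //.
  rewrite /= r'2 r'5 -/sample_size; set rd := update r' 4 _.
  apply: wp_seq; apply: (asg) => //.
  rewrite [aeval _ _ _]/=; set re := update rd 1 1.
  apply: wp_seq; apply: (asg) => //.
  rewrite [aeval _ _ _]/=; set rf := update re 7 E.
  pose I3 i (r2 : nat -> nat) F1 t1 := [/\ r2 7 = E /\ r2 1 = N ^ i, r2 2 = N, r2 3 = L, r2 4 = sample_size & F1 = F /\ t1 = t].
  apply: wp_seq; apply: (wp_weaken (Q := I3 E)).
    apply: (@wp_for _ _ _ _ _ _ 6 7 _ 1 E I3) => //.
    - by move=> i r3' F3 t3 _ [[]].
    - move=> i r3' F3 t3 g3 iE r6 [[r7 r1'] r22 r33 r4 [-> ->]].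
      have Ni : N ^ i * N <= N ^ E by rewrite -expnSr; apply: Np.
      apply: (asg) => //; first by rewrite /= r1' r22; do ![split=> //]; lia.
      rewrite /= r1' r22 -expnSr; split; first by rewrite -[LHS]/(r3' 6).
      by split.
  exact: leqnn.
  move=> r4 F4 t4 g4 [[_ q1] q2 q3 q4 [-> ->]].
  have sL : sample_size * L <= N * L by rewrite leq_mul2r sample_size_le orbT.
  have LN : L < N by exact: ltn_expl.
  have CsL : 8 * C * (sample_size * L) <= 8 * C * (N * L) by rewrite leq_mul2l sL orbT.
  have NLN : N * L <= N * N by rewrite leq_mul2l ltnW ?orbT.
  have NNE : N * N <= N * N * N by rewrite leq_pmulr // ltnW.
  apply: (asg) => //.
    rewrite /= q3 q4; do ![split=> //]; try lia.
    by apply: leq_ltn_trans CW; rewrite leq_pmulr // muln_gt0 ltnW.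
  rewrite /= q3 q4 -/round_count; split=> // i.
  by case: i => [|[|[|[|[|[|]]]]]] // _; rewrite /update /=.
rewrite /cost_init; have := scale_le; lia.
Qed.

End Init.

Lemma expn3 x : x * x * x = x ^ 3.
Proof. by rewrite !expnS expn0 muln1 mulnA. Qed.

(** * Array size, word size and the complete program *)

Section Solve.
Variables (K C D : nat).
Hypothesis C_gt0 : 0 < C.

(** The time stamps need at most [36 * C * N ^ 4] cells of array 5; [C <= N ^ C] and [36 <= N ^ 3]
    bring this below [N ^ (C + 7)]. *)
Definition array_exp : nat := C + 8.
(** [N ^ (E + 2)] covers 16 arrays because [N >= 4], and [N ^ K.+1] exceeds [K * N], a bound for the
    product in the search of the cube root. *)
Definition kappa : nat := K + array_exp + 2.
Definition program : cmd := CSeq (init_code K C array_exp) main_code.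

Variable n : nat.
Hypothesis n_gt1 : 1 < n.
Local Notation L := (size_log n).
Local Notation N := (2 ^ L).
Local Notation s := (sample_size K n).
Local Notation T := (round_count K C n).
Local Notation E := array_exp.

(** With [q = 2 ^ scale K n] and [s * q = N], rows that differ on more columns agree on a sample
    with probability at most [(1 - D * L * q / N) ^ s <= exp (- D * L)]. *)
Definition threshold : nat := D * (L * 2 ^ scale K n).
(** The summands stand for the index 0, which is no block, for the full patterns, for the mixed ones
    and, by the successor, for the source of the search. *)
Definition node_bound : nat := (n + (2 * N + n * (threshold * (4 * L.+1)))).+1.
Definition run_time : nat := (cost_init E n + cost_main n N s T node_bound).+1.

Lemma N_ge4 : 4 <= N.
Proof.
by rewrite -[4]/(2 ^ 2) leq_exp2l // -exp_size_log.
Qed.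

Lemma word_sizeE : 2 ^ word_size kappa n = N ^ kappa.
Proof. by rewrite /word_size -/L mulnC expnM. Qed.

Lemma le_expN a : a <= N ^ a.
Proof. by apply: ltnW; apply: ltn_expl; exact: leq_trans N_ge4. Qed.

Lemma exp_le a b : a <= b -> N ^ a <= N ^ b.
Proof. by move=> ab; rewrite leq_exp2l //; exact: leq_trans N_ge4. Qed.

Lemma stamps_le : (T * s.+1 + 2) * N * 2 <= N ^ E.
Proof.
have N4 := N_ge4; have sN : s <= N := leq_div _ _.
have LN : L < N by exact: ltn_expl.
apply: (@leq_trans (N ^ C * (N * N * N) * (N * N * N * N))); last first.
  by rewrite expn3 -expnSr -!expnD exp_le // /array_exp; lia.
have CN := le_expN C.
have T_le : T <= 8 * C * (N * N) by rewrite /round_count leq_mul2l leq_mul ?orbT // ltnW.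
have h1 : T * s.+1 + 2 <= 18 * C * (N * N * N).
  have : T * s.+1 <= 8 * C * (N * N) * (2 * N) by rewrite leq_mul //; lia.
  have : 1 <= C * (N * N * N) by rewrite !muln_gt0 C_gt0; lia.
  by lia.
apply: (@leq_trans (18 * C * (N * N * N) * N * 2)); first by rewrite !leq_mul2r h1 !orbT.
have h3 : 36 <= N * N * N by nia.
apply: (@leq_trans (C * 36 * (N * N * N * N))); first by lia.
by apply: leq_mul => //; apply: leq_mul.
Qed.

Lemma NNN_le : N * N * N * 8 <= N ^ E.
Proof.
have N4 := N_ge4; apply: (@leq_trans (N * N * N * (N * N))); first by rewrite leq_mul2l; nia.
by rewrite expn3 mulnn -expnD exp_le // /array_exp; lia.
Qed.

Lemma program_params : [/\ K * N < N ^ kappa, E < N ^ kappa, 8 * C * (N * L) < N ^ kappa,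
  16 * N ^ E <= N ^ kappa & T.+1 < N ^ kappa].
Proof.
have N4 := N_ge4; have N1 : 1 < N by lia.
have LN : L < N by exact: ltn_expl.
have sN : s <= N := leq_div _ _.
have big a b : a < N ^ b -> b <= kappa -> a < N ^ kappa.
  by move=> ab bk; apply: leq_trans ab _; exact: exp_le.
have E8 : 8 * C * (N * N) < N ^ E.
  apply: (@leq_ltn_trans (N ^ C * (N * N) * (N * N))).
    by rewrite leq_mul // mulnC leq_mul ?le_expN //; nia.
  by rewrite mulnn -!expnD ltn_exp2l // /array_exp; lia.
have N16 : 16 * N ^ E <= N ^ (E + 2) by rewrite expnD mulnC leq_mul2l; apply/orP; right; rewrite -[16]/(4 ^ 2) leq_exp2r.
split.
- apply: (big _ K.+1); last by rewrite /kappa; lia.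
  by rewrite expnSr ltn_mul2r (ltn_expl _ N1); lia.
- by apply: (big _ E); [exact: ltn_expl|rewrite /kappa; lia].
- apply: (big _ E); last by rewrite /kappa; lia.
  by apply: leq_ltn_trans E8; rewrite !leq_mul2l ltnW ?orbT.
- by apply: leq_trans N16 _; apply: exp_le; rewrite /kappa; lia.
- apply: (big _ (E + 2)); last by rewrite /kappa; lia.
  apply: leq_trans N16; apply: (@leq_ltn_trans (N ^ E)); last by rewrite ltn_Pmull ?expn_gt0 ?(ltnW N1).
  apply: leq_trans E8; rewrite ltnS /round_count leq_mul2l leq_mul ?orbT //; exact: ltnW.
Qed.

Lemma program_solves (e : rel 'I_n) (ta : seq nat) :
  (forall (pos : 'I_n -> nat) F, injective pos -> (forall u, pos u < n) ->
     (forall j, j <= T -> forall y, convex pos (cluster (rep_at e N s id ta j) y)) ->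
     codes e L pos F -> (\sum_(b < 2 * N) size (nodes n L F b)).+1 <= node_bound) ->
  apsp_solved program (word_size kappa n) e run_time ta.
Proof.
move=> vis; have [p1 p2 p3 p4 p5] := program_params; rewrite -word_sizeE in p1 p2 p3 p4 p5.
set w := word_size kappa n in p1 p2 p3 p4 p5 *.
have N4 := N_ge4; have nN : n < N := n_lt_N n; have n0 : 0 < n := ltnW n_gt1.
have B0 : 0 < N ^ E by rewrite !expn_gt0.
have W1 : 1 < 2 ^ w by have := expn_gt0 N E; lia.
have NE8 := NNN_le.
have nnB : n * n + n * n <= N ^ E.
  have : n * n <= N * N by rewrite leq_mul // ltnW.
  by move: NE8; nia.
pose F0 k i := input_mem e (k * N ^ E + i).
have inp i j : i < n -> j < n -> F0 0 (i * n + j) = adj e i j.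
  move=> i_n jn; rewrite /F0 mul0n add0n /input_mem /adj; congr nat_of_bool.
  apply/existsP/existsP => [[x /existsP[y /andP[/eqP E1 exy]]]|[x /existsP[y /and3P[/eqP E1 /eqP E2 exy]]]]; exists x; apply/existsP; exists y.
    have E2 : i = x by have := congr1 (divn^~ n) E1; rewrite /= !divnMDl // !divn_small // !addn0.
    have E3 : j = y by have := congr1 (modn^~ n) E1; rewrite /= !modnMDl !modn_small.
    by rewrite exy E2 E3 !eqxx.
  by rewrite -E1 -E2 eqxx exy.
have zero k i : 0 < k < 16 -> i < N ^ E -> F0 k i = 0.
  move=> /andP[k0 _] iB; rewrite /F0 /input_mem; case: existsP => // -[x /existsP[y /andP[/eqP E1 _]]].
  have := idx_lt (ltn_ord x) (ltn_ord y); rewrite -E1.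
  have : N ^ E <= k * N ^ E by rewrite leq_pmull.
  by lia.
have rep0 : represents (N ^ E) (input_mem e) F0 by [].
have H : wp w (N ^ E) (fun r => r 0 = n) program run_time (input_reg n) F0 ta (fun r F t =>
    forall x y : 'I_n, F 0 (n * n + (x * n + y)) = odflt n (distance e x y)).
  apply: wp_le.
    apply: wp_seq; apply: wp_weaken.
      by apply: (initP (K := K) (C := C) (E := E)) => //; rewrite /array_exp; lia.
    exact: leqnn.
    move=> r F t g [gl -> ->].
    apply: (wp_change (G := globals n (N ^ E) N L s T)) => //.
      by move=> r' g'; rewrite (g' 0).
    apply: mainP => //; [exact: stamps_le|exact: leq_div|exact: vis].
  by rewrite /run_time.
have [j [r' [m' [F' [t' [jk it mF _ q]]]]]] := H erefl _ rep0.
(* A halted configuration is a fixed point of [step], so the steps left over change nothing. *)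
have halt k : iter k (step w) (Config [::] r' m' t') = Config [::] r' m' t' by elim: k => //= k ->.
rewrite /apsp_solved /init -(subnK jk) iterD it halt /=; apply/forallP => x; apply/forallP => y.
apply/eqP; rewrite -q -mF //.
by have := idx_lt (ltn_ord x) (ltn_ord y); lia.
Qed.

End Solve.

(** * Number of nodes on a favourable tape *)

Section NodeBound.
Variables (n : nat) (e : rel 'I_n) (L s T D : nat) (ta : seq nat).
Local Notation N := (2 ^ L).
Hypotheses (n_gt0 : 0 < n) (nN : n < N) (L_gt0 : 0 < L) (sym_e : symmetric e).
Variables (pos : 'I_n -> nat) (F : nat -> nat -> nat).
Hypotheses (pos_inj : injective pos) (pos_lt : forall u, pos u < n) (HF : codes e L pos F).

(** Valid on every tape; it settles the sizes for which [q] reaches [N]. *)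
Lemma nodes_trivial : \sum_(b < 2 * N) size (nodes n L F b) <= 2 * N * n.
Proof.
rewrite -[X in _ <= X * n]card_ord -sum_nat_const; apply: leq_sum => b _.
apply: leq_trans (size_undup _) _; rewrite size_map size_filter.
by apply: leq_trans (count_size _ _) _; rewrite -cardE card_ord.
Qed.

Lemma nodes_few :
  (forall j, j <= T -> forall y, convex pos (cluster (rep_at e N s id ta j) y)) ->
  ~~ bad_run e N s D id ta T -> #|alive (rep_at e N s id ta T)| = 1 ->
  \sum_(b < 2 * N) size (nodes n L F b) <= n + (2 * N + n * (D * (4 * L.+1))).
Proof.
move=> cvx good one.
have posN u : pos u < N by exact: ltn_trans nN.
have idr j : forall u, rep_at e N s id ta j u \in alive (rep_at e N s id ta j).
  by apply: rep_at_idem => u; rewrite inE.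
have := @mixed_chain _ e L pos sym_e (rep_at e N s id ta)
  (fun j => leader e (rep_at e N s id ta j) (samples N s ta j)) D.
move=> /(_ (fun=> erefl) (fun _ _ => erefl) idr) H.
have {}H : \sum_(b < 2 * N) #|mixed L pos setT e b| <= n * (D * (4 * L.+1)).
  rewrite -[X in _ <= X * _]card_ord; apply: (H _ T) => //.
  - by move=> j u uA; have [] := leaderP e (samples N s ta j) uA.
  - by move=> j jT y; apply: cvx; exact: ltnW.
  - move=> j jT x xA; have := bad_runP good jT; rewrite negb_exists => /forallP/(_ x).
    by rewrite xA /= -leqNgt.
apply: (@leq_trans (n + \sum_(b < 2 * N) #|[set pattern L pos (e x) b | x : 'I_n] :\ set0|)); last first.
  by rewrite leq_add2l; apply: leq_trans (pattern_count _ _ _) _; rewrite leq_add2l.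
(* Index 0 is not a block and [codes] does not constrain it, so its nodes are bounded by the number
   of rows. *)
have nE : \sum_(b < 2 * N) (if b == 0 :> nat then n else 0) = n.
  rewrite -(big_mkord xpredT (fun b => if b == 0 then n else 0)) big_ltn ?muln_gt0 ?expn_gt0 //.
  by rewrite big_nat big1 ?addn0 // => -[|i].
rewrite -[X in _ <= X + _]nE -big_split; apply: leq_sum => b _ /=.
case: eqP => [_|/eqP b0].
  apply: leq_trans (leq_addr _ _); apply: leq_trans (size_undup _) _; rewrite size_map size_filter.
  by apply: leq_trans (count_size _ _) _; rewrite -cardE card_ord.
by rewrite add0n; apply: (size_nodes L_gt0 nN posN HF); rewrite lt0n b0 ltn_ord.
Qed.

End NodeBound.

From mathcomp Require Import all_order all_algebra ring lra.
Import Order.TTheory GRing.Theory Num.Theory.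

(** * Random words *)

Section Average.
Local Open Scope ring_scope.
Variable R : realFieldType.
Implicit Types (f g : seq nat -> R).

(** Expectation over [m] independent uniform words below [W]. The recursion exposes the first word,
    so that conditioning on a prefix of the tape is [avg_cat]. *)
Fixpoint avg (W m : nat) f : R :=
  if m is m'.+1 then (\sum_(a < W) avg W m' (fun s => f (nat_of_ord a :: s))) / W%:R else f [::].

Lemma avg_le W m f g : (forall s, size s = m -> f s <= g s) -> avg W m f <= avg W m g.
Proof.
elim: m f g => [|m IH] f g fg /=; first exact: fg.
rewrite ler_wpM2r ?invr_ge0 ?ler0n //; apply: ler_sum => a _; apply: IH => s sm.
by apply: fg; rewrite /= sm.
Qed.

Lemma eq_avg W m f g : (forall s, size s = m -> f s = g s) -> avg W m f = avg W m g.
Proof. by move=> fg; apply: le_anti; rewrite !avg_le // => s /fg ->. Qed.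

Lemma avgD W m f g : avg W m (fun s => f s + g s) = avg W m f + avg W m g.
Proof.
elim: m f g => [|m IH] f g //=.
by rewrite -mulrDl -big_split /=; congr (_ / _); apply: eq_bigr => a _; rewrite IH.
Qed.

Lemma avgZ W m c f : avg W m (fun s => c * f s) = c * avg W m f.
Proof.
elim: m f => [|m IH] f //=.
by rewrite mulrA mulr_sumr; congr (_ / _); apply: eq_bigr => a _; rewrite IH.
Qed.

Lemma avg_cst W m c : (0 < W)%N -> avg W m (fun _ => c) = c.
Proof.
move=> W0; elim: m => [|m IH] //=; under eq_bigr do rewrite IH.
by rewrite sumr_const card_ord -[c *+ W]mulr_natr mulfK // pnatr_eq0 -lt0n.
Qed.

Lemma avg_sum W m (I : finType) (P : pred I) (f : I -> seq nat -> R) : (0 < W)%N ->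
  avg W m (fun s => \sum_(i | P i) f i s) = \sum_(i | P i) avg W m (f i).
Proof.
move=> W0; pose r := [seq i <- index_enum I | P i].
transitivity (avg W m (fun s => \sum_(i <- r) f i s)).
  by apply: eq_avg => s _; rewrite big_filter.
rewrite -[RHS]big_filter -/r; elim: r => [|i r IH].
  by rewrite big_nil -[RHS](avg_cst m _ W0); apply: eq_avg => s _; rewrite big_nil.
by rewrite big_cons -IH -avgD; apply: eq_avg => s _; rewrite big_cons.
Qed.

Lemma avg_cat W m1 m2 f :
  avg W (m1 + m2) f = avg W m1 (fun s1 => avg W m2 (fun s2 => f (s1 ++ s2))).
Proof.
elim: m1 f => [|m1 IH] f //=.
by congr (_ / _); apply: eq_bigr => a _; rewrite IH.
Qed.

Lemma sum_modn N K (f : nat -> R) : (0 < N)%N ->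
  \sum_(a < K * N) f (a %% N)%N = K%:R * \sum_(a < N) f a.
Proof.
move=> N0; elim: K => [|K IH]; first by rewrite mul0n big_ord0 mul0r.
rewrite -natr1 mulrDl mul1r -IH -!(big_mkord xpredT (fun a => f (a %% N)%N)) -(big_mkord xpredT f).
rewrite (@big_cat_nat _ _ _ (K * N)) ?leq_mul2r ?leqnSn ?orbT //=; congr (_ + _).
rewrite mulSn addnC -{1}[(K * N)%N]add0n big_addn addKn; apply: eq_big_nat => i /andP[_ iN].
by rewrite addnC modnMDl modn_small.
Qed.

(** Each residue has [W %/ N] preimages, so reduction modulo a divisor of [W] keeps the distribution
    uniform. *)
Lemma avg_modn W N m f : (0 < W)%N -> (N %| W)%N ->
  avg W m (fun s => f (map (modn^~ N) s)) = avg N m f.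
Proof.
move=> W0 NW; have N0 : (0 < N)%N by exact: dvdn_gt0 W0 NW.
have KN : (W %/ N * N)%N = W by rewrite divnK.
elim: m f => [|m IH] f //=.
under eq_bigr do rewrite (IH (fun s => f (_ :: s))).
rewrite -KN (@sum_modn N _ (fun a => avg N m (fun s => f (a :: s)))) // natrM invfM.
rewrite mulrACA mulfV ?mul1r // pnatr_eq0; lia.
Qed.

Lemma avg_tuple W m (P : pred (seq nat)) : (0 < W)%N ->
  #|[set t : m.-tuple 'I_W | P (map (@nat_of_ord _) t)]|%:R / #|{: m.-tuple 'I_W}|%:R
  = avg W m (fun s => (P s)%:R).
Proof.
move=> W0; rewrite card_tuple card_ord.
have W0' : W%:R != 0 :> R by rewrite pnatr_eq0 -lt0n.
suff -> : #|[set t : m.-tuple 'I_W | P (map (@nat_of_ord _) t)]|%:R =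
    (W ^ m)%:R * avg W m (fun s => (P s)%:R).
  by rewrite mulrC mulKf // pnatr_eq0 -lt0n expn_gt0 W0.
have count : forall m (P : pred (seq nat)),
    #|[set t : m.-tuple 'I_W | P (map (@nat_of_ord _) t)]|%:R =
    \sum_(t : m.-tuple 'I_W) (P (map (@nat_of_ord _) t))%:R :> R.
  move=> m' P'; rewrite -sum1dep_card natr_sum big_mkcond /=.
  by apply: eq_bigr => t _; case: (P' _).
elim: m P => [|m IH] P; rewrite count.
  rewrite expn0 mul1r (bigD1 [tuple]) //= big1 ?addr0 // => t /eqP[].
  exact: tuple0.
pose h (p : 'I_W * m.-tuple 'I_W) : m.+1.-tuple 'I_W := [tuple of p.1 :: p.2].
rewrite (reindex h) /=; last first.
  exists (fun t : m.+1.-tuple 'I_W => (thead t, [tuple of behead t])) => [[a t] _|t _].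
    by congr (_, _); apply: val_inj.
  by rewrite /h /= -tuple_eta.
rewrite -(pair_bigA _ (fun a (t : m.-tuple 'I_W) => (P (nat_of_ord a :: map (@nat_of_ord _) t))%:R)) /=.
rewrite expnSr natrM mulrACA divff // mulr1.
rewrite mulr_sumr; apply: eq_bigr => a _.
by rewrite -(IH (fun s => P (nat_of_ord a :: s))) (count m (fun s => P (nat_of_ord a :: s))).
Qed.

End Average.

(** * Rounds in expectation: progress and wrong merges *)

Section Rounds.
Local Open Scope ring_scope.
Variables (R : realFieldType) (n : nat) (e : rel 'I_n) (N s : nat).
Hypotheses (n_le : (n <= N)%N) (N_gt0 : (0 < N)%N) (s_gt0 : (0 < s)%N).
Implicit Types (rep : 'I_n -> 'I_n) (ys t : seq nat).

Lemma N_neq0 : N%:R != 0 :> R. Proof. by rewrite pnatr_eq0 -lt0n. Qed.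

Lemma sum_hit (D : {set 'I_n}) :
  \sum_(a < N) ([exists z in D, z == a :> nat])%:R = #|D|%:R :> R.
Proof.
have winj : injective (widen_ord n_le) by move=> x y /(congr1 val) /= /val_inj.
rewrite -natr_sum; congr (_%:R).
rewrite (eq_bigr (fun a : 'I_N => if [exists z in D, z == a :> nat] then 1%N else 0%N)); last first.
  by move=> a _; case: ifP.
rewrite -big_mkcond /= sum1dep_card -(card_imset D winj).
apply: eq_card => a; rewrite inE; apply/existsP/imsetP => [[z /andP[zD /eqP za]]|[z zD ->]].
  by exists z => //; apply: val_inj.
by exists z; rewrite zD /=.
Qed.

(** The samples are independent, and each one misses the set of differing columns with the
    probability raised to the power [m]. *)
Lemma avg_agree rep x y m :
  avg N m (fun ys => (agree e rep ys x y)%:R) =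
  (1 - #|row_diff e (alive rep) x y|%:R / N%:R) ^+ m :> R.
Proof.
elim: m => [|m IH] //=; set D := row_diff _ _ _ _.
under eq_bigr => a _.
  rewrite (@eq_avg R _ _ _ (fun ys => (~~ [exists z in D, z == a :> nat])%:R * (agree e rep ys x y)%:R)).
    rewrite avgZ IH; over.
  by move=> ys _; rewrite -[X in X%:R = _]/(nat_of_bool (agree e rep (nat_of_ord a :: ys) x y)) agree_cons -natrM mulnb.
rewrite -mulr_suml exprS mulrAC; congr (_ * _).
rewrite (eq_bigr (fun a : 'I_N => 1 - ([exists z in D, z == a :> nat])%:R)); last first.
  by move=> a _; case: ([exists z in D, _]); rewrite ?subr0 ?subrr.
by rewrite sumrB sum_hit sumr_const card_ord mulrBl divff ?N_neq0.
Qed.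

Lemma bernoulli (x : R) m : 0 <= x <= 1 -> 1 - m%:R * x <= (1 - x) ^+ m.
Proof.
move=> /andP[x0 x1]; elim: m => [|m IH]; first by rewrite mul0r subr0.
have m0 : 0 <= m%:R :> R := ler0n _ _.
by rewrite exprSr -natr1; have : (1 - m%:R * x) * (1 - x) <= (1 - x) ^+ m * (1 - x);
  [rewrite ler_wpM2r // subr_ge0|nra].
Qed.

(** Union bound over the samples, in the form of Bernoulli's inequality. *)
Lemma avg_disagree rep x y m :
  avg N m (fun ys => (~~ agree e rep ys x y)%:R)
   <= m%:R * (#|row_diff e (alive rep) x y|%:R / N%:R) :> R.
Proof.
rewrite (@eq_avg R _ _ _ (fun ys => 1 + (-1) * (agree e rep ys x y)%:R)); last first.
  by move=> ys _; case: (agree _ _ _ _ _) => /=; rewrite ?mulr1 ?subrr ?mulr0 ?addr0.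
rewrite avgD avg_cst // avgZ avg_agree mulN1r lerBlDr -lerBlDl; apply: bernoulli.
rewrite divr_ge0 ?ler0n //= ler_pdivrMr ?ltr0n // mul1r ler_nat.
by apply: leq_trans n_le; rewrite -[X in (_ <= X)%N]card_ord max_card.
Qed.

(* Delete near twins from the alive set one by one: the twins of the first [k] steps
   differ on at most [d + 2 + k] alive columns, and are told apart by the sample with
   probability at most 1/2. *)
Lemma avg_leaders d k rep (U : {set 'I_n}) j : (sd e <= d)%N ->
  (2 * (s * (d + 2 + k)) <= N)%N ->
  U \subset alive rep -> (#|alive rep :\: U| + j <= k)%N -> (j < #|U|)%N ->
  avg N s (fun ys => #|leader e rep ys @: U|%:R) <= #|U|%:R - j%:R / 2%:R :> R.
Proof.
move=> sdd sN; elim: j U => [|j IH] U UA Uk jU.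
  rewrite mul0r subr0 -[X in _ <= X](avg_cst s _ N_gt0); apply: avg_le => ys _.
  by rewrite ler_nat leq_imset_card.
have [w [q [wU qU wq dwq]]] := near_twins sdd UA (leq_ltn_trans (ltn0Sn j) jU).
have cU := cardsD1 w U; rewrite wU add1n in cU.
have -> : #|U|%:R - j.+1%:R / 2 = (#|U :\ w|%:R - j%:R / 2) + 1 / 2 :> R.
  by rewrite cU -!natr1; field.
apply: (le_trans (@avg_le R _ _ _ (fun ys => #|leader e rep ys @: (U :\ w)|%:R +
    (~~ agree e rep ys w q)%:R) _)).
  by move=> ys _; rewrite -natrD ler_nat leader_imset_del.
rewrite avgD lerD //.
  apply: IH; first by apply: subset_trans UA; exact: subD1set.
  - have : (#|alive rep :\: (U :\ w)| <= #|alive rep :\: U| + 1)%N.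
      rewrite -(cards1 w); apply: leq_trans (leq_card_setU _ _); apply: subset_leq_card.
      by apply/subsetP => z; rewrite !inE; case: (z == w) => /=; rewrite ?orbT ?orbF.
    lia.
  - by move: jU; rewrite cU.
apply: le_trans (avg_disagree _ _ _ _) _.
rewrite mulrA ler_pdivrMr ?ltr0n // -natrM.
suff : (2 * (s * #|row_diff e (alive rep) w q|) <= N)%N.
  by rewrite -(ler_nat R) [(2 * _)%N%:R]natrM; lra.
apply: leq_trans sN; rewrite leq_mul2l /= leq_mul2l; apply/orP; right.
apply: leq_trans dwq _; lia.
Qed.

(** Each deletion loses half a class on average, and [minn m.-1 k] deletions are possible. This is
    at least the fraction [k / N] of [m.-1], because [m] and [k] are at most [N]. *)
Lemma avg_progress d k rep : (sd e <= d)%N -> (2 * (s * (d + 2 + k)) <= N)%N -> (k <= N)%N ->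
  (forall u, rep u \in alive rep) -> (0 < #|alive rep|)%N ->
  avg N s (fun ys => #|alive (merge_reps e rep ys)|%:R - 1)
    <= (#|alive rep|%:R - 1) * (1 - k%:R / (2%:R * N%:R)) :> R.
Proof.
move=> sdd sN kN idr A0; set m := #|alive rep| in A0 *.
rewrite avgD avg_cst // (@eq_avg R _ _ _ (fun ys => #|leader e rep ys @: alive rep|%:R)); last first.
  by move=> ys _; rewrite alive_merge.
pose j := minn m.-1 k.
have : avg N s (fun ys => #|leader e rep ys @: alive rep|%:R) <= m%:R - j%:R / 2%:R :> R.
  apply: (avg_leaders (k := k)) sdd sN (subxx _) _ _; first by rewrite setDv cards0 geq_minr.
  by rewrite (leq_ltn_trans (geq_minl _ _)) // prednK.
have mN : (m <= N)%N by apply: leq_trans n_le; rewrite -[X in (_ <= X)%N]card_ord max_card.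
have : (m.-1 * k <= j * N)%N.
  rewrite /j /minn; case: ltnP => _; first by rewrite leq_mul2l kN orbT.
  by rewrite mulnC leq_mul2l (leq_trans (leq_pred _) mN) orbT.
rewrite -(ler_nat R) !natrM => jk H.
have -> : m%:R = m.-1%:R + 1 :> R by rewrite natr1 prednK.
rewrite addrK; apply: le_trans (lerB H (lexx _)) _.
rewrite mulrBr mulr1; have -> : m%:R = m.-1%:R + 1 :> R by rewrite natr1 prednK.
suff : m.-1%:R * (k%:R / (2%:R * N%:R)) <= j%:R / 2 :> R by lra.
rewrite mulrA ler_pdivrMr ?mulr_gt0 ?ltr0n //; lra.
Qed.

Variables (Delta W m : nat).
Hypotheses (W_gt0 : (0 < W)%N) (NW : (N %| W)%N).

(** Conditions on the words of the first round and applies the induction to the merged clustering;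
    the [m] further words of the tape are averaged out. *)
Lemma avg_alive d k rep T : (sd e <= d)%N -> (2 * (s * (d + 2 + k)) <= N)%N -> (k <= N)%N ->
  (forall u, rep u \in alive rep) -> (0 < n)%N ->
  avg W (T * s + m) (fun t => #|alive (rep_at e N s rep t T)|%:R - 1)
    <= (#|alive rep|%:R - 1) * (1 - k%:R / (2%:R * N%:R)) ^+ T :> R.
Proof.
move=> sdd sN kN idr n0.
have rho0 : 0 <= 1 - k%:R / (2%:R * N%:R) :> R.
  by rewrite subr_ge0 ler_pdivrMr ?mul1r -?natrM ?ltr0n ?ler_nat ?muln_gt0 //; lia.
elim: T rep idr => [|T IH] rep idr; first by rewrite (avg_cst _ (#|alive rep|%:R - 1)) // mulr1.
have A0 : (0 < #|alive rep|)%N by apply/card_gt0P; exists (rep (Ordinal n0)).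
rewrite mulSn -addnA avg_cat exprS mulrA.
apply: (le_trans (y := avg W s (fun t1 => (1 - k%:R / (2%:R * N%:R)) ^+ T *
   (fun ys => #|alive (merge_reps e rep ys)|%:R - 1) (map (modn^~ N) t1)))); last first.
  rewrite avgZ (avg_modn s (fun ys => #|alive (merge_reps e rep ys)|%:R - 1)) // mulrC.
  by rewrite ler_wpM2r ?exprn_ge0 //; exact: avg_progress sdd sN kN idr A0.
apply: avg_le => t1 t1s; rewrite mulrC.
have idr1 := merge_reps_idem e (map (modn^~ N) t1) idr.
apply: le_trans (IH _ idr1).
by apply: avg_le => t2 _; rewrite rep_atSl samples_cat // drop_size_cat.
Qed.

(** Union bound over the [T] rounds and the [n * n] ordered pairs: a bad round exhibits two vertices
    that differ on more than [Delta] alive columns and yet agree on the sample. *)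
Lemma avg_bad (eps : R) rep T : 0 <= eps ->
  ((Delta < N)%N -> (1 - Delta%:R / N%:R) ^+ s <= eps) ->
  avg W (T * s + m) (fun t => (bad_run e N s Delta rep t T)%:R) <= T%:R * ((n * n)%:R * eps).
Proof.
move=> eps0 Heps.
have round rep' : avg N s (fun ys => (bad_round e Delta rep' ys)%:R) <= (n * n)%:R * eps.
  apply: (le_trans (y := avg N s (fun ys => \sum_(p : 'I_n * 'I_n)
      (Delta < #|row_diff e (alive rep') p.1 p.2|)%N%:R * (agree e rep' ys p.1 p.2)%:R))).
    apply: avg_le => ys _; have [/exists_inP[x xA xD]|_] := boolP (bad_round _ _ _ _); last first.
      by apply: sumr_ge0 => p _; rewrite mulr_ge0 ?ler0n.
    have [lA lx _] := leaderP e ys xA.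
    rewrite (bigD1 (x, leader e rep' ys x)) //= xD agree_sym lx mul1r lerDl.
    by apply: sumr_ge0 => p _; rewrite mulr_ge0 ?ler0n.
  rewrite avg_sum // -[(n * n)%N](_ : #|{: 'I_n * 'I_n}| = _)%N; last by rewrite card_prod card_ord.
  rewrite -sum1_card natr_sum mulr_suml; apply: ler_sum => p _; rewrite avgZ mul1r.
  case: ltnP => [big|_]; last by rewrite mul0r.
  have DN : (#|row_diff e (alive rep') p.1 p.2| <= N)%N.
    by apply: leq_trans n_le; rewrite -[X in (_ <= X)%N]card_ord max_card.
  rewrite mul1r avg_agree; apply: le_trans (Heps (leq_trans big DN)).
  apply: lerXn2r; rewrite ?nnegrE ?subr_ge0 ?ler_pdivrMr ?ltr0n // ?mul1r ?ler_nat //.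
    by rewrite (leq_trans (ltnW big)).
  by rewrite lerD2l lerN2 ler_wpM2r ?invr_ge0 ?ler0n // ler_nat ltnW.
elim: T rep => [|T IH] rep; first by rewrite (avg_cst _ 0) // mul0r.
rewrite mulSn -addnA avg_cat -natr1 mulrDl mul1r addrC.
apply: (le_trans (y := avg W s (fun t1 => (fun ys => (bad_round e Delta rep ys)%:R) (map (modn^~ N) t1) +
   T%:R * ((n * n)%:R * eps)))); last first.
  by rewrite avgD avg_cst // lerD2r (avg_modn s (fun ys => (bad_round e Delta rep ys)%:R)).
apply: avg_le => t1 t1s.
apply: (le_trans (y := avg W (T * s + m) (fun t2 => (bad_round e Delta rep (map (modn^~ N) t1))%:R +
   (bad_run e N s Delta (merge_reps e rep (map (modn^~ N) t1)) t2 T)%:R))); last by rewrite avgD avg_cst // lerD2l.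
apply: avg_le => t2 _; rewrite [bad_run _ _ _ _ _ _ _]/= samples_cat // drop_size_cat //.
by case: (bad_round _ _ _ _); case: (bad_run _ _ _ _ _ _ _); rewrite /= ?addr0 ?add0r ?lerDl ?ler01.
Qed.

End Rounds.

From mathcomp Require Import all_classical all_reals all_analysis.

(** * Running time and success probability *)

Section RunTime.
Variables (K C D n : nat).
Hypotheses (C_gt0 : 0 < C) (n_gt1 : 1 < n).
Local Notation L := (size_log n).
Local Notation N := (2 ^ L).
Local Notation q := (2 ^ scale K n).
Local Notation s := (sample_size K n).

Lemma sample_sizeE : s * q = N.
Proof. by rewrite divnK // dvdn_exp2l // scale_le. Qed.

Lemma sample_size_gt0 : 0 < s.
Proof. by have := expn_gt0 2 L; rewrite -sample_sizeE muln_gt0 => /andP[]. Qed.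

(** The searches cost about [L ^ 2 * (N ^ 2 * q)], the rounds about [L * (N * s ^ 2)], and all else
    is dominated. [711 = 9 * 79] comes from the rounds and [328 = 8 * 41] from the mixed patterns,
    41 being the cost of visiting a node. *)
Lemma run_time_le : run_time K C D n <=
  (4 * array_exp C + 711 * C + 328 * D + 600) * (L ^ 2 * (N ^ 2 * q + N * s ^ 2)).
Proof.
have nN : n <= N := ltnW (n_lt_N n).
have LN : L <= N by apply: ltnW; exact: ltn_expl.
have s0 := sample_size_gt0; have q0 : 0 < q by rewrite expn_gt0.
have N0 : 0 < N by rewrite expn_gt0.
have L0 : 0 < L by [].
rewrite /run_time /cost_init /cost_main /cost_rounds /node_bound /threshold /round_count.
move: (L) (N) (s) (q) (array_exp C) nN LN s0 q0 N0 L0 => l N' s' q' E nN LN s0 q0 N0 L0.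
set X1 := l ^ 2 * (N' ^ 2 * q'); set X2 := l ^ 2 * (N' * s' ^ 2).
have NX : N' ^ 2 <= X1.
  by rewrite /X1 mulnCA -[X in X <= _]muln1 leq_mul2l muln_gt0 expn_gt0 L0 q0 orbT.
have N1X : N' <= X1 by apply: leq_trans NX; rewrite -mulnn leq_pmulr.
have nnX : n * n <= X1 by apply: leq_trans NX; rewrite -mulnn leq_mul.
have NnX : N' * n <= X1 by apply: leq_trans NX; rewrite -mulnn leq_mul.
have r1 : (8 * C * (s' * l) + 1) * (s' * (10 * n + 13) + 34 * n + 22) <= 711 * C * X2.
  have h1 : 8 * C * (s' * l) + 1 <= 9 * C * (s' * l).
    have : 0 < C * (s' * l) by rewrite !muln_gt0 C_gt0 s0.
    lia.
  have h2 : s' * (10 * n + 13) + 34 * n + 22 <= 79 * (s' * N').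
    have : s' * n <= s' * N' by rewrite leq_mul2l nN orbT.
    have : s' <= s' * N' by rewrite leq_pmulr.
    have : N' <= s' * N' by rewrite leq_pmull.
    nia.
  apply: leq_trans (leq_mul h1 h2) _.
  have -> : 9 * C * (s' * l) * (79 * (s' * N')) = 711 * C * (l * (N' * s' ^ 2)) by rewrite -mulnn; lia.
  by rewrite leq_mul2l /X2 leq_mul2r -mulnn leq_pmulr // !orbT.
have M1 : n * ((n + (2 * N' + n * (D * (l * q') * (4 * l.+1)))).+1 * 41) <= (164 + 328 * D) * X1.
  have h : n * (n * (D * (l * q') * (4 * l.+1))) <= 8 * D * X1.
    have -> : n * (n * (D * (l * q') * (4 * l.+1))) = 4 * D * ((n * n) * (l * l.+1 * q')) by lia.
    have -> : 8 * D * X1 = 4 * D * ((N' * N') * (l * (2 * l) * q')) by rewrite /X1 -!mulnn; lia.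
    rewrite leq_mul2l; apply/orP; right; apply: leq_mul; first exact: leq_mul.
    rewrite leq_mul2r; apply/orP; right; rewrite leq_mul2l; lia.
  lia.
have EX : E * 4 <= 4 * E * X1 by rewrite mulnC leq_pmulr //; lia.
rewrite [l ^ 2 * _]mulnDr -/X1 -/X2; set Y := n * n in nnX.
set r := (8 * C * (s' * l)).+1 * _; have {}r1 : r <= 711 * C * X2.
  by apply: leq_trans r1; rewrite /r; lia.
rewrite [n * (_ + _ + _)]mulnDr [n * (_ + n * 8)]mulnDr.
rewrite [n * (n * 8)]mulnA [n * (n * 4 + 20)]mulnDr [n * (n * 4)]mulnA -/Y [N' * (_ + _)]mulnDr [N' * (n * 20)]mulnA.
move: (n * (_ * 41)) M1 => Z M1; move: X1 X2 r Y Z (N' * n) N1X NX nnX NnX r1 M1 EX => X1 X2 r Y Z V *.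
have : 0 <= E * X2 by []. have : 0 <= 711 * C * X1 by []. have : 0 <= D * X2 by [].
lia.
Qed.
End RunTime.

(** * Estimates of the parameters by powers of the cube root *)

Section Estimates.
Local Open Scope ring_scope.
Variables (R : realType) (n : nat).
Hypothesis n_gt1 : (1 < n)%N.
Local Notation L := (size_log n).
Local Notation N := (2 ^ L)%N.
Local Notation x := (n%:R `^ (1 / 3%:R) : R).

Lemma cbrt_ge1 : 1 <= x.
Proof. by rewrite -[X in X <= _](powRr0 n%:R) ler_powR ?ler1n ?(ltnW n_gt1) // divr_ge0. Qed.

Lemma exp_cbrt m : x ^+ m = n%:R `^ (m%:R / 3%:R).
Proof. by rewrite -powR_mulrn ?powR_ge0 // -powRrM mul1r mulrC. Qed.

Lemma cbrtK : x ^+ 3 = n%:R.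
Proof. by rewrite exp_cbrt divff ?pnatr_eq0 // powRr1. Qed.

(** [L] is at most the binary logarithm of [n] plus 1, and that logarithm is itself at least 1. *)
Lemma size_log_le : L%:R <= 2%:R / ln 2%:R * ln n%:R :> R.
Proof.
have l2 : 0 < ln 2%:R :> R by rewrite ln_gt0 // ltr1n.
have pn : (2 ^ trunc_log 2 n <= n)%N by rewrite trunc_logP // ltnW.
have h1 : (trunc_log 2 n)%:R * ln 2%:R <= ln n%:R :> R.
  by rewrite mulr_natl -lnXn // ler_ln ?posrE ?exprn_gt0 ?ltr0n ?(ltnW n_gt1) // -natrX ler_nat.
have h2 : ln 2%:R <= ln n%:R :> R by rewrite ler_ln ?posrE ?ltr0n ?(ltnW n_gt1) // ler_nat.
rewrite mulrAC ler_pdivlMr // /size_log -natr1 mulrDl mul1r; lra.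
Qed.

Lemma N_le : N%:R <= 2%:R * x ^+ 3.
Proof. by rewrite cbrtK -natrM ler_nat expnS leq_mul2l trunc_logP // ltnW. Qed.

Variable k0 : nat.
Hypothesis k0_gt0 : (0 < k0)%N.
Local Notation K := (k0 ^ 3)%N.
Local Notation q := (2 ^ scale K n)%N.
Local Notation s := (sample_size K n).

(** Unless [q] is 1, the power of two before it still passed the test, so its cube is below
    [K * n]. *)
Lemma q_le : q%:R <= 2%:R * k0%:R * x.
Proof.
have x1 := cbrt_ge1; have k1 : 1 <= k0%:R :> R by rewrite ler1n.
case E : (scale K n) => [|a]; first by rewrite expn0; nra.
have /andP[_] : scale_cond K n a by apply: scale_before; rewrite E.
rewrite expn3 => lt; rewrite expnS natrM -mulrA ler_pM2l //.
rewrite -(@ler_pXn2r _ 3) ?nnegrE ?mulr_ge0 ?ler0n ?powR_ge0 //.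
by rewrite exprMn cbrtK -!natrX -natrM ler_nat ltnW.
Qed.

(** The two reasons for the doubling to stop: the cap [N], reached only for bounded [n], or a cube
    that has reached [K * n]. *)
Lemma scale_cases : (s = 1%N /\ (N <= q)%N) \/ k0%:R * x <= q%:R.
Proof.
have /nandP[|] := scale_stop K n; rewrite -leqNgt.
  move=> Nq; left; split=> //; apply/eqP; rewrite eqn_leq sample_size_gt0 andbT.
  by have := leq_div2r q Nq; rewrite divnn expn_gt0.
rewrite expn3 => Kq; right; rewrite -(@ler_pXn2r _ 3) ?nnegrE ?mulr_ge0 ?ler0n ?powR_ge0 //.
by rewrite exprMn cbrtK -!natrX -natrM ler_nat.
Qed.

(** The search term [N ^ 2 * q] and the refinement term [N * s ^ 2 = N ^ 3 / q ^ 2] balance when [q]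
    is of the order of the cube root of [n]; this fixes the choice of [q]. *)
Lemma size_estimate :
  (N ^ 2 * q + N * s ^ 2)%:R <= (8%:R * k0%:R + 8%:R) * x ^+ 7.
Proof.
have x1 := cbrt_ge1; have k1 : 1 <= k0%:R :> R by rewrite ler1n.
have p m : 1 <= x ^+ m by rewrite exprn_ege1.
rewrite natrD [(N ^ 2 * q)%N%:R]natrM [(N * s ^ 2)%N%:R]natrM [(N ^ 2)%N%:R]natrX [(s ^ 2)%N%:R]natrX mulrDl lerD //.
  have -> : 8%:R * k0%:R * x ^+ 7 = (2%:R * x ^+ 3) ^+ 2 * (2%:R * k0%:R * x) by ring.
  apply: ler_pM; rewrite ?q_le ?exprn_ge0 ?ler0n // ler_pXn2r ?nnegrE ?ler0n ?N_le // mulr_ge0 // exprn_ge0.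
have -> : 8%:R * x ^+ 7 = (2%:R * x ^+ 3) * (2%:R * x ^+ 2) ^+ 2 by ring.
apply: ler_pM; rewrite ?N_le ?exprn_ge0 ?ler0n // ler_pXn2r ?nnegrE ?ler0n //.
have [[-> _]|kq] := scale_cases; first by have := p 2; lra.
have sx : s%:R * x <= 2%:R * x ^+ 3.
  apply: le_trans N_le; rewrite -(sample_sizeE K n) natrM ler_wpM2l ?ler0n //.
  by apply: le_trans kq; rewrite ler_peMl.
rewrite -(@ler_pM2r _ x) ?(lt_le_trans ltr01) //; apply: le_trans sx _.
by rewrite -mulrA -exprSr.
Qed.

End Estimates.

(** * Probability of failure *)

Section Success.
Local Open Scope ring_scope.
Variable R : realType.

(** From [1 - y <= exp (- y)] and [2 <= exp 1]. *)
Lemma exp_decay (y : R) m l : 0 <= y <= 1 -> l%:R <= m%:R * y -> (1 - y) ^+ m <= 2^-1 ^+ l.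
Proof.
move=> /andP[y0 y1] ly.
have le_exp : 1 - y <= expR (- y) by have := expR_ge1Dx (- y).
have e2 : 2 <= expR 1 :> R by have := expR_ge1Dx (1 : R); lra.
apply: (@le_trans _ _ (expR (- y) ^+ m)).
  by rewrite lerXn2r ?nnegrE ?subr_ge0 // expR_ge0.
rewrite -expRM_natl mulrN expRN exprVn lef_pV2 ?posrE ?expR_gt0 ?exprn_gt0 //.
apply: (@le_trans _ _ (expR 1 ^+ l)); first by rewrite lerXn2r ?nnegrE ?expR_ge0.
by rewrite -expRM_natl mulr1 ler_expR.
Qed.

Variables (b c' n : nat) (e : rel 'I_n).
Hypotheses (n_gt1 : (1 < n)%N) (sym_e : symmetric e).
Local Notation k0 := (4 * b + 8)%N.
Local Notation K := (k0 ^ 3)%N.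
Local Notation C := (c' + 2)%N.
Local Notation D := (7 + C + c')%N.
Local Notation L := (size_log n).
Local Notation N := (2 ^ L)%N.
Local Notation q := (2 ^ scale K n)%N.
Local Notation s := (sample_size K n).
Local Notation T := (round_count K C n).
Local Notation Delta := (threshold K D n).
Local Notation x := (n%:R `^ (1 / 3%:R) : R).
Local Notation W := (2 ^ word_size (kappa K C) n)%N.
Hypothesis sd_le : (sd e)%:R <= b%:R * x.

Let solved ta := apsp_solved (program K C) (word_size (kappa K C) n) e (run_time K C D n) ta.

Lemma k0_gt0 : (0 < k0)%N. Proof. by rewrite addn_gt0 orbT. Qed.
Lemma C_gt0 : (0 < C)%N. Proof. by lia. Qed.

(** When [q] reaches [N], the summand of [node_bound] for mixed patterns is at least the number of
    all pairs of a block and a row. *)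
Lemma solved_large_q ta : (N <= q)%N -> solved ta.
Proof.
move=> Nq; apply: program_solves => // [|pos F _ _ _ _]; first exact: C_gt0.
rewrite ltnS; apply: leq_trans (nodes_trivial _ _ _) _.
apply: leq_trans (leq_addl _ _); apply: leq_trans (leq_addl _ _).
rewrite mulnC leq_mul2l; apply/orP; right.
rewrite /threshold; move: (scale _ _) Nq => a Nq.
apply: (@leq_trans (2 * 2 ^ a)); first by rewrite leq_mul2l Nq orbT.
apply: (@leq_trans (D * (2 ^ a * (L * (4 * L.+1))))); last by lia.
by apply: leq_mul; [lia|exact: leq_pmulr].
Qed.

Lemma solved_good ta : ~~ bad_run e N s Delta id ta T ->
  #|alive (rep_at e N s id ta T)| = 1%N -> solved ta.
Proof.
move=> good one; apply: program_solves => // [|pos F pos_inj pos_lt cvx HF]; first exact: C_gt0.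
rewrite ltnS; exact: (nodes_few (n_lt_N n) (ltn0Sn _) sym_e pos_lt HF cvx good one).
Qed.

(** Pointwise form of the union bound and of Markov's inequality: if more than one cluster is left,
    the last term is at most -1. *)
Lemma failure_le ta :
  1 + (-1) * (bad_run e N s Delta id ta T)%:R
    + (-1) * (#|alive (rep_at e N s id ta T)|%:R - 1) <= (solved ta)%:R :> R.
Proof.
have A0 : (0 < #|alive (rep_at e N s id ta T)|)%N.
  apply/card_gt0P; exists (rep_at e N s id ta T (Ordinal (ltnW n_gt1))).
  by apply: rep_at_idem => u; rewrite inE.
have [good|bad] := boolP (~~ bad_run e N s Delta id ta T); last first.
  rewrite (negbNE bad) /=; have : 1 <= #|alive (rep_at e N s id ta T)|%:R :> R by rewrite ler1n.
  have := ler0n R (solved ta); lra.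
rewrite (negbTE good) /=.
have [one|A2] := leqP #|alive (rep_at e N s id ta T)| 1.
  have one' : #|alive (rep_at e N s id ta T)| = 1%N by apply/eqP; rewrite eqn_leq one A0.
  by rewrite (solved_good good one') one' /=; lra.
have : 2 <= #|alive (rep_at e N s id ta T)|%:R :> R by rewrite ler_nat.
have := ler0n R (solved ta); lra.
Qed.

(** The constant [k0 = 4 * b + 8] makes [q] at least [4 * (sd e + 2)], since the cube root is at
    least 1. With [k = q / 4] the sum [sd e + 2 + k] is at most [q / 2], and [s * q = N]. *)
Lemma sample_small : k0%:R * x <= q%:R ->
  exists2 k, q = (4 * k)%N & (2 * (s * (sd e + 2 + k)) <= N)%N.
Proof.
move=> xq; have x1 := cbrt_ge1 R n_gt1; have b0 := ler0n R b.
have bx : 0 <= b%:R * x by rewrite mulr_ge0 ?powR_ge0.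
have {}xq : 4 * (b%:R * x) + 8 * x <= q%:R by move: xq; rewrite natrD natrM mulrDl mulrA.
have q8 : (8 <= q)%N.
  have : 8%:R <= q%:R :> R by lra.
  by rewrite ler_nat.
have s2 : (2 <= scale K n)%N by rewrite -(@leq_exp2l 2) // (leq_trans _ q8).
exists (2 ^ (scale K n - 2))%N; first by rewrite -[4%N]/(2 ^ 2)%N -expnD subnKC.
set k := (2 ^ _)%N; have qk : q = (4 * k)%N by rewrite -[4%N]/(2 ^ 2)%N -expnD subnKC.
have dq : (4 * (sd e + 2) <= q)%N.
  have : (4 * (sd e + 2))%:R <= q%:R :> R by have := sd_le; rewrite natrM natrD; lra.
  by rewrite ler_nat.
rewrite -(sample_sizeE K n) mulnCA leq_mul2l; lia.
Qed.


(** With [q = 4 * k] the factor per round is [1 - 1 / (8 * s)], which explains the 8 in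
    [T = 8 * C * (s * L)]. *)
Lemma alive_decay k m : q = (4 * k)%N -> (2 * (s * (sd e + 2 + k)) <= N)%N -> (N %| W)%N ->
  avg W (T * s + m) (fun t => #|alive (rep_at e N s id t T)|%:R - 1)
    <= n%:R * 2^-1 ^+ (C * L) :> R.
Proof.
move=> qk sN NW; have W0 : (0 < W)%N by rewrite expn_gt0.
have nN : (n <= N)%N := ltnW (n_lt_N n); have N0 : (0 < N)%N by rewrite expn_gt0.
have s0 := sample_size_gt0 K n.
have kN : (k <= N)%N by rewrite -(sample_sizeE K n) qk; nia.
have kp : (0 < k)%N by have := expn_gt0 2 (scale K n); rewrite qk; lia.
have idr : forall u : 'I_n, id u \in alive id by move=> u; rewrite inE.
have := @avg_alive R n e N s nN N0 s0 W m W0 NW (sd e) k id T (leqnn _) sN kN idr (ltnW n_gt1).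
move=> H; apply: le_trans H _.
have -> : k%:R / (2%:R * N%:R) = (8 * s)%:R^-1 :> R.
  rewrite -(sample_sizeE K n) qk !natrM; field.
  by rewrite !pnatr_eq0 -!lt0n s0 kp.
have s1 : 1 <= (8 * s)%:R :> R by rewrite ler1n; lia.
apply: ler_pM.
- rewrite subr_ge0 ler1n; apply/card_gt0P; exists (Ordinal (ltnW n_gt1)); exact: idr.
- by rewrite exprn_ge0 // subr_ge0 invf_le1 // (lt_le_trans ltr01).
- rewrite lerBlDr; apply: (@le_trans _ _ n%:R); last by rewrite lerDl.
  by rewrite ler_nat -[X in (_ <= X)%N]card_ord max_card.
apply: exp_decay; first by rewrite invr_ge0 ler0n invf_le1 // (lt_le_trans ltr01).
rewrite ler_pdivlMr ?(lt_le_trans ltr01) // -natrM ler_nat /round_count; lia.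
Qed.

Lemma bad_decay m : (N %| W)%N ->
  avg W (T * s + m) (fun t => (bad_run e N s Delta id t T)%:R)
    <= T%:R * ((n * n)%:R * 2^-1 ^+ (D * L)) :> R.
Proof.
move=> NW; have W0 : (0 < W)%N by rewrite expn_gt0.
have nN : (n <= N)%N := ltnW (n_lt_N n); have N0 : (0 < N)%N by rewrite expn_gt0.
have s0 := sample_size_gt0 K n.
have idr : forall u : 'I_n, id u \in alive id by move=> u; rewrite inE.
apply: (@avg_bad R n e N s nN N0 Delta W m W0 NW) => [|DN].
  by rewrite exprn_ge0 // invr_ge0.
apply: exp_decay.
  by rewrite divr_ge0 ?ler0n //= ler_pdivrMr // mul1r ler_nat ltnW.
rewrite mulrA ler_pdivlMr // -!natrM ler_nat -(sample_sizeE K n) /threshold; lia.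
Qed.

Lemma half_exp m : 2^-1 ^+ (m * L) = N%:R^-1 ^+ m :> R.
Proof. by rewrite mulnC exprM !exprVn -natrX. Qed.

(** Both terms are at most [N ^ - (c' + 1)]: the first because [T * n ^ 2 <= N ^ (6 + C)] and
    [D = 7 + C + c'], the second because [n <= N] and [C = c' + 2]. The spare power of [N] pays for
    adding them. *)
Lemma failures_small :
  T%:R * ((n * n)%:R * 2^-1 ^+ (D * L)) + n%:R * 2^-1 ^+ (C * L) <= N%:R^-1 ^+ c' :> R.
Proof.
have nN : (n <= N)%N := ltnW (n_lt_N n).
have N4 := N_ge4 n_gt1; have N0 : 0 < N%:R :> R by rewrite ltr0n; lia.
have T_le : (T * (n * n) <= N ^ (6 + C))%N.
  have CN : (8 * C <= N ^ (2 + C))%N.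
    rewrite expnD; apply: leq_mul; last exact: (le_expN n_gt1 C).
    by apply: (@leq_trans (4 ^ 2)%N); rewrite ?leq_exp2r.
  have E6 : (6 + C = (2 + C) + 2 + 2)%N by lia.
  rewrite E6 2!expnD -!mulnn; apply: leq_mul; last exact: leq_mul.
  rewrite /round_count; apply: leq_mul => //; apply: leq_mul; first exact: sample_size_le.
  by apply: ltnW; exact: ltn_expl.
rewrite !half_exp mulrA -natrM; set i := N%:R^-1.
have i0 : 0 <= i by rewrite invr_ge0 ltW.
have Ni : N%:R * i = 1 by rewrite divff // gt_eqF.
have h1 : (T * (n * n))%:R * i ^+ D <= i ^+ c' * i.
  apply: (@le_trans _ _ (N%:R ^+ (6 + C) * i ^+ D)).
    by rewrite ler_wpM2r ?exprn_ge0 // -natrX ler_nat.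
  have -> : D = ((6 + C) + c'.+1)%N by lia.
  by rewrite [i ^+ (_ + _)]exprD mulrA -exprMn Ni expr1n mul1r exprSr.
have h2 : n%:R * i ^+ C <= i ^+ c' * i.
  apply: (@le_trans _ _ (N%:R * i ^+ C)); first by rewrite ler_wpM2r ?exprn_ge0 // ler_nat.
  by rewrite addn2 exprS mulrA Ni mul1r exprSr.
have p : 0 <= i ^+ c' by rewrite exprn_ge0.
have i2 : i <= 2^-1 by rewrite /i lef_pV2 ?posrE // ler_nat; lia.
apply: le_trans (lerD h1 h2) _; nra.
Qed.

Lemma dvdn_word : (N %| W)%N.
Proof.
by rewrite word_sizeE -{1}(expn1 N) dvdn_exp2l // /kappa addn2.
Qed.

(** The tape has room for all draws, as the form of [avg_alive] and [avg_bad] requires. *)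
Lemma run_time_split : exists m, run_time K C D n = (T * s + m)%N.
Proof.
exists (run_time K C D n - T * s)%N; rewrite subnKC //.
rewrite /run_time /cost_main /cost_rounds mulSn mulnDr; nia.
Qed.

Lemma success_ge : 1 - N%:R^-1 ^+ c' <=
  apsp_success R (program K C) (word_size (kappa K C) n) e (run_time K C D n).
Proof.
have W0 : (0 < W)%N by rewrite expn_gt0.
rewrite /apsp_success (avg_tuple R _ solved W0).
have [[_ Nq]|xq] := scale_cases R n k0.
  rewrite (@eq_avg R _ _ _ (fun=> 1)) ?avg_cst ?gerBl // => ta _.
  by rewrite solved_large_q.
have [k qk sN] := sample_small xq; have NW := dvdn_word.
have [m tE] := run_time_split; rewrite tE.
apply: (@le_trans _ _ (avg W (T * s + m) (fun ta =>
    1 + (-1) * (bad_run e N s Delta id ta T)%:R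
      + (-1) * (#|alive (rep_at e N s id ta T)|%:R - 1)))); last first.
  by apply: avg_le => ta _; exact: failure_le.
rewrite avgD avgZ avgD avgZ avg_cst //.
have := bad_decay m NW; have := alive_decay m qk sN NW; have := failures_small; lra.
Qed.

End Success.

Local Open Scope ring_scope.

Theorem theorem1p6 (R : realType) (beta c : R) (c_gt0 : 0 < c) :
  exists (P : cmd) (kappa : nat) (K : R) (time : nat -> nat),
    [/\ (0 < kappa)%N,
        forall n : nat, (1 < n)%N ->
          (time n)%:R <= K * n%:R `^ (7%:R / 3%:R) * ln n%:R ^+ 2
      & forall (n : nat) (e : rel 'I_n),
          (1 < n)%N -> symmetric e -> irreflexive e ->
          (sd e)%:R <= beta * n%:R `^ (1 / 3%:R) ->
          1 - n%:R `^ (- c) <=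
            apsp_success R P (word_size kappa n) e (time n)].
Proof.
(* The program contains natural constants only, so [beta] and [c] are rounded up. *)
have [b bE] : exists b : nat, beta <= b%:R.
  by exists (Num.bound `|beta|); exact: (le_trans (ler_norm _) (ltW (archi_boundP (normr_ge0 _)))).
have [c' cE] : exists c' : nat, c <= c'%:R.
  by exists (Num.bound c); apply: ltW; apply: archi_boundP; exact: ltW.
pose k0 := (4 * b + 8)%N; pose C := (c' + 2)%N; pose D := (7 + C + c')%N.
pose K0 := (4 * array_exp C + 711 * C + 328 * D + 600)%N.
exists (program (k0 ^ 3) C), (kappa (k0 ^ 3) C),
  (K0%:R * (2%:R / ln 2%:R) ^+ 2 * (8%:R * k0%:R + 8%:R)), (run_time (k0 ^ 3) C D).
split=> [|n n1|n e n1 sym_e _ sd_le]; first by rewrite /kappa addn2.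
- have C0 : (0 < C)%N by rewrite /C addn2.
  have k00 : (0 < k0)%N by rewrite /k0 addn_gt0 orbT.
  have h := run_time_le (k0 ^ 3) D C0 n1; rewrite -(ler_nat R) in h; apply: (le_trans h).
  rewrite natrM -/K0 [(size_log n ^ 2 * _)%N%:R]natrM [(size_log n ^ 2)%N%:R]natrX.
  have L2 : (size_log n)%:R ^+ 2 <= (2%:R / ln 2%:R) ^+ 2 * ln n%:R ^+ 2 :> R.
    have ll := size_log_le R n1.
    by rewrite -exprMn lerXn2r ?nnegrE ?ler0n // (le_trans _ ll).
  have := ler_pM _ _ L2 (size_estimate R n1 k00) => /(_ (sqr_ge0 _) (ler0n _ _)) H.
  apply: (le_trans (ler_wpM2l (ler0n R _) H)); rewrite exp_cbrt.
  by rewrite le_eqVlt; apply/orP; left; apply/eqP; ring.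
have sd_le' : (sd e)%:R <= b%:R * n%:R `^ (1 / 3%:R) :> R.
  by apply: le_trans sd_le _; rewrite ler_wpM2r ?powR_ge0.
apply: le_trans (success_ge c' n1 sym_e sd_le').
(* [N > n] and [c <= c'] turn [N ^ - c'] into a bound by [n ^ - c]. *)
rewrite lerD2l lerN2 powRN exprVn lef_pV2 ?posrE ?powR_gt0 ?exprn_gt0 ?ltr0n ?expn_gt0 ?(ltnW n1) //.
apply: (@le_trans _ _ (n%:R `^ c'%:R)); first by rewrite ler_powR // ler1n ltnW.
by rewrite powR_mulrn ?ler0n // lerXn2r ?nnegrE ?ler0n // ler_nat ltnW // n_lt_N.
Qed.
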